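(* Let $\delta>0$ and let $\Omega_\delta$ be a subordinator in $\mathcal B$ with Lévy density $\rho_{\Omega_\delta}(s)=\int_\delta^\infty e^{-sx}q(x)\,dx$, where $q$ is a nonnegative (measurable) function such that $q(x)\le 1$ for $x\ge\delta$. Then there is another subordinator in $\mathcal B$, say $\widehat\Omega_\delta$, with Lévy density $\rho_{\widehat\Omega_\delta}(s)=\int_\delta^\infty e^{-sx}[1-q(x)]\,dx$, such that the Lévy density of a gamma$(1)$ subordinator with scale $1/\delta$ has the decomposition $$s^{-1}e^{-s\delta}=\rho_{\widehat\Omega_\delta}(s)+\rho_{\Omega_\delta}(s).$$ Hence the gamma subordinator can be expressed (in distribution) as a sum of the independent subordinators $\Omega_\delta$ and $\widehat\Omega_\delta$, which implies that for each fixed $\theta>0$ $$\gamma_\theta/\delta\stackrel{d}{=}\widehat\Omega_\delta(\theta)+\Omega_\delta(\theta).$$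
   Context: A subordinator $\zeta$ is an increasing right-continuous process started at $0$ with stationary independent increments and zero drift, with $\mathbb{E}[e^{-\omega\zeta(t)}]=\exp\{-t\int_0^\infty(1-e^{-\omega s})\rho_\zeta(s)\,ds\}$, where $\rho_\zeta$ is its Lévy density. $\mathcal B$ is Bondesson's class: subordinators with completely monotone Lévy density, $\rho_\zeta(s)=\int_0^\infty e^{-sy}\mu(dy)$ for some nonnegative measure $\mu$. $\gamma_\theta$ is a gamma variable with shape $\theta$ and scale $1$. *)

(* Defs.v *)
From HB Require Import structures.
From mathcomp Require Import all_boot all_order all_algebra.
From mathcomp Require Import all_classical all_reals all_analysis.
From mathcomp Require Import measurable_realfun.

Set Implicit Arguments.
Unset Strict Implicit.
Unset Printing Implicit Defensive.

Import Order.TTheory GRing.Theory Num.Theory.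
Import numFieldNormedType.Exports.

Local Open Scope classical_set_scope.
Local Open Scope ring_scope.

(* A process is a function X : R -> T -> R, with X t the variable at time t;
   only the times t >= 0 are meaningful. *)
Section processes.
Context (R : realType) (d : measure_display) (T : measurableType d).
Variable P : probability T R.
Implicit Types (X Y : R -> T -> R) (rho : R -> \bar R).

(* Taking some of the A i to be setT gives the product rule for subfamilies. *)
Definition mutually_independent (n : nat) (Z : 'I_n -> T -> R) : Prop :=
  forall A : 'I_n -> set R, (forall i, measurable (A i)) ->
    P (\bigcap_(i in [set: 'I_n]) Z i @^-1` A i) =
    (\prod_(i < n) P (Z i @^-1` A i))%E.

Definition process_sigma_algebra X : set (set T) :=
  <<s [set E | exists t A, [/\ 0 <= t, measurable A & E = X t @^-1` A]] >>.

Definition independent_processes X Y : Prop :=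
  forall E F, process_sigma_algebra X E -> process_sigma_algebra Y F ->
    P (E `&` F) = (P E * P F)%E.

Definition stationary_increments X : Prop :=
  forall s h, 0 <= s -> 0 <= h -> forall A, measurable A ->
    P ((fun w => X (s + h) w - X s w) @^-1` A) = P (X h @^-1` A).

Definition independent_increments X : Prop :=
  forall (n : nat) (t : nat -> R), 0 <= t 0%N -> nondecreasing_seq t ->
    @mutually_independent n (fun i w => X (t i.+1) w - X (t i) w).

Definition increasing_levy_process X : Prop :=
  [/\ (forall t, 0 <= t -> measurable_fun setT (X t)),
      (forall w, X 0 w = 0),
      (forall w s t, 0 <= s -> s <= t -> X s w <= X t w),
      (forall w t, 0 <= t -> X u w @[u --> t^'+] --> X t w) &
      stationary_increments X /\ independent_increments X].

(* The Laplace formula has no linear term in the exponent: zero drift. It also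
   forces its exponent to be finite, i.e. min(1, s) rho(s) to be integrable. *)
Definition has_levy_density X rho : Prop :=
  [/\ measurable_fun (`]0, +oo[ : set R) rho,
      (forall s, 0 < s -> (0 <= rho s)%E) &
      forall omega t, 0 <= omega -> 0 <= t ->
        ('E_P[fun w => expR (- (omega * X t w))%R] =
         expeR (- (t%:E * \int[lebesgue_measure]_(s in (`]0%R, +oo[ : set R))
                    ((1 - expR (- (omega * s)))%:E * rho s))))%E].

Definition subordinator X rho : Prop :=
  increasing_levy_process X /\ has_levy_density X rho.

Definition bondesson X : Prop :=
  exists mu : {measure set R -> \bar R}, exists rho : R -> \bar R,
    subordinator X rho /\
    forall s, 0 < s ->
      rho s = (\int[mu]_(y in (`[0%R, +oo[ : set R)) (expR (- (s * y)))%:E)%E.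

End processes.

Section gamma.
Context (R : realType).

Definition Gamma_fun (a : R) : R :=
  Rintegral lebesgue_measure `]0, +oo[ (fun x : R => x `^ (a - 1) * expR (- x)).

Definition gamma_law (a : R) (A : set R) : \bar R :=
  (\int[lebesgue_measure]_(x in A `&` `]0%R, +oo[)
     (x `^ (a - 1) * expR (- x) / Gamma_fun a)%:E)%E.

Definition gamma_variable (d : measure_display) (T : measurableType d)
    (P : probability T R) (g : T -> R) (a : R) : Prop :=
  measurable_fun setT g /\
  forall A, measurable A -> P (g @^-1` A) = gamma_law a A.

(* gamma(1) subordinator with scale 1 / delta: its value at time t has the law
   of a gamma variable of shape t, divided by delta. *)
Definition gamma_subordinator (d : measure_display) (T : measurableType d)
    (P : probability T R) (delta : R) (G : R -> T -> R) : Prop :=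
  increasing_levy_process P G /\
  forall t, 0 < t -> forall A, measurable A ->
    P (G t @^-1` A) = gamma_law t ((fun x => x / delta) @^-1` A).

End gamma.

Section laws.
Context (R : realType) (d1 d2 : measure_display).
Context (T1 : measurableType d1) (T2 : measurableType d2).
Variables (P1 : probability T1 R) (P2 : probability T2 R).

Definition eq_law (X : T1 -> R) (Y : T2 -> R) : Prop :=
  forall A, measurable A -> P1 (X @^-1` A) = P2 (Y @^-1` A).

(* equality of all finite-dimensional distributions *)
Definition eq_process_law (X : R -> T1 -> R) (Y : R -> T2 -> R) : Prop :=
  forall (n : nat) (t : 'I_n -> R) (A : 'I_n -> set R),
    (forall i, 0 <= t i) -> (forall i, measurable (A i)) ->
    P1 (\bigcap_(i in [set: 'I_n]) X (t i) @^-1` A i) =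
    P2 (\bigcap_(i in [set: 'I_n]) Y (t i) @^-1` A i).

(* p exhibits (T1, P1) as an extension of the probability space (T2, P2):
   variables Z on T2 are identified with Z \o p on T1. *)
Definition extension_of_space (p : T1 -> T2) : Prop :=
  measurable_fun setT p /\
  forall A, measurable A -> P1 (p @^-1` A) = P2 A.

End laws.

Definition mixture_density (R : realType) (delta : R) (q : R -> R) (s : R)
    : \bar R :=
  (\int[lebesgue_measure]_(x in `[delta, +oo[) (expR (- (s * x)) * q x)%:E)%E.

(* Main.v *)
(** Integrating [expR (- (s * x))] over [x >= delta] gives [s^-1 * expR (- (s * delta))],
    so the mixtures with weights [q] and [1 - q] add up to the gamma Levy density, whose
    Laplace exponent is [ln (1 + w / delta)] by Frullani's integral: the exponents of
    [Omega] and [hatOmega] add up to that of the gamma subordinator.  A process with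
    nonnegative independent increments is determined in law by its exponent, because
    Laplace transforms determine the laws of nonnegative variables, one coordinate at a
    time.

    It remains to construct [hatOmega] independently of [Omega], on the product of the
    given space with the unit interval.  The even and odd binary digits of one uniform
    variable are two independent ones; iterating, they supply a sequence of independent
    marks (time, size, level) with exponential times and sizes.  There is a Poisson
    number of marks in each layer [j], and a mark is kept when [j + level] lies below the
    ratio of the wanted intensity to the density of the marks.  The kept marks form a
    Poisson process of jumps with intensity [rho s ds dt]; their sizes are almost surely
    summable because the exponent is at most [w / delta]. *)
Require Import Defs.
From HB Require Import structures.
From mathcomp Require Import all_boot all_order all_algebra.
From mathcomp Require Import all_classical all_reals all_analysis.
From mathcomp Require Import measurable_realfun.
From mathcomp Require Import ring lra.
Set Implicit Arguments.
Unset Strict Implicit.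
Unset Printing Implicit Defensive.
Import Order.TTheory GRing.Theory Num.Theory.
Import numFieldNormedType.Exports.
Local Open Scope classical_set_scope.
Local Open Scope ring_scope.

(** * Functions with values in the unit interval and Laplace transforms *)

(** The given space may carry no randomness beyond [Omega], which forces its extension. With the
    unit interval as second factor, all other randomness comes from Lebesgue measure, and no
    infinite product of spaces occurs. Statements about laws are routed through one identity,
    [laplace_increments]: it gives back stationarity, independence and the marginals, it adds up
    over a product of spaces, and it survives limits. Joint laws need no Laplace transform in
    several variables. An expectation of a product of test functions is, in each factor separately,
    an integral against a finite measure, so exponentials can be exchanged for indicators in that
    factor while the others are frozen. The layers answer an obstacle: the ratio of the wanted
    intensity to the density of the marks is in general unbounded, so a single Poisson number of
    marks with mean 1 cannot be thinned to the right intensity. Layer [j] takes care of the part of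
    the ratio between [j] and [j + 1]. *)

Section unit_functions.
Context d (T : measurableType d) (R : realType).
Implicit Types (f g : T -> R) (m : {measure set T -> \bar R}).

(** These test functions are integrable against every finite measure and are stable under products
    and complements to 1, which disposes of integrability conditions throughout. *)
Definition unit_fun f := measurable_fun setT f /\ forall x, 0 <= f x <= 1.

Lemma unit_fun_ge0 f : unit_fun f -> forall x, 0 <= f x.
Proof. by move=> [_ f01] x; have /andP[] := f01 x. Qed.

Lemma unit_fun_le1 f : unit_fun f -> forall x, f x <= 1.
Proof. by move=> [_ f01] x; have /andP[] := f01 x. Qed.

Lemma unit_funM f g : unit_fun f -> unit_fun g -> unit_fun (f \* g).
Proof.
move=> uf ug; split; first exact: measurable_funM uf.1 ug.1.
move=> x /=; rewrite mulr_ge0 ?unit_fun_ge0//=.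
by rewrite mulr_ile1 ?unit_fun_ge0 ?unit_fun_le1.
Qed.

Lemma unit_funB f : unit_fun f -> unit_fun (fun x => 1 - f x).
Proof.
move=> uf; split; first by apply: measurable_funB => //; exact: uf.1.
by move=> x; rewrite subr_ge0 unit_fun_le1//= gerBl unit_fun_ge0.
Qed.

Lemma unit_fun_cst (c : R) : 0 <= c <= 1 -> unit_fun (cst c).
Proof. by move=> c01; split => //; exact: measurable_cst. Qed.

Lemma unit_fun_indic (A : set T) : measurable A -> unit_fun (\1_A : T -> R).
Proof.
move=> mA; split; first exact: measurable_indic.
by move=> x; rewrite indicE; case: (_ \in _); rewrite ?ler01 ?lexx.
Qed.

Lemma unit_fun_prod (I : Type) (s : seq I) (p : pred I) (f : I -> T -> R) :
  (forall i, unit_fun (f i)) -> unit_fun (fun x => \prod_(i <- s | p i) f i x).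
Proof.
move=> uf; elim: s => [|i s ih].
  rewrite (_ : (fun x => _) = cst 1); first by apply: unit_fun_cst; rewrite ler01 lexx.
  by apply/funext => x; rewrite big_nil.
have [pi|pi] := boolP (p i).
  rewrite (_ : (fun x => _) = f i \* (fun x => \prod_(i <- s | p i) f i x)).
    exact: unit_funM.
  by apply/funext => x; rewrite big_cons pi.
rewrite (_ : (fun x => _) = (fun x => \prod_(i <- s | p i) f i x))//.
by apply/funext => x; rewrite big_cons (negbTE pi).
Qed.

Lemma unit_funX f n : unit_fun f -> unit_fun (fun x => f x ^+ n).
Proof.
move=> uf; elim: n => [|n ih].
  by apply: unit_fun_cst; rewrite ler01 lexx.
rewrite (_ : (fun x => _) = f \* (fun x => f x ^+ n)); first exact: unit_funM.
by apply/funext => x; rewrite exprS.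
Qed.

Lemma integrable_cst1 m : (m setT < +oo)%E -> m.-integrable setT (cst 1%E).
Proof.
move=> moo; apply/integrableP; split; first exact: measurable_cst.
by under eq_integral do rewrite /= normr1; rewrite integral_cst// mul1e.
Qed.

Lemma unit_fun_integrable m f : (m setT < +oo)%E -> unit_fun f ->
  m.-integrable setT (EFin \o f).
Proof.
move=> moo uf; apply: (@le_integrable _ _ _ m _ measurableT _ (cst 1%E)).
- by apply/measurable_EFinP; exact: uf.1.
- move=> x _ /=; rewrite lee_fin ger0_norm ?unit_fun_ge0//.
  by rewrite normr1 unit_fun_le1.
- exact: integrable_cst1.
Qed.

Lemma EFin_unit_integral m f : (m setT < +oo)%E -> unit_fun f ->
  (\int[m]_x f x)%:E = (\int[m]_x (f x)%:E)%E.
Proof.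
by move=> moo uf; rewrite fineK//; apply: integrable_fin_num => //; exact: unit_fun_integrable.
Qed.

Lemma unit_integral_ge0 m f : unit_fun f -> 0 <= \int[m]_x f x.
Proof. by move=> uf; apply: Rintegral_ge0 => x _; exact: unit_fun_ge0. Qed.

Lemma unit_cvg_integral m (f_ : nat -> T -> R) f : (m setT < +oo)%E ->
  (forall n, unit_fun (f_ n)) -> measurable_fun setT f ->
  {ae m, forall x, f_ ^~ x @ \oo --> f x} ->
  (\int[m]_x f_ n x) @[n --> \oo] --> \int[m]_x f x.
Proof.
move=> moo uf_ mf f_f.
have [|||||intf _ cv] := @dominated_convergence _ _ R m setT measurableT
  (fun n x => (f_ n x)%:E) (EFin \o f) (cst 1%E).
- by move=> n; apply/measurable_EFinP; exact: (uf_ n).1.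
- exact/measurable_EFinP.
- by apply: filterS f_f => x fx _; apply: cvg_EFin => //; apply: nearW.
- exact: integrable_cst1.
- apply: nearW => x n _ /=; rewrite lee_fin ger0_norm ?unit_fun_ge0//.
  by rewrite unit_fun_le1.
apply: fine_cvg; rewrite fineK//; exact: integrable_fin_num.
Qed.

End unit_functions.

Lemma unit_fun_comp d d' (T : measurableType d) (T' : measurableType d')
    (R : realType) (f : T -> R) (X : T' -> T) :
  unit_fun f -> measurable_fun setT X -> unit_fun (f \o X).
Proof.
by move=> uf mX; split=> [|x]; [exact: measurableT_comp uf.1 mX|exact: uf.2].
Qed.

(** * Image measures and measures with a density *)

Section image_measure.
Context d d' (T : measurableType d) (T' : measurableType d') (R : realType).
Variables (m : {measure set T -> \bar R}) (X : T -> T').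

(** [pushforward] with the measurability proof as an argument, so that the measure structure can be
    inferred from the term. *)
Definition image_measure (mX : measurable_fun setT X) : set T' -> \bar R :=
  pushforward m X.

Variable mX : measurable_fun setT X.

Let image_measure0 : image_measure mX set0 = 0%E.
Proof. by rewrite /image_measure /pushforward preimage_set0 measure0. Qed.

Let image_measure_ge0 A : (0 <= image_measure mX A)%E.
Proof. exact: measure_ge0. Qed.

Let image_measure_sigma_additive : semi_sigma_additive (image_measure mX).
Proof. exact: (@measure_semi_sigma_additive _ _ _
  (measure_function_pushforward__canonical__measure_function_Measure m mX)). Qed.

HB.instance Definition _ := isMeasure.Build _ _ _ (image_measure mX)
  image_measure0 image_measure_ge0 image_measure_sigma_additive.

Lemma integral_image_measure (f : T' -> \bar R) : measurable_fun setT f ->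
  (forall x, 0 <= f x)%E ->
  (\int[image_measure mX]_y f y = \int[m]_x f (X x))%E.
Proof. by move=> mf f0; rewrite ge0_integral_pushforward// => x _. Qed.

End image_measure.

Section density_measure.
Context d (T : measurableType d) (R : realType).
Variables (m : {measure set T -> \bar R}) (h : T -> R).

Definition density_measure (mh : measurable_fun setT h)
    (h0 : forall x, 0 <= h x) : set T -> \bar R :=
  fun A => (\int[m]_(x in A) (h x)%:E)%E.

Variables (mh : measurable_fun setT h) (h0 : forall x, 0 <= h x).

Let density_measure0 : density_measure mh h0 set0 = 0%E.
Proof. by rewrite /density_measure integral_set0. Qed.

Let density_measure_ge0 A : (0 <= density_measure mh h0 A)%E.
Proof. by rewrite /density_measure integral_ge0// => x _; rewrite lee_fin. Qed.

Let density_measure_sigma_additive : semi_sigma_additive (density_measure mh h0).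
Proof.
move=> F mF tF mUF; apply: cvg_toP.
  apply: ereal_nondecreasing_is_cvgn => k n kn.
  exact: lee_sum_nneg_natr.
rewrite /density_measure ge0_integral_bigcup//=.
- by apply: measurable_funTS; exact/measurable_EFinP.
- by move=> x _; rewrite lee_fin.
Qed.

HB.instance Definition _ := isMeasure.Build _ _ _ (density_measure mh h0)
  density_measure0 density_measure_ge0 density_measure_sigma_additive.

Import HBNNSimple.

Let integral_density_nnsfun (f : {nnsfun T >-> R}) :
  (\int[density_measure mh h0]_x (f x)%:E = \int[m]_x ((f x)%:E * (h x)%:E))%E.
Proof.
have mhE : measurable_fun setT (EFin \o h) by exact/measurable_EFinP.
under [LHS]eq_integral do rewrite fimfunE -fsumEFin//.
rewrite [LHS]ge0_integral_fsum//; last 2 first.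
  - by move=> r; exact/measurable_EFinP/measurableT_comp.
  - by move=> n x _; rewrite EFinM nnfun_muleindic_ge0.
under [RHS]eq_integral.
  move=> x xD; rewrite fimfunE -fsumEFin// ge0_mule_fsuml; last first.
    by move=> r; rewrite EFinM nnfun_muleindic_ge0.
  over.
rewrite [RHS]ge0_integral_fsum//; last 2 first.
  - move=> r; apply: emeasurable_funM => //.
    by apply/measurable_EFinP; apply/measurableT_comp.
  - by move=> n x _; rewrite mule_ge0 ?EFinM ?nnfun_muleindic_ge0 ?lee_fin.
apply: eq_fsbigr => r _; rewrite integralZl_indic_nnsfun// integral_indic// setIT.
under [RHS]eq_integral do rewrite EFinM -muleA.
(* A negative [r] is not a value of [f], so both sides vanish; a nonnegative one can be taken out of
   the integral. *)
have [r0|r0] := ltP r 0%R.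
  rewrite preimage_nnfun0// [X in _ = X]integral0_eq; last first.
    by move=> x _; rewrite indicE in_set0 mul0e mule0.
  by rewrite measure0 mule0.
rewrite ge0_integralZl//.
- congr (_ * _)%E; rewrite [LHS]/= /density_measure integral_mkcond.
  apply: eq_integral => x _; rewrite patchE indicE.
  by case: (_ \in _); rewrite ?mul1e ?mul0e.
- by apply: emeasurable_funM => //; exact/measurable_EFinP/measurable_indic.
- by move=> x _; rewrite mule_ge0 ?lee_fin.
Qed.

(** Known for simple functions, the formula passes to their increasing limits by monotone
    convergence on both sides. *)
Lemma integral_density_measure (f : T -> \bar R) : measurable_fun setT f ->
  (forall x, 0 <= f x)%E ->
  (\int[density_measure mh h0]_x f x = \int[m]_x (f x * (h x)%:E))%E.
Proof.
move=> mf f0.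
pose f_ := nnsfun_approx measurableT mf.
have mhE : measurable_fun setT (EFin \o h) by exact/measurable_EFinP.
transitivity (lim (\int[density_measure mh h0]_x (f_ n x)%:E @[n --> \oo])%E).
  rewrite -monotone_convergence//=.
  - apply: eq_integral => x _; apply/esym/cvg_lim => //=.
    exact: cvg_nnsfun_approx.
  - by move=> n; exact/measurable_EFinP/measurable_funTS.
  - by move=> n ? _; rewrite lee_fin.
  - by move=> ? _ ? ? mn; rewrite lee_fin; exact/lefP/nd_nnsfun_approx.
under eq_fun do rewrite integral_density_nnsfun.
rewrite -monotone_convergence//=.
- apply: eq_integral => x _; apply/cvg_lim => //=.
  apply: cvgeZr => //; exact: cvg_nnsfun_approx.
- move=> n; apply: emeasurable_funM => //.
  exact/measurable_EFinP/measurable_funTS.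
- by move=> n ? _; rewrite mule_ge0// lee_fin.
- move=> x _ a b ab; rewrite lee_wpmul2r ?lee_fin//.
  exact/lefP/nd_nnsfun_approx.
Qed.

End density_measure.

(** * Laplace transforms at integer rates determine a finite measure on the half-line *)

Lemma cvg_natr_expRN (R : realType) (c : R) : 0 < c ->
  (2 * n%:R * expR (- (n%:R * c))) @[n --> \oo] --> (0 : R).
Proof.
move=> c0.
(* The bound comes from [expR (n c) = expR (n c / 2) ^ 2 >= (n c / 2) ^ 2]. *)
apply: (@squeeze_cvgr _ _ _ _ (cst 0) (fun n : nat => (8 / c ^+ 2) * (n%:R)^-1)).
- near=> n.
  have n0 : 0 < n%:R :> R by near: n; exact: nbhs_infty_gtr.
  rewrite mulr_ge0 ?expR_ge0 ?mulr_ge0//=.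
  have h : (n%:R * c / 2) ^+ 2 <= expR (n%:R * c).
    have e : expR (n%:R * c) = expR (n%:R * c / 2) ^+ 2.
      by rewrite -expRM_natl; congr expR; field.
    rewrite e ler_pXn2r// ?nnegrE ?expR_ge0//; last first.
      by rewrite !mulr_ge0// ltW.
    by rewrite (le_trans _ (expR_ge1Dx _))// lerDr.
  have nc0 : 0 < (n%:R * c / 2) ^+ 2 by rewrite exprn_gt0// divr_gt0// mulr_gt0.
  rewrite expRN; apply: (@le_trans _ _ (2 * n%:R * ((n%:R * c / 2) ^+ 2)^-1)).
    by rewrite ler_wpM2l ?mulr_ge0// lef_pV2// posrE expR_gt0.
  rewrite le_eqVlt; apply/predU1P; left; field.
  by rewrite (gt_eqF c0) (gt_eqF n0).
- exact: cvg_cst.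
- rewrite -[X in _ --> X](mulr0 (8 / c ^+ 2)).
  apply: cvgMr; apply/gtr0_cvgV0; last exact/cvgryPgt/nbhs_infty_gtr.
  by near=> n; near: n; exact: nbhs_infty_gtr.
Unshelve. all: by end_near. Qed.

(* A Gumbel-type kernel: polynomials in [expR (- x)] converging to the indicator
   of a half-line at every point, its end included. *)
Lemma cvg_ray_kernel (R : realType) (b x : R) : 0 <= b -> 0 <= x ->
  (1 - expR (- (n%:R * x))) ^+ (n * (Num.truncn (expR (n%:R * b))).+1)
    @[n --> \oo] --> ((b < x)%R%:R : R).
Proof.
move=> b0 x0.
pose M n := (n * (Num.truncn (expR (n%:R * b))).+1)%N.
(* The exponent [M n] lies between [n expR (n b)] and twice that. The factor [n] forces the limit 0
   at [x = b]: for [b > 0], exponents of order [expR (n b)] would leave a positive limit there. *)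
have MlE n : n%:R * expR (n%:R * b) <= (M n)%:R :> R.
  by rewrite /M natrM ler_wpM2l// ltW// truncnS_gt.
have MrE n : (M n)%:R <= 2 * n%:R * expR (n%:R * b) :> R.
  rewrite /M natrM [2 * _]mulrC -mulrA ler_wpM2l// -natr1 mulrDl mul1r lerD//.
    by rewrite truncn_le expR_ge0.
  by rewrite -[leLHS]expR0 ler_expR mulr_ge0.
have e01 n : 0 <= expR (- (n%:R * x)) <= 1.
  by rewrite expR_ge0/= -[leRHS]expR0 ler_expR oppr_le0 mulr_ge0.
have [bx|xb] := ltP b x.
- apply: (@squeeze_cvgr _ _ _ _
    (fun n : nat => 1 - 2 * n%:R * expR (- (n%:R * (x - b)))) (cst 1)).
  + apply: nearW => n; apply/andP; split; last first.
      by rewrite exprn_ile1// ?subr_ge0 ?gerBl; have /andP[] := e01 n.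
    apply: (@le_trans _ _ (1 - (M n)%:R * expR (- (n%:R * x)))).
      rewrite lerB//; apply: le_trans (ler_wpM2r (expR_ge0 _) (MrE n)) _.
      rewrite -[leLHS]mulrA -expRD le_eqVlt; apply/predU1P; left; congr (_ * expR _).
      by rewrite mulrBr; lra.
    (* Bernoulli's inequality [1 - k e <= (1 - e) ^ k]. *)
    rewrite -/(M n); elim: (M n) => [|k ih]; first by rewrite mul0r subr0 expr0.
    rewrite exprS; set e := expR _ in ih *.
    have /andP[e0 e1] : 0 <= e <= 1 by exact: e01.
    apply: le_trans (_ : (1 - e) * (1 - k%:R * e) <= _); last first.
      by rewrite ler_wpM2l// subr_ge0.
    have : 0 <= k%:R * (e * e) by rewrite !mulr_ge0.
    by rewrite -natr1; nra.
  + rewrite -[X in _ --> X]subr0; apply: cvgB; first exact: cvg_cst.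
    by apply: cvg_natr_expRN; rewrite subr_gt0.
  + exact: cvg_cst.
- apply: (@squeeze_cvgr _ _ _ _ (cst 0) (fun n : nat => expR (- n%:R))).
  + apply: nearW => n; apply/andP; split.
      by rewrite exprn_ge0// subr_ge0; have /andP[] := e01 n.
    (* Here [1 - y <= expR (- y)] is used at [y = expR (- (n x))]. *)
    apply: (@le_trans _ _ (expR (- expR (- (n%:R * x))) ^+ M n)).
      apply: lerXn2r; rewrite ?nnegrE ?expR_ge0//.
        by rewrite subr_ge0; have /andP[] := e01 n.
      by rewrite expR_ge1Dx.
    rewrite -expRM_natl ler_expR mulrN lerN2.
    apply: le_trans (ler_wpM2r (expR_ge0 _) (MlE n)).
    rewrite -mulrA -expRD ler_peMr// -[leLHS]expR0 ler_expR.
    by rewrite -mulrBr mulr_ge0// subr_ge0.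
  + exact: cvg_cst.
  + apply: (@cvg_comp _ _ _ (fun n : nat => n%:R : R) (fun x => expR (- x)) _ (pinfty_nbhs R)).
      exact: cvgr_idn.
    exact: cvgr_expR.
Qed.

Section laplace_ray.
Context d1 d2 (T1 : measurableType d1) (T2 : measurableType d2) (R : realType).
Variables (m1 : {measure set T1 -> \bar R}) (m2 : {measure set T2 -> \bar R}).
Variables (X1 : T1 -> R) (X2 : T2 -> R).
Hypotheses (m1oo : (m1 setT < +oo)%E) (m2oo : (m2 setT < +oo)%E).
Hypotheses (mX1 : measurable_fun setT X1) (mX2 : measurable_fun setT X2).
Hypotheses (X1_ge0 : forall x, 0 <= X1 x) (X2_ge0 : forall x, 0 <= X2 x).
Hypothesis laplace_eq : forall k : nat,
  \int[m1]_x expR (- (k%:R * X1 x)) = \int[m2]_x expR (- (k%:R * X2 x)).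

(** The extra factor [expR (- (k X))] makes the induction on [m] close up: one factor
    [1 - expR (- (n X))] expands into a difference of two terms of the same shape, with [k] and
    [n + k]. *)
Lemma laplace_poly_eq (m n k : nat) :
  \int[m1]_x ((1 - expR (- (n%:R * X1 x))) ^+ m * expR (- (k%:R * X1 x))) =
  \int[m2]_x ((1 - expR (- (n%:R * X2 x))) ^+ m * expR (- (k%:R * X2 x))).
Proof.
have uE d (T : measurableType d) (X : T -> R) (j : nat) : measurable_fun setT X ->
    (forall x, 0 <= X x) -> unit_fun (fun x => expR (- (j%:R * X x))).
  move=> mX X0; split.
    by apply: measurableT_comp => //; apply: measurableT_comp => //; exact: measurable_funM.
  by move=> x; rewrite expR_ge0/= -[leRHS]expR0 ler_expR oppr_le0 mulr_ge0.
have uP d (T : measurableType d) (X : T -> R) (p j : nat) : measurable_fun setT X ->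
    (forall x, 0 <= X x) ->
    unit_fun (fun x => (1 - expR (- (n%:R * X x))) ^+ p * expR (- (j%:R * X x))).
  move=> mX X0; apply: unit_funM; last exact: uE.
  by apply: unit_funX; apply: unit_funB; exact: uE.
have step d (T : measurableType d) (m' : {measure set T -> \bar R}) (X : T -> R) p j :
    (m' setT < +oo)%E -> measurable_fun setT X -> (forall x, 0 <= X x) ->
    \int[m']_x ((1 - expR (- (n%:R * X x))) ^+ p.+1 * expR (- (j%:R * X x))) =
    \int[m']_x ((1 - expR (- (n%:R * X x))) ^+ p * expR (- (j%:R * X x))) -
    \int[m']_x ((1 - expR (- (n%:R * X x))) ^+ p * expR (- ((n + j)%:R * X x))).
  move=> moo mX X0; rewrite -RintegralB//; last 2 first.
  - by apply: unit_fun_integrable => //; exact: uP.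
  - by apply: unit_fun_integrable => //; exact: uP.
  apply: eq_Rintegral => x _.
  by rewrite natrD mulrDl opprD expRD exprS; ring.
elim: m k => [|m ih] k.
  under eq_Rintegral do rewrite expr0 mul1r.
  by under [RHS]eq_Rintegral do rewrite expr0 mul1r.
by rewrite !step// !ih.
Qed.

(** The kernels of [cvg_ray_kernel] lie in the unit interval and are polynomials in
    [expR (- (n X))]: their integrals agree by [laplace_poly_eq] and converge to the masses of the
    ray. *)
Lemma laplace_ray_eq (b : R) : m1 [set x | b < X1 x] = m2 [set x | b < X2 x].
Proof.
have mray d (T : measurableType d) (X : T -> R) : measurable_fun setT X ->
    measurable [set x | b < X x].
  move=> mX; rewrite (_ : [set x | _] = X @^-1` `]b, +oo[).
    by rewrite -[X in measurable X]setTI; apply: mX.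
  by apply/seteqP; split => x /=; rewrite in_itv/= andbT.
have E d (T : measurableType d) (m : {measure set T -> \bar R}) (X : T -> R) :
    (m setT < +oo)%E -> measurable_fun setT X -> m [set x | b < X x] =
    (\int[m]_x \1_[set x | b < X x] x)%:E.
  move=> moo mX; rewrite EFin_unit_integral//; last exact/unit_fun_indic/mray.
  by rewrite integral_indic ?setIT//; exact: mray.
rewrite !E//; congr EFin.
have [b0|b0] := ltP b 0.
  (* A ray with negative end contains every value, and the rate 0 compares the total masses. *)
  have := laplace_eq 0; congr (_ = _); apply: eq_Rintegral => x _;
    rewrite mul0r oppr0 expR0 indicE mem_set//=.
    exact: lt_le_trans (X1_ge0 x).
  exact: lt_le_trans (X2_ge0 x).
pose M n := (n * (Num.truncn (expR (n%:R * b))).+1)%N.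
have lim d (T : measurableType d) (m : {measure set T -> \bar R}) (X : T -> R) :
    (m setT < +oo)%E -> measurable_fun setT X -> (forall x, 0 <= X x) ->
    \int[m]_x ((1 - expR (- (n%:R * X x))) ^+ M n * expR (- (0%:R * X x)))
      @[n --> \oo] --> \int[m]_x \1_[set x | b < X x] x.
  move=> moo mX X0; apply: unit_cvg_integral => //.
  - move=> n.
    have uE : unit_fun (fun x => expR (- (n%:R * X x))).
      split; first by apply: measurableT_comp => //; apply: measurableT_comp => //; exact: measurable_funM.
      by move=> x; rewrite expR_ge0/= -[leRHS]expR0 ler_expR oppr_le0 mulr_ge0.
    split; last first.
      move=> x; rewrite mul0r oppr0 expR0 mulr1.
      exact: (unit_funX _ (unit_funB uE)).2.
    apply: measurable_funM; first exact: (unit_funX _ (unit_funB uE)).1.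
    by apply: measurableT_comp => //; apply: measurableT_comp => //; exact: measurable_funM.
  - exact/measurable_indic/mray.
  - apply: aeW => x; under eq_fun do rewrite mul0r oppr0 expR0 mulr1.
    rewrite indicE (_ : (x \in _) = (b < X x)); first exact: cvg_ray_kernel.
    by apply/idP/idP; rewrite inE.
apply: (cvg_unique _ (lim _ _ m1 X1 m1oo mX1 X1_ge0)) => //.
rewrite (_ : (fun n => _) = (fun n => \int[m2]_x
   ((1 - expR (- (n%:R * X2 x))) ^+ M n * expR (- (0%:R * X2 x))))).
  exact: lim.
by apply/funext => n; exact: laplace_poly_eq.
Qed.

(** Open rays are stable under intersection and generate the Borel sets, so agreement on them is
    enough. *)
Theorem laplace_unique (A : set R) : measurable A ->
  m1 (X1 @^-1` A) = m2 (X2 @^-1` A).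
Proof.
move=> mA.
rewrite -[LHS]/(image_measure m1 mX1 A) -[RHS]/(image_measure m2 mX2 A).
apply: (measure_unique (@RGenOInfty.G R) (fun k => `]- k%:R, +oo[%classic)) => //.
- exact: RGenOInfty.measurableE.
- move=> _ _ [x ->] [y ->]; exists (Num.max x y).
  by apply/seteqP; split => z /=; rewrite !in_itv/= !andbT gt_max => /andP.
- by move=> k; exists (- k%:R).
- apply/seteqP; split => // x _; exists (Num.truncn `|x|).+1 => //=.
  rewrite in_itv/= andbT ltrNl (le_lt_trans _ (truncnS_gt _))//.
  by rewrite -normrN ler_norm.
- move=> _ [x ->]; rewrite /= /image_measure /pushforward.
  have e d (T : measurableType d) (X : T -> R) :
      X @^-1` `]x, +oo[ = [set t | x < X t].
    by apply/seteqP; split => t /=; rewrite in_itv/= andbT.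
  by rewrite !e; exact: laplace_ray_eq.
- move=> k; apply: le_lt_trans m1oo; rewrite /= /image_measure /pushforward.
  apply: le_measure; rewrite ?inE//.
  by rewrite -[X in measurable X]setTI; exact: mX1.
Qed.

End laplace_ray.

(** * Replacing test functions one coordinate at a time *)

Section slices.
Context (R : realType).

(* The functional is, in each coordinate separately, the integral against a
   finite measure of the image under a nonnegative variable. *)
Definition slice_integral (n : nat) (L : ('I_n -> R -> R) -> R) :=
  forall (i : 'I_n) (phi : 'I_n -> R -> R), (forall j, unit_fun (phi j)) ->
  exists d (T : measurableType d) (m : {measure set T -> \bar R}) (X : T -> R),
    [/\ (m setT < +oo)%E, measurable_fun setT X, forall x, 0 <= X x &
      forall psi, unit_fun psi ->
        L (fun j => if j == i then psi else phi j) = \int[m]_x psi (X x)].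

(** A class that separates the images of finite measures under nonnegative variables. Variables
    appear, and not only measures on the line, because [slice_integral] provides such pairs. *)
Definition test_class (K : set (R -> R)) :=
  (forall phi, K phi -> unit_fun phi) /\
  forall d1 (T1 : measurableType d1) (m1 : {measure set T1 -> \bar R}) (X1 : T1 -> R)
    d2 (T2 : measurableType d2) (m2 : {measure set T2 -> \bar R}) (X2 : T2 -> R),
    (m1 setT < +oo)%E -> (m2 setT < +oo)%E ->
    measurable_fun setT X1 -> measurable_fun setT X2 ->
    (forall x, 0 <= X1 x) -> (forall x, 0 <= X2 x) ->
    (forall phi, K phi -> \int[m1]_x phi (X1 x) = \int[m2]_x phi (X2 x)) ->
    forall phi, unit_fun phi -> \int[m1]_x phi (X1 x) = \int[m2]_x phi (X2 x).

(** The absolute value keeps the kernel in the unit interval on the whole line without changing it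
    on nonnegative variables. *)
Definition laplace_kernel (w x : R) : R := expR (- (w * `|x|)).

Lemma unit_laplace_kernel (w : R) : 0 <= w -> unit_fun (laplace_kernel w).
Proof.
move=> w0; split.
  apply: measurableT_comp => //; apply: measurableT_comp => //.
  by apply: measurable_funM => //; exact: measurableT_comp.
by move=> x; rewrite expR_ge0/= -[leRHS]expR0 ler_expR oppr_le0 mulr_ge0.
Qed.

Lemma test_class_indic : test_class [set \1_A | A in measurable].
Proof.
split=> [_ [A mA <-]|]; first exact: unit_fun_indic.
move=> d1 T1 m1 X1 d2 T2 m2 X2 oo1 oo2 mX1 mX2 X10 X20 eqA phi uphi.
have E d (T : measurableType d) (m : {measure set T -> \bar R}) (X : T -> R)
    (mX : measurable_fun setT X) :
    \int[m]_x phi (X x) = fine (\int[image_measure m mX]_x (phi x)%:E)%E.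
  rewrite integral_image_measure//; first by apply/measurable_EFinP; exact: uphi.1.
  by move=> x; rewrite lee_fin unit_fun_ge0.
rewrite (E _ _ _ _ mX1) (E _ _ _ _ mX2); congr fine.
apply: eq_measure_integral => A mA _ /=.
have F d (T : measurableType d) (m : {measure set T -> \bar R}) (X : T -> R)
    (mX : measurable_fun setT X) : (m setT < +oo)%E ->
    m (X @^-1` A) = (\int[m]_x \1_A (X x))%:E.
  move=> moo; rewrite EFin_unit_integral//; last exact: unit_fun_comp (unit_fun_indic _ mA) mX.
  rewrite (eq_integral (fun x => (\1_(X @^-1` A) x)%:E)); last first.
    by move=> x _; rewrite !indicE; congr (_%:R%:E); apply/idP/idP; rewrite !inE.
  rewrite integral_indic ?setIT//.
  by rewrite -[X in measurable X]setTI; exact: mX.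
rewrite /image_measure /pushforward (F _ _ m1 X1)// (F _ _ m2 X2)//; congr EFin.
by apply: eqA; exists A.
Qed.

Lemma test_class_laplace :
  test_class [set laplace_kernel w | w in [set w | 0 <= w]].
Proof.
split=> [_ [w w0 <-]|]; first exact: unit_laplace_kernel.
move=> d1 T1 m1 X1 d2 T2 m2 X2 oo1 oo2 mX1 mX2 X10 X20 eqw.
apply: test_class_indic.2 => // _ [A mA <-].
have F d (T : measurableType d) (m : {measure set T -> \bar R}) (X : T -> R)
    (mX : measurable_fun setT X) : (m setT < +oo)%E ->
    \int[m]_x \1_A (X x) = fine (m (X @^-1` A)).
  move=> moo; rewrite /Rintegral; congr fine.
  rewrite (eq_integral (fun x => (\1_(X @^-1` A) x)%:E)); last first.
    by move=> x _; rewrite !indicE; congr (_%:R%:E); apply/idP/idP; rewrite !inE.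
  rewrite integral_indic ?setIT//.
  by rewrite -[X in measurable X]setTI; exact: mX.
rewrite !F//; congr fine; apply: laplace_unique => // k.
have E d (T : measurableType d) (m : {measure set T -> \bar R}) (X : T -> R) :
    (forall x, 0 <= X x) ->
    \int[m]_x expR (- (k%:R * X x)) = \int[m]_x laplace_kernel k%:R (X x).
  by move=> X0; apply: eq_Rintegral => x _; rewrite /laplace_kernel ger0_norm.
rewrite (E _ _ m1)// (E _ _ m2)//; apply: (eqw (laplace_kernel k%:R)).
exact: (ex_intro2 _ _ k%:R (ler0n R k) erefl).
Qed.

(** The first [k] coordinates are released from [K] to arbitrary test functions, by induction on
    [k]. Releasing one more freezes the others, which leaves two integrals of one function, compared
    by [test_class]. *)
Lemma slice_integral_ext (n : nat) (L1 L2 : ('I_n -> R -> R) -> R) (K : set (R -> R)) :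
  test_class K -> slice_integral L1 -> slice_integral L2 ->
  (forall phi, (forall i, K (phi i)) -> L1 phi = L2 phi) ->
  forall phi, (forall i, unit_fun (phi i)) -> L1 phi = L2 phi.
Proof.
move=> [KU KE] sL1 sL2 eqK phi uphi.
suff H : forall k, (k <= n)%N -> forall phi,
    (forall i : 'I_n, if (i < k)%N then unit_fun (phi i) else K (phi i)) ->
    L1 phi = L2 phi.
  by apply: (H n) => // i; rewrite ltn_ord.
elim => [_ {uphi}phi Kphi|k ih kn {uphi}phi Kphi].
  by apply: eqK => i; have := Kphi i.
pose i0 := Ordinal kn.
have uphi j : unit_fun (phi j).
  by have := Kphi j; case: ifP => // _ /KU.
have phiE : phi = (fun j => if j == i0 then phi i0 else phi j).
  by apply/funext => j; case: eqP => // ->.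
have [d1 [T1 [m1 [X1 [oo1 mX1 X10 E1]]]]] := sL1 i0 phi uphi.
have [d2 [T2 [m2 [X2 [oo2 mX2 X20 E2]]]]] := sL2 i0 phi uphi.
rewrite phiE E1// E2//.
apply: KE => // psi Kpsi.
rewrite -E1 -?E2; [|exact: KU|exact: KU].
apply: ih => [|i]; first exact: ltnW.
case: eqP => [->|/eqP ii0]; first by rewrite ltnn.
have := Kphi i; rewrite ltnS leq_eqVlt.
by move: ii0; rewrite -val_eqE/= => /negbTE ->.
Qed.

Lemma integral_density_unit d (T : measurableType d) (m : {measure set T -> \bar R})
    (W : T -> R) (mW : measurable_fun setT W) (W0 : forall x, 0 <= W x) f :
  unit_fun f -> \int[density_measure m mW W0]_x f x = \int[m]_x (f x * W x).
Proof.
move=> uf; rewrite /Rintegral integral_density_measure//.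
  by apply/measurable_EFinP; exact: uf.1.
by move=> x; rewrite lee_fin unit_fun_ge0.
Qed.

Lemma density_measure_setT_lty d (T : measurableType d) (m : {measure set T -> \bar R})
    (W : T -> R) (mW : measurable_fun setT W) (W0 : forall x, 0 <= W x) (c : R) :
  (m setT < +oo)%E -> (forall x, W x <= c) -> (density_measure m mW W0 setT < +oo)%E.
Proof.
move=> moo Wc; rewrite /density_measure.
apply: (@le_lt_trans _ _ (\int[m]_x (c%:E))%E).
  apply: ge0_le_integral => //; last by move=> x _; rewrite lee_fin.
  - by move=> x _; rewrite lee_fin.
  - exact/measurable_EFinP.
rewrite integral_cst//; have [->|mn0] := eqVneq (m setT) 0%E; first by rewrite mule0 ltry.
by rewrite -(@fineK _ (m setT)) ?ltry// ge0_fin_numE.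
Qed.

Section expectations.
Context d (T : measurableType d) (m : {measure set T -> \bar R}).
Variables (n : nat) (X : 'I_n -> T -> R).
Hypotheses (moo : (m setT < +oo)%E).
Hypotheses (mX : forall i, measurable_fun setT (X i)).
Hypotheses (X_ge0 : forall i x, 0 <= X i x).

Lemma slice_integral_joint :
  slice_integral (fun phi => \int[m]_x \prod_(i < n) phi i (X i x)).
Proof.
move=> i phi uphi.
pose W x := \prod_(j < n | j != i) phi j (X j x).
have uW : unit_fun W.
  by apply: unit_fun_prod => j; exact: (unit_fun_comp (uphi j) (mX j)).
exists d, T, (density_measure m uW.1 (unit_fun_ge0 uW)), (X i); split => //.
  by apply: (density_measure_setT_lty _ _ moo (unit_fun_le1 uW)).
move=> psi upsi; rewrite (integral_density_unit _ _ _ (unit_fun_comp upsi (mX i))).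
apply: eq_Rintegral => x _; rewrite (bigD1 i)//= eqxx; congr (_ * _).
by apply: eq_bigr => j /negbTE ->.
Qed.

Lemma slice_integral_marginals :
  slice_integral (fun phi => \prod_(i < n) \int[m]_x phi i (X i x)).
Proof.
move=> i phi uphi.
pose c := \prod_(j < n | j != i) \int[m]_x phi j (X j x).
have c0 (x : T) : 0 <= c.
  by apply: prodr_ge0 => j _; apply: unit_integral_ge0; exact: unit_fun_comp (uphi j) (mX j).
have mc : measurable_fun setT (cst c : T -> R) by [].
exists d, T, (density_measure m mc c0), (X i); split => //.
  by apply: (density_measure_setT_lty _ _ moo (c := c)).
move=> psi upsi.
have ui := unit_fun_comp upsi (mX i).
rewrite (integral_density_unit _ _ _ ui) RintegralZr//; last exact: unit_fun_integrable.
rewrite (bigD1 i)//= eqxx; congr (_ * _).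
by apply: eq_bigr => j /negbTE ->.
Qed.

End expectations.

End slices.

Arguments test_class_indic {R}.
Arguments test_class_laplace {R}.

(** * Laplace exponents of increments and laws of processes *)

Section increments.
Context (R : realType).

Lemma probability_lty d (T : measurableType d) (P : probability T R) :
  (P setT < +oo)%E.
Proof. by rewrite probability_setT ltry. Qed.

Lemma probability_preimage d (T : measurableType d) (P : probability T R)
    (X : T -> R) (A : set R) : measurable_fun setT X -> measurable A ->
  P (X @^-1` A) = (\int[P]_x \1_A (X x))%:E.
Proof.
move=> mX mA; rewrite EFin_unit_integral; last 2 first.
- exact: probability_lty.
- exact: unit_fun_comp (unit_fun_indic _ mA) mX.
rewrite (eq_integral (fun x => (\1_(X @^-1` A) x)%:E)); last first.
  by move=> x _; rewrite !indicE; congr (_%:R%:E); apply/idP/idP; rewrite !inE.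
rewrite integral_indic ?setIT//.
by rewrite -[X in measurable X]setTI; exact: mX.
Qed.

Lemma probability_bigcap_preimage d (T : measurableType d) (P : probability T R)
    (n : nat) (X : 'I_n -> T -> R) (A : 'I_n -> set R) :
  (forall i, measurable_fun setT (X i)) -> (forall i, measurable (A i)) ->
  P (\bigcap_(i in [set: 'I_n]) X i @^-1` A i) =
  (\int[P]_x \prod_(i < n) \1_(A i) (X i x))%:E.
Proof.
move=> mX mA.
have mXA i : measurable (X i @^-1` A i).
  by rewrite -[X in measurable X]setTI; exact: mX.
have mcap : measurable (\bigcap_(i in [set: 'I_n]) X i @^-1` A i).
  by apply: fin_bigcap_measurable.
rewrite EFin_unit_integral; last 2 first.
- exact: probability_lty.
- by apply: unit_fun_prod => i; exact: unit_fun_comp (unit_fun_indic _ (mA i)) (mX i).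
rewrite (eq_integral (fun x => (\1_(\bigcap_(i in [set: 'I_n]) X i @^-1` A i) x)%:E)).
  by rewrite integral_indic ?setIT.
move=> x _; congr EFin; rewrite indicE.
have [xcap|xcap] := boolP (x \in _).
  rewrite big1// => i _; rewrite indicE mem_set//.
  by move: xcap; rewrite inE => /(_ i I).
move: xcap; rewrite notin_setE => /existsNP[i /not_implyP[_ xi]].
by rewrite (bigD1 i)//= indicE memNset// mul0r.
Qed.

Lemma laplace_kernel_prod d (T : measurableType d) (n : nat) (w : 'I_n -> R)
    (X : 'I_n -> T -> R) (x : T) : (forall i, 0 <= X i x) ->
  \prod_(i < n) laplace_kernel (w i) (X i x) = expR (- \sum_(i < n) w i * X i x).
Proof.
move=> X0; rewrite -sumrN expR_sum; apply: eq_bigr => i _.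
by rewrite /laplace_kernel ger0_norm.
Qed.

(** Stationary and independent increments with Laplace exponent [psi], encoded in a single
    identity. *)
Definition laplace_increments d (T : measurableType d) (P : probability T R)
    (X : R -> T -> R) (psi : R -> R) :=
  forall (n : nat) (t w : nat -> R), 0 <= t 0%N -> nondecreasing_seq t ->
  (forall i, 0 <= w i) ->
  \int[P]_x expR (- \sum_(i < n) w i * (X (t i.+1) x - X (t i) x)) =
  expR (- \sum_(i < n) (t i.+1 - t i) * psi (w i)).

Section one_process.
Context d (T : measurableType d) (P : probability T R).
Variables (X : R -> T -> R) (psi : R -> R).
Hypotheses (mX : forall t : R, 0 <= t -> measurable_fun setT (X t)).
Hypothesis X0 : forall x, X 0 x = 0.
Hypothesis X_homo : forall x (s t : R), 0 <= s -> s <= t -> X s x <= X t x.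

Let times_ge0 (t : nat -> R) : 0 <= t 0%N -> nondecreasing_seq t ->
  forall i, 0 <= t i.
Proof. by move=> t0 tnd i; exact: le_trans t0 (tnd _ _ (leq0n i)). Qed.

Let mincr (t : nat -> R) i : 0 <= t 0%N -> nondecreasing_seq t ->
  measurable_fun setT (fun x => X (t i.+1) x - X (t i) x).
Proof. by move=> t0 tnd; apply: measurable_funB; apply/mX/times_ge0. Qed.

Let incr_ge0 (t : nat -> R) i x : 0 <= t 0%N -> nondecreasing_seq t ->
  0 <= X (t i.+1) x - X (t i) x.
Proof.
move=> t0 tnd; rewrite subr_ge0; apply: X_homo; first exact: times_ge0.
exact: tnd (leqnSn i).
Qed.

(** Independence, known for events, extends to expectations of products of test functions by
    [slice_integral_ext]; stationarity then replaces each increment by the value of the process at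
    the length of the time step. *)
Lemma levy_laplace_increments : stationary_increments P X ->
  independent_increments P X ->
  (forall w t : R, 0 <= w -> 0 <= t -> \int[P]_x expR (- (w * X t x)) = expR (- (t * psi w))) ->
  laplace_increments P X psi.
Proof.
move=> sX iX LX n t w t0 tnd w0.
pose Z (i : 'I_n) x := X (t i.+1) x - X (t i) x.
have mZ i : measurable_fun setT (Z i) by exact: mincr.
have Z0 i x : 0 <= Z i x by exact: incr_ge0.
have indep : forall phi : 'I_n -> R -> R, (forall i, unit_fun (phi i)) ->
    \int[P]_x \prod_(i < n) phi i (Z i x) = \prod_(i < n) \int[P]_x phi i (Z i x).
  have ext := slice_integral_ext test_class_indic
    (slice_integral_joint (probability_lty P) mZ Z0)
    (slice_integral_marginals (probability_lty P) mZ Z0).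
  apply: ext => phi Kphi.
  have /choice[A phiA] i : exists A, measurable A /\ phi i = \1_A.
    by have [A mA <-] := Kphi i; exists A.
  have mA i : measurable (A i) by have [] := phiA i.
  have -> : phi = fun i => \1_(A i) by apply/funext => i; have [] := phiA i.
  apply: EFin_inj; rewrite -probability_bigcap_preimage// (iX n t t0 tnd A mA).
  by rewrite -prodEFin; apply: eq_bigr => i _; exact: (probability_preimage P (mZ i) (mA i)).
transitivity (\int[P]_x \prod_(i < n) laplace_kernel (w i) (Z i x)).
  by apply: eq_Rintegral => x _; rewrite laplace_kernel_prod.
rewrite (indep (fun i => laplace_kernel (w i))); last first.
  by move=> i; exact: unit_laplace_kernel.
rewrite -sumrN expR_sum; apply: eq_bigr => i _.
have h0 : 0 <= t i.+1 - t i by rewrite subr_ge0; exact: tnd (leqnSn i).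
rewrite -(LX (w i) _ (w0 i) h0).
have Xh0 x : 0 <= X (t i.+1 - t i) x by rewrite -(X0 x); exact: X_homo.
rewrite [RHS](_ : _ = \int[P]_x laplace_kernel (w i) (X (t i.+1 - t i) x)); last first.
  by apply: eq_Rintegral => x _; rewrite /laplace_kernel ger0_norm.
have mXh := mX h0.
apply: test_class_indic.2; rewrite ?probability_lty//; last exact: unit_laplace_kernel.
move=> _ [A mA <-]; apply: EFin_inj; rewrite -!probability_preimage//.
rewrite -(sX (t i) (t i.+1 - t i))// ?(times_ge0 t0 tnd)//.
by rewrite [t i + _]addrC subrK.
Qed.

Hypothesis LIX : laplace_increments P X psi.

Lemma laplace_increments1 (s t w : R) : 0 <= s -> s <= t -> 0 <= w ->
  \int[P]_x expR (- (w * (X t x - X s x))) = expR (- ((t - s) * psi w)).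
Proof.
move=> s0 st w0.
(* Time sequences are infinite: this one is [s, t, t, ...], and only its first increment is used. *)
have := @LIX 1%N (fun i => if i == 0%N then s else t) (fun=> w).
rewrite /= big_ord1/=; under eq_Rintegral do rewrite big_ord1/=.
apply => //; apply/nondecreasing_seqP => -[|i]//=.
Qed.

Lemma laplace_marginal (t w : R) : 0 <= t -> 0 <= w ->
  \int[P]_x expR (- (w * X t x)) = expR (- (t * psi w)).
Proof.
move=> t0 w0; rewrite -[in RHS](subr0 t) -laplace_increments1//.
by apply: eq_Rintegral => x _; rewrite X0 subr0.
Qed.

Lemma laplace_increments_stationary : stationary_increments P X.
Proof.
move=> s h s0 h0 A mA.
have sh : s <= s + h by rewrite lerDl.
have sh0 : 0 <= s + h by rewrite addr_ge0.
have m1 : measurable_fun setT (fun x => X (s + h) x - X s x).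
  by apply: measurable_funB; exact: mX.
have m2 := mX h0.
rewrite !probability_preimage//; congr EFin.
apply: test_class_laplace.2; rewrite ?probability_lty//; last exact: unit_fun_indic.
- by move=> x; rewrite subr_ge0; exact: X_homo.
- by move=> x; rewrite -(X0 x); exact: X_homo.
move=> _ [w w0 <-].
transitivity (\int[P]_x expR (- (w * (X (s + h) x - X s x)))).
  by apply: eq_Rintegral => x _; rewrite /laplace_kernel ger0_norm// subr_ge0; exact: X_homo.
transitivity (\int[P]_x expR (- (w * X h x))); last first.
  by apply: eq_Rintegral => x _; rewrite /laplace_kernel ger0_norm// -(X0 x); exact: X_homo.
by rewrite laplace_increments1// laplace_marginal// addrAC subrr add0r.
Qed.

(** The right-hand side of the identity is a product over the increments, and exponentials suffice
    as test functions in every coordinate. *)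
Lemma laplace_increments_independent : independent_increments P X.
Proof.
move=> n t t0 tnd A mA.
pose Z (i : 'I_n) x := X (t i.+1) x - X (t i) x.
have mZ i : measurable_fun setT (Z i) by exact: mincr.
have Z0 i x : 0 <= Z i x by exact: incr_ge0.
rewrite (probability_bigcap_preimage P mZ mA).
under eq_bigr => i _ do rewrite (probability_preimage P (mZ i) (mA i)).
rewrite prodEFin; congr EFin.
have ext := slice_integral_ext test_class_laplace
    (slice_integral_joint (probability_lty P) mZ Z0)
    (slice_integral_marginals (probability_lty P) mZ Z0).
apply: (ext _ (fun i => \1_(A i))); last first.
  by move=> i; exact: unit_fun_indic.
move=> phi Kphi.
have /choice[w phiw] i : exists w, 0 <= w /\ phi i = laplace_kernel w.
  by have [w w0 <-] := Kphi i; exists w.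
have w0 i : 0 <= w i by have [] := phiw i.
have -> : phi = fun i => laplace_kernel (w i) by apply/funext => i; have [] := phiw i.
(* [laplace_increments] indexes weights by [nat], so [w] is continued by 0. *)
pose w' i := if insub i is Some j then w j else 0.
have w'E (i : 'I_n) : w' i = w i by rewrite /w' valK.
have w'0 i : 0 <= w' i by rewrite /w'; case: insub.
transitivity (\int[P]_x expR (- \sum_(i < n) w' i * (X (t i.+1) x - X (t i) x))).
  apply: eq_Rintegral => x _; rewrite laplace_kernel_prod//; congr (expR (- _)).
  by apply: eq_bigr => i _; rewrite w'E.
rewrite LIX// -sumrN expR_sum; apply: eq_bigr => i _.
rewrite w'E -laplace_increments1 ?(times_ge0 t0 tnd)//; last exact: tnd (leqnSn i).
by apply: eq_Rintegral => x _; rewrite /laplace_kernel ger0_norm// ?Z0.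
Qed.

End one_process.
End increments.

(** * Finite-dimensional laws, and sums on product spaces *)

Section process_laws.
Context (R : realType).

(** The number 0 and the given times are sorted; [s] runs through these [n + 1] entries and then
    stays at the last one. *)
Lemma sorted_times (n : nat) (t : 'I_n -> R) : (forall i, 0 <= t i) ->
  exists (s : nat -> R) (k : 'I_n -> nat),
    [/\ s 0%N = 0, nondecreasing_seq s, forall i, t i = s (k i) &
      forall i, (k i <= n)%N].
Proof.
move=> t0.
pose l := sort <=%R (0 :: codom t).
have sl : size l = n.+1 by rewrite size_sort/= size_codom card_ord.
pose s m := nth 0 l (minn m n).
have lsort : sorted <=%R l by apply: sort_sorted; exact: le_total.
have snd : nondecreasing_seq s.
  move=> i j ij; rewrite /s; apply: sorted_leq_nth => //.
  - exact: le_trans.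
  - by rewrite inE sl ltnS geq_minr.
  - by rewrite inE sl ltnS geq_minr.
  - by rewrite leq_min geq_minr andbT (leq_trans (geq_minl _ _)).
have sE x : x \in l -> s (index x l) = x.
  move=> xl; rewrite /s (minn_idPl _) ?nth_index//.
  by rewrite -ltnS -sl index_mem.
exists s, (fun i => index (t i) l); split => //.
- apply/eqP; rewrite eq_le; apply/andP; split.
    rewrite -[leRHS](sE 0) ?snd//.
    by rewrite mem_sort mem_head.
  have : s 0%N \in l by apply: mem_nth; rewrite sl min0n.
  by rewrite mem_sort inE => /orP[/eqP ->//|/codomP[i ->]].
- by move=> i; rewrite sE// mem_sort inE codom_f orbT.
- by move=> i; rewrite -ltnS -sl index_mem mem_sort inE codom_f orbT.
Qed.

Section finite_dimensional_laws.
Context d (T : measurableType d) (P : probability T R) (X : R -> T -> R).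
Variable psi : R -> R.
Hypothesis X0 : forall x, X 0 x = 0.
Hypothesis X_homo : forall x (s t : R), 0 <= s -> s <= t -> X s x <= X t x.
Hypothesis LIX : laplace_increments P X psi.

(** Summation by parts: [X (s (k i))] is the sum of the increments of rank below [k i], so increment
    [m] receives the total weight of the indices [i] with [m < k i]. *)
Lemma laplace_finite_dimensional (n : nat) (s w : nat -> R) (k : 'I_n -> nat) :
  s 0%N = 0 -> nondecreasing_seq s -> (forall i, (k i <= n)%N) -> (forall i, 0 <= w i) ->
  \int[P]_x \prod_(i < n) laplace_kernel (w i) (X (s (k i)) x) =
  expR (- \sum_(m < n) (s m.+1 - s m) * psi (\sum_(i < n | (m < k i)%N) w i)).
Proof.
move=> s0 snd kn w0.
have sge0 m : 0 <= s m by rewrite -s0 snd.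
rewrite -(@LIX n s (fun m => \sum_(i < n | (m < k i)%N) w i)) ?s0//; last first.
  by move=> m; apply: sumr_ge0.
apply: eq_Rintegral => x _.
rewrite (laplace_kernel_prod (fun i : 'I_n => w i) (X := fun i => X (s (k i)))); last first.
  by move=> i; rewrite -(X0 x) X_homo.
congr (expR (- _)).
under [RHS]eq_bigr do rewrite big_distrl/=.
have -> : \sum_(i < n) w i * X (s (k i)) x =
    \sum_(i < n) \sum_(m < n | (m < k i)%N) w i * (X (s m.+1) x - X (s m) x).
  apply: eq_bigr => i _; rewrite -big_distrr/=; congr (_ * _).
  rewrite -(big_mkord (fun m => (m < k i)%N) (fun m => X (s m.+1) x - X (s m) x)).
  rewrite -big_filter (_ : [seq _ <- _ | _] = index_iota 0 (k i)); last first.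
    by rewrite /index_iota !subn0; apply: (filter_iota_ltn 0); exact: kn.
  by rewrite telescope_sumr// s0 X0 subr0.
by rewrite (exchange_big_dep xpredT).
Qed.

End finite_dimensional_laws.

(** Both joint expectations are slice integrals, and they agree on exponentials by
    [laplace_finite_dimensional]. *)
Lemma laplace_increments_eq_process_law d1 (T1 : measurableType d1)
    (P1 : probability T1 R) (X1 : R -> T1 -> R)
    d2 (T2 : measurableType d2) (P2 : probability T2 R) (X2 : R -> T2 -> R)
    (psi : R -> R) :
  (forall t : R, 0 <= t -> measurable_fun setT (X1 t)) -> (forall x, X1 0 x = 0) ->
  (forall x (s t : R), 0 <= s -> s <= t -> X1 s x <= X1 t x) ->
  (forall t : R, 0 <= t -> measurable_fun setT (X2 t)) -> (forall x, X2 0 x = 0) ->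
  (forall x (s t : R), 0 <= s -> s <= t -> X2 s x <= X2 t x) ->
  laplace_increments P1 X1 psi -> laplace_increments P2 X2 psi ->
  eq_process_law P1 P2 X1 X2.
Proof.
move=> mX1 X10 X1h mX2 X20 X2h LI1 LI2 n t A t0 mA.
pose Z1 i := X1 (t i); pose Z2 i := X2 (t i).
have mZ1 i : measurable_fun setT (Z1 i) by exact: mX1.
have mZ2 i : measurable_fun setT (Z2 i) by exact: mX2.
have Z10 i x : 0 <= Z1 i x by rewrite -(X10 x); exact: X1h.
have Z20 i x : 0 <= Z2 i x by rewrite -(X20 x); exact: X2h.
rewrite (probability_bigcap_preimage P1 mZ1 mA).
rewrite (probability_bigcap_preimage P2 mZ2 mA); congr EFin.
have ext := slice_integral_ext test_class_laplace
    (slice_integral_joint (probability_lty P1) mZ1 Z10)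
    (slice_integral_joint (probability_lty P2) mZ2 Z20).
apply: (ext _ (fun i => \1_(A i))); last by move=> i; exact: unit_fun_indic.
move=> phi Kphi.
have /choice[w phiw] i : exists w, 0 <= w /\ phi i = laplace_kernel w.
  by have [w w0 <-] := Kphi i; exists w.
have -> : phi = fun i => laplace_kernel (w i) by apply/funext => i; have [] := phiw i.
pose w' i := if insub i is Some j then w j else 0.
have w'E (i : 'I_n) : w i = w' i by rewrite /w' valK.
have w'0 i : 0 <= w' i.
  by rewrite /w'; case: insub => // j; have [] := phiw j.
have [s [k [s0 snd tE kn]]] := sorted_times t0.
have E d (T : measurableType d) (P : probability T R) (X : R -> T -> R) :
    \int[P]_x \prod_(i < n) laplace_kernel (w i) (X (t i) x) =
    \int[P]_x \prod_(i < n) laplace_kernel (w' i) (X (s (k i)) x).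
  by apply: eq_Rintegral => x _; apply: eq_bigr => i _; rewrite w'E tE.
apply: etrans (E _ _ P1 X1) _; apply: etrans _ (esym (E _ _ P2 X2)).
exact: etrans (laplace_finite_dimensional X10 X1h LI1 s0 snd kn w'0)
  (esym (laplace_finite_dimensional X20 X2h LI2 s0 snd kn w'0)).
Qed.

Lemma Rintegral_prod_unit d1 (T1 : measurableType d1) (P1 : probability T1 R)
    d2 (T2 : measurableType d2) (P2 : probability T2 R) (f : T1 -> R) (g : T2 -> R) :
  unit_fun f -> unit_fun g ->
  \int[(P1 \x P2)%E]_z (f z.1 * g z.2) = \int[P1]_x f x * \int[P2]_y g y.
Proof.
move=> uf ug; apply: EFin_inj.
have ufg : unit_fun (fun z : T1 * T2 => f z.1 * g z.2).
  apply: unit_funM; first exact: (unit_fun_comp uf measurable_fst).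
  exact: (unit_fun_comp ug measurable_snd).
rewrite EFin_unit_integral//; last exact: probability_lty.
rewrite fubini_tonelli1//; last 2 first.
- by apply/measurable_EFinP; exact: ufg.1.
- by move=> z; rewrite lee_fin; exact: (unit_fun_ge0 ufg).
rewrite /fubini_F/= EFinM EFin_unit_integral//; last exact: probability_lty.
rewrite -ge0_integralZr//; last 3 first.
- by apply/measurable_EFinP; exact: uf.1.
- by move=> x _; rewrite lee_fin unit_fun_ge0.
- by rewrite lee_fin unit_integral_ge0.
apply: eq_integral => x _.
rewrite EFin_unit_integral//; last exact: probability_lty.
rewrite -ge0_integralZl//; first exact/measurable_EFinP/ug.1.
- by move=> y _; rewrite lee_fin unit_fun_ge0.
- by rewrite lee_fin unit_fun_ge0.
Qed.

(** On the product space the transform of the sum factorizes, so the exponents add. *)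
Lemma laplace_increments_sum d1 (T1 : measurableType d1)
    (P1 : probability T1 R) (X1 : R -> T1 -> R)
    d2 (T2 : measurableType d2) (P2 : probability T2 R) (X2 : R -> T2 -> R)
    (psi1 psi2 : R -> R) :
  (forall t : R, 0 <= t -> measurable_fun setT (X1 t)) ->
  (forall x (s t : R), 0 <= s -> s <= t -> X1 s x <= X1 t x) ->
  (forall t : R, 0 <= t -> measurable_fun setT (X2 t)) ->
  (forall x (s t : R), 0 <= s -> s <= t -> X2 s x <= X2 t x) ->
  laplace_increments P1 X1 psi1 -> laplace_increments P2 X2 psi2 ->
  laplace_increments (P1 \x P2)%E (fun t z => X2 t z.2 + X1 t z.1)
    (fun w => psi2 w + psi1 w).
Proof.
move=> mX1 X1h mX2 X2h LI1 LI2 n t w t0 tnd w0.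
have ti0 i : 0 <= t i by exact: le_trans t0 (tnd _ _ (leq0n i)).
have uE d (T : measurableType d) (X : R -> T -> R) :
    (forall t : R, 0 <= t -> measurable_fun setT (X t)) ->
    (forall x (s t : R), 0 <= s -> s <= t -> X s x <= X t x) ->
    unit_fun (fun x => expR (- \sum_(i < n) w i * (X (t i.+1) x - X (t i) x))).
  move=> mX Xh; split.
    apply: measurableT_comp => //; apply: measurableT_comp => //.
    apply: measurable_sum => i; apply: measurable_funM => //.
    by apply: measurable_funB; exact: mX.
  move=> x; rewrite expR_ge0/= -[leRHS]expR0 ler_expR oppr_le0.
  apply: sumr_ge0 => i _; rewrite mulr_ge0// subr_ge0.
  by apply: Xh; [exact: ti0|exact: tnd (leqnSn i)].
transitivity (\int[(P1 \x P2)%E]_z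
  (expR (- \sum_(i < n) w i * (X1 (t i.+1) z.1 - X1 (t i) z.1)) *
   expR (- \sum_(i < n) w i * (X2 (t i.+1) z.2 - X2 (t i) z.2)))).
  apply: eq_Rintegral => z _; rewrite -expRD -opprD -big_split/=.
  by congr (expR (- _)); apply: eq_bigr => i _; ring.
rewrite (Rintegral_prod_unit _ _ (uE _ _ _ mX1 X1h) (uE _ _ _ mX2 X2h)).
rewrite LI1// LI2// -expRD -opprD -big_split/=.
by congr (expR (- _)); apply: eq_bigr => i _; ring.
Qed.

End process_laws.

(** * Independent uniform variables from binary digits *)

Section affine_substitution.
Context (R : realType).
Local Notation mu := (@lebesgue_measure R).

Lemma measurable_affine (c e : R) : measurable_fun setT (fun x : R => c * x + e).
Proof. by apply: measurable_funD => //; apply: measurable_funM. Qed.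

(** The measure [nu], which is [c] times the image of Lebesgue measure under the map, gives
    half-open intervals their length, hence is Lebesgue measure. *)
Lemma ge0_integral_affine (c e : R) (D : set R) (f : R -> \bar R) : 0 < c ->
  measurable D -> measurable_fun D f -> (forall x, D x -> 0 <= f x)%E ->
  (\int[mu]_(x in D) f x =
   c%:E * \int[mu]_(x in (fun x => (c * x + e)%R) @^-1` D) f (c * x + e)%R)%E.
Proof.
move=> c0 mD mf f0.
have mA : measurable_fun setT ((fun x : R => c * x + e) :
  measurableTypeR R -> measurableTypeR R) by exact: measurable_affine.
have mc : measurable_fun setT (cst c : measurableTypeR R -> R) by [].
have c0' (x : R) : 0 <= cst c x by exact: ltW.
pose nu := density_measure (image_measure mu mA) mc c0'.
have nuB B : measurable B -> nu B = (c%:E * mu ((fun x : R => (c * x + e)%R) @^-1` B))%E.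
  by move=> mB; rewrite -(integral_cst (image_measure mu mA) mB).
have nuE A : measurable A -> mu A = nu A.
  move=> {}mA'; apply: (@lebesgue_measure_unique R nu) => // _ [[a b] _ <-].
  apply: etrans _ (esym (nuB _ _)); last exact: measurable_itv.
  rewrite (_ : (fun x : R => c * x + e) @^-1` `]a, b] = `](a - e) / c, (b - e) / c]%classic).
    rewrite !lebesgue_measure_itv/= !lte_fin ltr_pM2r ?invr_gt0// ltrD2r.
    case: ifPn => _; last by rewrite mule0.
    rewrite -!EFinB -EFinM; congr EFin.
    by field; rewrite gt_eqF.
  apply/seteqP; split => x /=; rewrite !in_itv/= ltr_pdivrMr// ler_pdivlMr// ltrBlDr lerBrDr;
    by rewrite mulrC.
rewrite integral_mkcond.
have mfD : measurable_fun setT (f \_ D) by apply/(measurable_restrictT f).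
have fD0 x : (0 <= (f \_ D) x)%E by apply: erestrict_ge0.
rewrite (@eq_measure_integral _ _ _ setT nu mu)//; last first.
  by move=> A mA' _; exact: nuE.
rewrite integral_density_measure// integral_image_measure//; last 2 first.
- by apply: emeasurable_funM => //; exact/measurable_EFinP.
- by move=> x; rewrite mule_ge0// lee_fin.
transitivity (\int[mu]_x ((f \_ D) (c * x + e)%R * c%:E))%E; first by [].
rewrite ge0_integralZr//; last 2 first.
- exact: (measurableT_comp mfD mA).
- by rewrite lee_fin ltW.
rewrite muleC; congr (_ * _)%E; rewrite [RHS]integral_mkcond.
apply: eq_integral => x _; rewrite !patchE.
by rewrite (_ : (x \in _) = (c * x + e \in D)).
Qed.

End affine_substitution.

Section uniform01.
Context (R : realType).

Definition uniform01 : probability (measurableTypeR R) R := uniform_prob (@ltr01 R).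

Lemma integral_uniform01 (f : R -> \bar R) : measurable_fun setT f ->
  (forall x, 0 <= f x)%E ->
  (\int[uniform01]_x f x = \int[lebesgue_measure]_(x in `[0%R, 1%R]) f x)%E.
Proof. by move=> mf f0; rewrite integral_uniform// subr0 invr1 mul1e. Qed.

Lemma eq_integral_uniform01 (f g : R -> \bar R) : measurable_fun setT f ->
  (forall x, 0 <= f x)%E -> measurable_fun setT g ->
  (forall x, 0 <= g x)%E -> (forall x : R, 0 < x < 1 -> f x = g x) ->
  (\int[uniform01]_x f x = \int[uniform01]_x g x)%E.
Proof.
move=> mf f0 mg g0 fg; rewrite !integral_uniform01//.
rewrite !(@integral_itv_bndoo _ 0 1 _ true false); try exact: measurable_funTS.
by apply: eq_integral => x; rewrite inE/= in_itv/= => /fg.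
Qed.

(** [bit] and [bit_shift] read the first binary digit and the remaining ones; on [[0, 1[] the latter
    is the doubling map modulo 1. *)
Definition bit (x : R) : R := (2^-1 <= x)%R%:R.
Definition bit_shift (x : R) : R := 2 * x - bit x.

Lemma measurable_bit : measurable_fun setT bit.
Proof.
rewrite (_ : bit = \1_(`[2^-1, +oo[)); first exact: measurable_indic.
apply/funext => x; rewrite /bit indicE; congr _%:R; congr nat_of_bool.
by apply/idP/idP; rewrite inE/= in_itv/= andbT.
Qed.

Lemma measurable_bit_shift : measurable_fun setT bit_shift.
Proof.
by apply: measurable_funB; [exact: measurable_funM|exact: measurable_bit].
Qed.

(** A fair digit and an independent uniform remainder: each half of the interval is stretched onto
    the whole. *)
Lemma integral_bit_shift (f : R -> R -> \bar R) :
  (forall i, measurable_fun setT (f i)) -> (forall i x, 0 <= f i x)%E ->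
  (\int[uniform01]_x f (bit x) (bit_shift x) =
   2^-1%:E * \int[uniform01]_x f 0%R x + 2^-1%:E * \int[uniform01]_x f 1%R x)%E.
Proof.
move=> mf f0.
have fE : (fun x => f (bit x) (bit_shift x)) =
    (fun x => if x < 2^-1 then f 0 (2 * x + 0) else f 1 (2 * x - 1)).
  apply/funext => x; rewrite /bit_shift /bit; case: ltP => _ //.
  by rewrite subr0 addr0.
have m0 : measurable_fun setT (fun x : R => f 0 (2 * x + 0)).
  by apply: measurableT_comp => //; exact: measurable_affine.
have m1 : measurable_fun setT (fun x : R => f 1 (2 * x - 1)).
  by apply: measurableT_comp => //; exact: measurable_affine.
have mfb : measurable_fun setT (fun x : R => f (bit x) (bit_shift x)).
  rewrite fE; apply: measurable_fun_if => //.
  - exact: measurable_fun_ltr.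
  - exact: measurable_funTS.
  - exact: measurable_funTS.
rewrite !integral_uniform01//.
rewrite [in LHS](@itv_bndbnd_setU _ _ _ (BLeft 2^-1)) ?bnd_simp ?invr_ge0//; last first.
  by rewrite invf_le1// ler1n.
rewrite ge0_integral_setU//=; last 2 first.
- exact: measurable_funTS.
- apply/disj_setPS => y [/=]; rewrite !in_itv/= => /andP[_ y1] /andP[].
  by rewrite leNgt y1.
congr (_ + _)%E.
(* The point 1 is dropped, because the lower half [[0, 1/2[] is open on the right. *)
- rewrite [in RHS](@integral_itv_bndoo _ 0 1 _ true false); try exact: measurable_funTS.
  rewrite -[in RHS](@integral_itv_bndoo _ 0 1 _ true true); try exact: measurable_funTS.
  rewrite [in RHS](@ge0_integral_affine _ 2 0)//; last exact: measurable_funTS.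
  rewrite muleA -EFinM mulVf// mul1e.
  rewrite (_ : _ @^-1` _ = `[0, 2^-1[%classic); last first.
    apply/seteqP; split => x /=; rewrite !in_itv/= addr0 => /andP[h1 h2]; lra.
  apply: eq_integral => x; rewrite inE/= in_itv/= => /andP[_ x2].
  by have := congr1 (@^~ x) fE; rewrite /= x2.
- rewrite [in RHS](@ge0_integral_affine _ 2 (-1))//; last exact: measurable_funTS.
  rewrite muleA -EFinM mulVf// mul1e.
  rewrite (_ : _ @^-1` _ = `[2^-1, 1]%classic); last first.
    by apply/seteqP; split => x /=; rewrite !in_itv/= => /andP[h1 h2]; lra.
  apply: eq_integral => x; rewrite inE/= in_itv/= => /andP[x2 _].
  by have := congr1 (@^~ x) fE; rewrite /= ltNge x2.
Qed.

Lemma Rintegral_bit_shift (f : R -> R -> R) : (forall i, unit_fun (f i)) ->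
  \int[uniform01]_x f (bit x) (bit_shift x) =
  2^-1 * (\int[uniform01]_x f 0 x + \int[uniform01]_x f 1 x).
Proof.
move=> uf; have oo := probability_lty uniform01.
rewrite {1}/Rintegral (integral_bit_shift (f := fun i x => (f i x)%:E)); last 2 first.
- by move=> i; apply/measurable_EFinP; exact: (uf i).1.
- by move=> i x; rewrite lee_fin; exact: (unit_fun_ge0 (uf i)).
have E i : (\int[uniform01]_x (f i x)%:E)%E = (\int[uniform01]_x f i x)%:E.
  exact: esym (EFin_unit_integral oo (uf i)).
by rewrite !E -!EFinM -EFinD/= mulrDr.
Qed.

End uniform01.

Section digit_splitting.
Context (R : realType).
Local Notation U := (uniform01 R).

Fixpoint even_bits (n : nat) (x : R) : R :=
  if n is n'.+1 then (bit x + even_bits n' (bit_shift (bit_shift x))) / 2 else 0.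

(** Number formed by the digits of even rank, counted from 0; those of odd rank form
    [even_part (bit_shift x)], since one shift exchanges the two parities. *)
Definition even_part (x : R) : R := limn (fun n => even_bits n x).

Lemma bit_ge0 (x : R) : 0 <= bit x. Proof. by rewrite /bit. Qed.

Lemma bit_le1 (x : R) : bit x <= 1.
Proof. by rewrite /bit; case: (2^-1 <= x); rewrite ?ler01 ?lexx. Qed.

Lemma even_bits_ge0 n x : 0 <= even_bits n x.
Proof.
elim: n x => //= n ih x; have := ih (bit_shift (bit_shift x)).
by have := bit_ge0 x; lra.
Qed.

Lemma even_bits_le1 n x : even_bits n x <= 1.
Proof.
elim: n x => //= n ih x; have := ih (bit_shift (bit_shift x)).
by have := bit_le1 x; lra.
Qed.

Lemma even_bits_nd x : nondecreasing_seq (fun n => even_bits n x).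
Proof.
apply/nondecreasing_seqP => n; elim: n x => [x|n ih x].
  exact: even_bits_ge0.
have := ih (bit_shift (bit_shift x)).
rewrite -[even_bits n.+2 x]/((bit x + even_bits n.+1 (bit_shift (bit_shift x))) / 2).
rewrite -[even_bits n.+1 x]/((bit x + even_bits n (bit_shift (bit_shift x))) / 2).
by move=> h; rewrite ler_pM2r ?invr_gt0// lerD2l.
Qed.

Lemma measurable_even_bits n : measurable_fun setT (even_bits n).
Proof.
elim: n => //= n ih; apply: measurable_funM => //; apply: measurable_funD.
  exact: measurable_bit.
apply: measurableT_comp ih _.
by apply: measurableT_comp; exact: measurable_bit_shift.
Qed.

Lemma even_bits_cvg x : even_bits n x @[n --> \oo] --> even_part x.
Proof.
apply: nondecreasing_is_cvgn; first exact: even_bits_nd.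
by exists 1 => _ [n _ <-]; exact: even_bits_le1.
Qed.

Lemma measurable_even_part : measurable_fun setT even_part.
Proof.
apply: (measurable_fun_cvg (h := even_bits)).
- by move=> n; exact: measurable_even_bits.
- by move=> x _; exact: even_bits_cvg.
Qed.

Lemma even_part_ge0 x : 0 <= even_part x.
Proof.
apply: limr_ge; first by apply/cvg_ex; exists (even_part x); exact: even_bits_cvg.
by apply: nearW => n; exact: even_bits_ge0.
Qed.

Lemma even_partE x : even_part x = (bit x + even_part (bit_shift (bit_shift x))) / 2.
Proof.
have /cvg_unique : even_bits n.+1 x @[n --> \oo] --> even_part x.
  by rewrite (cvg_shiftS (fun n => even_bits n x)); exact: even_bits_cvg.
apply => //=; apply: cvgMl; apply: cvgD; first exact: cvg_cst.
exact: even_bits_cvg.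
Qed.

(** Ends the recursions on Laplace transforms: under repeated halving of the rates they tend to
    1. *)
Lemma cvg_laplace_half d (T : measurableType d) (P : probability T R) (Y : T -> R) :
  measurable_fun setT Y -> (forall x, 0 <= Y x) ->
  (\int[P]_x expR (- (Y x / 2 ^+ n))) @[n --> \oo] --> (1 : R).
Proof.
move=> mY Y0.
have e1 : \int[P]_x 1 = 1 :> R.
  rewrite (Rintegral_cst P)// mul1r.
  exact: (congr1 fine (probability_setT P)).
rewrite -[X in _ --> X]e1.
apply: unit_cvg_integral => //; first exact: probability_lty.
- move=> n; split.
    by apply: measurableT_comp => //; apply: measurableT_comp => //; exact: measurable_funM.
  by move=> x; rewrite expR_ge0/= -[leRHS]expR0 ler_expR oppr_le0 divr_ge0// exprn_ge0.
- apply: aeW => x.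
  rewrite -[X in _ --> X]expR0; apply: continuous_cvg; first exact: continuous_expR.
  rewrite -oppr0; apply: cvgN; rewrite -(mulr0 (Y x)); apply: cvgMr.
  under eq_fun do rewrite -exprVn.
  by apply: cvg_expr; rewrite ger0_norm ?invr_ge0// invf_lt1// ltr1n.
Qed.

(** Laplace transform at [a] of a variable equal to 0 or 1/2 with equal probability. *)
Let half_laplace (a : R) : R := 2^-1 * (1 + expR (- (a / 2))).
Let laplace_uniform (a : R) : R := \int[U]_x expR (- (a * `|x|)).
Let laplace_split (a b : R) : R :=
  \int[U]_x expR (- (a * even_part x + b * even_part (bit_shift x))).

Let unit_expN d (T : measurableType d) (Y : T -> R) : measurable_fun setT Y ->
  (forall x, 0 <= Y x) -> unit_fun (fun x => expR (- Y x)).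
Proof.
move=> mY Y0; split.
  by apply: measurableT_comp => //; exact: measurableT_comp.
by move=> x; rewrite expR_ge0/= -[leRHS]expR0 ler_expR oppr_le0.
Qed.

Lemma eq_Rintegral_uniform01 (f g : R -> R) : unit_fun f -> unit_fun g ->
  (forall x : R, 0 < x < 1 -> f x = g x) -> \int[U]_x f x = \int[U]_x g x.
Proof.
move=> uf ug fg; congr fine; apply: eq_integral_uniform01.
- by apply/measurable_EFinP; exact: uf.1.
- by move=> x; rewrite lee_fin; exact: (unit_fun_ge0 uf).
- by apply/measurable_EFinP; exact: ug.1.
- by move=> x; rewrite lee_fin; exact: (unit_fun_ge0 ug).
- by move=> x x01; rewrite fg.
Qed.

(** In [x = (bit x + bit_shift x) / 2] the two summands are independent. *)
Let laplace_uniform_half a : 0 <= a ->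
  laplace_uniform a = half_laplace a * laplace_uniform (a / 2).
Proof.
move=> a0; rewrite /laplace_uniform.
(* Here [i] stands for the digit; its absolute value keeps the function in the unit interval for
   every real [i], as [Rintegral_bit_shift] demands. *)
have um (i : R) : unit_fun (fun y : R => expR (- (a * `|(`|i| + y) / 2|))).
  apply: unit_expN; last by move=> x; rewrite mulr_ge0.
  apply: measurable_funM => //; apply: measurableT_comp => //.
  by apply: measurable_funM => //; exact: measurable_funD.
have ul : unit_fun (fun y : R => expR (- (a / 2 * `|y|))).
  apply: unit_expN; last by move=> x; rewrite mulr_ge0// divr_ge0.
  by apply: measurable_funM => //; exact: measurableT_comp.
have uc (c : R) : 0 <= c <= 1 -> unit_fun (fun y : R => c * expR (- (a / 2 * `|y|))).
  by move=> c01; exact: (unit_funM (unit_fun_cst _ c01) ul).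
transitivity (\int[U]_x expR (- (a * `|(`|bit x| + bit_shift x) / 2|))).
  apply: eq_Rintegral => x _; congr (expR (- (a * `|_|))).
  by rewrite ger0_norm ?bit_ge0// /bit_shift; field.
have e0 : \int[U]_x expR (- (a * `|(`|0 : R| + x) / 2|)) = laplace_uniform (a / 2).
  rewrite /laplace_uniform; apply: eq_Rintegral => x _; congr (expR (- _)).
  by rewrite normr0 add0r normrM (@ger0_norm _ 2^-1) ?invr_ge0//; ring.
have e1 : \int[U]_x expR (- (a * `|(`|1 : R| + x) / 2|)) =
    expR (- (a / 2)) * laplace_uniform (a / 2).
  rewrite /laplace_uniform -RintegralZl//; last first.
    exact: (unit_fun_integrable (probability_lty U) ul).
  apply: eq_Rintegral_uniform01 => //.
    by apply: uc; rewrite expR_ge0/= -[leRHS]expR0 ler_expR oppr_le0 divr_ge0.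
  move=> x /andP[x0 x1]; rewrite -expRD; congr expR.
  rewrite normr1 !ger0_norm ?(ltW x0)//; first by field.
  by rewrite divr_ge0// addr_ge0// ltW.
rewrite (Rintegral_bit_shift um) e0 e1 /half_laplace -/(laplace_uniform (a / 2)).
by rewrite -[X in X + _]mul1r -mulrDl mulrA.
Qed.

(** Two digits are read: the first goes to [even_part x], the second to [even_part (bit_shift x)].
    What remains are the even and odd parts of [bit_shift (bit_shift x)]. *)
Let laplace_split_half a b : 0 <= a -> 0 <= b ->
  laplace_split a b = half_laplace a * half_laplace b * laplace_split (a / 2) (b / 2).
Proof.
move=> a0 b0; rewrite /laplace_split.
have me := measurable_even_part; have ms := @measurable_bit_shift R.
have mes : measurable_fun setT (even_part \o @bit_shift R) by exact: measurableT_comp.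
pose f (i y : R) := expR (- (a * ((`|i| + even_part (bit_shift y)) / 2) + b * even_part y)).
have uf i : unit_fun (f i).
  apply: unit_expN; last first.
    by move=> x; rewrite addr_ge0// mulr_ge0 ?divr_ge0 ?addr_ge0 ?even_part_ge0.
  apply: measurable_funD; apply: measurable_funM => //.
  by apply: measurable_funM => //; exact: measurable_funD.
pose g (i j z : R) := expR (- (a * ((`|i| + even_part z) / 2) +
                               b * ((`|j| + even_part (bit_shift z)) / 2))).
have ug i j : unit_fun (g i j).
  apply: unit_expN; last first.
    by move=> x; rewrite addr_ge0// mulr_ge0 ?divr_ge0 ?addr_ge0 ?even_part_ge0.
  by apply: measurable_funD; apply: measurable_funM => //;
    apply: measurable_funM => //; exact: measurable_funD.
have ul : unit_fun (fun z : R => expR (- (a / 2 * even_part z + b / 2 * even_part (bit_shift z)))).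
  apply: unit_expN; last first.
    by move=> x; rewrite addr_ge0// mulr_ge0 ?divr_ge0 ?even_part_ge0.
  by apply: measurable_funD; apply: measurable_funM.
have gE i j : \int[U]_z g i j z = expR (- (a * `|i| / 2)) * expR (- (b * `|j| / 2)) *
    laplace_split (a / 2) (b / 2).
  rewrite /laplace_split -RintegralZl//; last first.
    exact: (unit_fun_integrable (probability_lty U) ul).
  by apply: eq_Rintegral => z _; rewrite -!expRD; congr expR; field.
transitivity (\int[U]_x f (bit x) (bit_shift x)).
  apply: eq_Rintegral => x _; rewrite /f ger0_norm ?bit_ge0//.
  by rewrite [in LHS](even_partE x).
rewrite (Rintegral_bit_shift uf).
have fE i : \int[U]_x f i x = 2^-1 * (\int[U]_z g i 0 z + \int[U]_z g i 1 z).
  rewrite -(Rintegral_bit_shift (ug i)); apply: eq_Rintegral => y _.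
  rewrite /f /g (ger0_norm (bit_ge0 y)).
  by rewrite [in LHS](even_partE y).
rewrite (fE 0) (fE 1) (gE 0 0) (gE 0 1) (gE 1 0) (gE 1 1).
rewrite -/(laplace_split (a / 2) (b / 2)); move: (laplace_split _ _) => z.
by rewrite normr0 normr1 !mulr0 !mulr1 !mul0r !oppr0 !expR0 /half_laplace; ring.
Qed.

(** Both sides obey the same recursion when the rates are halved, with a positive factor that
    cancels, and both tend to 1 under repeated halving. The identity [step] is in product form to
    avoid dividing by transforms. *)
Lemma laplace_splitE a b : 0 <= a -> 0 <= b ->
  \int[U]_x expR (- (a * even_part x + b * even_part (bit_shift x))) =
  (\int[U]_x expR (- (a * `|x|))) * \int[U]_x expR (- (b * `|x|)).
Proof.
move=> a0 b0; rewrite -/(laplace_split a b) -/(laplace_uniform a) -/(laplace_uniform b).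
have step n : laplace_split a b *
    (laplace_uniform (a / 2 ^+ n) * laplace_uniform (b / 2 ^+ n)) =
    laplace_uniform a * laplace_uniform b * laplace_split (a / 2 ^+ n) (b / 2 ^+ n).
  elim: n => [|n]; first by rewrite expr0 !divr1 mulrC.
  have h c : 0 <= c -> 0 <= c / 2 ^+ n :> R by move=> c0; rewrite divr_ge0// exprn_ge0.
  rewrite (laplace_uniform_half (h a a0)) (laplace_uniform_half (h b b0)).
  rewrite (laplace_split_half (h a a0) (h b b0)).
  have e c : c / 2 ^+ n / 2 = c / 2 ^+ n.+1 :> R by rewrite exprSr invfM mulrA.
  rewrite !e => ih.
  have hp c : 0 < half_laplace c by rewrite /half_laplace mulr_gt0 ?invr_gt0// addr_gt0// expR_gt0.
  apply: (@mulfI _ (half_laplace (a / 2 ^+ n) * half_laplace (b / 2 ^+ n))).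
    by rewrite mulf_neq0 ?gt_eqF.
  move: ih; move: (half_laplace (a / 2 ^+ n)) (half_laplace (b / 2 ^+ n))
    (laplace_uniform (a / 2 ^+ n.+1)) (laplace_uniform (b / 2 ^+ n.+1)) => p q u v ih.
  transitivity (laplace_split a b * (p * u * (q * v))); first by ring.
  by rewrite ih; ring.
have me := measurable_even_part; have ms := @measurable_bit_shift R.
have mes : measurable_fun setT (even_part \o @bit_shift R) by exact: measurableT_comp.
have cu c : 0 <= c -> laplace_uniform (c / 2 ^+ n) @[n --> \oo] --> (1 : R).
  move=> c0; rewrite (_ : (fun n => _) =
    (fun n => \int[U]_x expR (- (c * `|x| / 2 ^+ n)))); last first.
    apply/funext => n; rewrite /laplace_uniform; apply: eq_Rintegral => x _.
    by rewrite mulrAC.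
  apply: (@cvg_laplace_half _ _ U (fun x => c * `|x|)).
    by apply: measurable_funM => //; exact: measurableT_comp.
  by move=> x; rewrite mulr_ge0.
have cs : laplace_split (a / 2 ^+ n) (b / 2 ^+ n) @[n --> \oo] --> (1 : R).
  rewrite (_ : (fun n => _) = (fun n => \int[U]_x
    expR (- ((a * even_part x + b * even_part (bit_shift x)) / 2 ^+ n)))); last first.
    apply/funext => n; rewrite /laplace_split; apply: eq_Rintegral => x _.
    by congr (expR (- _)); rewrite mulrDl mulrAC (mulrAC b).
  apply: (@cvg_laplace_half _ _ U
    (fun x => a * even_part x + b * even_part (bit_shift x))).
    by apply: measurable_funD; apply: measurable_funM.
  by move=> x; rewrite addr_ge0// mulr_ge0// even_part_ge0.
rewrite -[LHS]mulr1 -[RHS]mulr1.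
have c1 : laplace_split a b *
    (laplace_uniform (a / 2 ^+ n) * laplace_uniform (b / 2 ^+ n)) @[n --> \oo] -->
    laplace_split a b * 1.
  by apply: cvgMr; rewrite -[X in _ --> X](mulr1 1); apply: cvgM; exact: cu.
have c2 : laplace_split a b *
    (laplace_uniform (a / 2 ^+ n) * laplace_uniform (b / 2 ^+ n)) @[n --> \oo] -->
    laplace_uniform a * laplace_uniform b * 1.
  by under eq_fun do rewrite step; exact: cvgMr.
exact: (cvg_unique _ c1 c2).
Qed.

End digit_splitting.

Section digit_splitting_law.
Context (R : realType).
Local Notation U := (uniform01 R).

Lemma unit_uniform_norm (f : R -> R) : unit_fun f ->
  \int[U]_x f `|x| = \int[U]_x f x.
Proof.
move=> uf; apply: eq_Rintegral_uniform01 => //.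
  exact: (unit_fun_comp uf (@normr_measurable R setT)).
by move=> x /andP[x0 _]; rewrite gtr0_norm.
Qed.

(** Exponentials being a test class, [laplace_splitE] extends to all test functions of two
    coordinates. The marginals are those of [|x|], because slices require nonnegative variables;
    [uniform01] does not see the difference. *)
Lemma digit_splitting_independent (f g : R -> R) : unit_fun f -> unit_fun g ->
  \int[U]_x (f (even_part x) * g (even_part (bit_shift x))) =
  (\int[U]_x f x) * \int[U]_x g x.
Proof.
move=> uf ug.
pose X (i : 'I_2) (x : R) := if i == ord0 then even_part x else even_part (bit_shift x).
have mX i : measurable_fun setT (X i).
  rewrite /X; case: (i == ord0); first exact: measurable_even_part.
  by apply: measurableT_comp; [exact: measurable_even_part|exact: measurable_bit_shift].
have X0 i x : 0 <= X i x by rewrite /X; case: ifP => _; exact: even_part_ge0.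
pose N (i : 'I_2) (x : R) := `|x|.
have mN i : measurable_fun setT (N i) by exact: normr_measurable.
have N0 i x : 0 <= N i x by exact: normr_ge0.
have oo := probability_lty U.
have ext := slice_integral_ext test_class_laplace
  (slice_integral_joint oo mX X0) (slice_integral_marginals oo mN N0).
have := ext _ (fun i => if i == ord0 then f else g).
rewrite 2!big_ord_recl big_ord0/= mulr1 /N !unit_uniform_norm//.
move=> <-.
- by apply: eq_Rintegral => x _; rewrite 2!big_ord_recl big_ord0/= mulr1.
- move=> phi Kphi.
  have /choice[w phiw] i : exists w, 0 <= w /\ phi i = laplace_kernel w.
    by have [w w0 <-] := Kphi i; exists w.
  have -> : phi = fun i => laplace_kernel (w i) by apply/funext => i; have [] := phiw i.
  have w0 i : 0 <= w i by have [] := phiw i.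
  rewrite 2!big_ord_recl big_ord0/= mulr1 /N.
  set i0 := ord0; set i1 := lift _ _.
  have E a : \int[U]_x laplace_kernel a `|x| = \int[U]_x expR (- (a * `|x|)).
    by apply: eq_Rintegral => x _; rewrite /laplace_kernel normr_id.
  rewrite (E (w i0)) (E (w i1)) -laplace_splitE//.
  apply: eq_Rintegral => x _; rewrite 2!big_ord_recl big_ord0/= mulr1.
  by rewrite /laplace_kernel /X/= !ger0_norm ?even_part_ge0// -expRD -opprD.
- by move=> i; case: ifP.
Qed.

Definition split_unif (x : R) : measurableTypeR R * measurableTypeR R :=
  (even_part x, even_part (bit_shift x)).

Lemma measurable_split_unif : measurable_fun setT split_unif.
Proof.
apply: measurable_fun_pair; first exact: measurable_even_part.
by apply: measurableT_comp; [exact: measurable_even_part|exact: measurable_bit_shift].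
Qed.

(** By independence of the two halves, the image of [uniform01] under [split_unif] agrees with the
    product measure on rectangles, hence everywhere. *)
Lemma integral_split_unif (F : measurableTypeR R * measurableTypeR R -> \bar R) :
  measurable_fun setT F -> (forall z, 0 <= F z)%E ->
  (\int[U]_x F (split_unif x) = \int[U]_x \int[U]_y F (x, y))%E.
Proof.
move=> mF F0.
rewrite -(integral_image_measure U measurable_split_unif)//.
transitivity (\int[U \x U]_z F z)%E; last by rewrite fubini_tonelli1.
apply: eq_measure_integral => A mA _; apply/esym; move: A mA.
apply: (@product_measure_unique _ _ _ _ R U U
  (image_measure U measurable_split_unif)) => A B mA mB.
have mm : measurable_fun setT (@even_part R \o @bit_shift R).
  by apply: measurableT_comp; [exact: measurable_even_part|exact: measurable_bit_shift].
have oo := probability_lty U.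
have E (C : set R) : measurable C -> U C = (\int[U]_x \1_C x)%:E.
  by move=> mC; rewrite -(@probability_preimage _ _ _ U id).
apply: etrans _ (esym (congr2 mule (E A mA) (E B mB))).
rewrite -EFinM -digit_splitting_independent; [|exact: unit_fun_indic..].
have uu : unit_fun (fun x => \1_A (even_part x) * \1_B (even_part (bit_shift x)) : R).
  apply: unit_funM; first exact: (unit_fun_comp (unit_fun_indic _ mA) (@measurable_even_part R)).
  exact: (unit_fun_comp (unit_fun_indic _ mB) mm).
rewrite (EFin_unit_integral oo uu).
transitivity (\int[U]_x (\1_(split_unif @^-1` (A `*` B)) x)%:E)%E.
  rewrite integral_indic ?setIT//.
  rewrite -[X in measurable X]setTI; apply: measurable_split_unif => //.
  exact: measurableX.
apply: eq_integral => x _; congr EFin; rewrite !indicE -natrM mulnb.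
congr (nat_of_bool _)%:R; apply/idP/andP => [|[]]; rewrite !inE.
  by move=> [].
by [].
Qed.

End digit_splitting_law.

Lemma measurable_nat_choice d (T : measurableType d) d' (T' : measurableType d')
    (N : T -> nat) (G : nat -> T -> T') :
  (forall n, measurable (N @^-1` [set n])) -> (forall n, measurable_fun setT (G n)) ->
  measurable_fun setT (fun x => G (N x) x).
Proof.
move=> mN mG _ B mB; rewrite setTI.
rewrite (_ : _ @^-1` B = \bigcup_n (N @^-1` [set n] `&` G n @^-1` B)).
  apply: bigcup_measurable => n _; apply: measurableI => //.
  by rewrite -[X in measurable X]setTI; exact: mG.
apply/seteqP; split => [x /= Bx|x [n _ [/= <-]]//].
by exists (N x).
Qed.

(** * Poisson sums of marks *)

Section compound_poisson.
Context (R : realType) d (T : measurableType d) (P : probability T R).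
Variable S : T -> T * T.
Hypothesis mS : measurable_fun setT S.
Hypothesis splitS : forall F : T * T -> \bar R, measurable_fun setT F ->
  (forall z, 0 <= F z)%E -> (\int[P]_x F (S x) = \int[P]_x \int[P]_y F (x, y))%E.
Variable N : T -> nat.
Hypothesis mN : forall n, measurable (N @^-1` [set n]).
Hypothesis poissonN : forall k : R, 0 <= k <= 1 ->
  \int[P]_x k ^+ N x = expR (k - 1).

Let oo := probability_lty P.

Let mS1 : measurable_fun setT (fun x => (S x).1).
Proof. exact: measurableT_comp measurable_fst mS. Qed.

Let mS2 : measurable_fun setT (fun x => (S x).2).
Proof. exact: measurableT_comp measurable_snd mS. Qed.

(** By [splitS] the two components of [S x] are independent with law [P]. The first is output and
    the second is split again, which draws an independent sequence from a single point. *)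
Fixpoint iid_stream (i : nat) (x : T) : T :=
  if i is i'.+1 then iid_stream i' (S x).2 else (S x).1.

Lemma measurable_iid_stream i : measurable_fun setT (iid_stream i).
Proof. by elim: i => //= i ih; exact: measurableT_comp ih mS2. Qed.

Lemma integral_split_prod (f g : T -> R) : unit_fun f -> unit_fun g ->
  \int[P]_x (f (S x).1 * g (S x).2) = (\int[P]_x f x) * \int[P]_x g x.
Proof.
move=> uf ug; rewrite -Rintegral_prod_unit//; congr fine.
have ufg : unit_fun (fun z : T * T => f z.1 * g z.2).
  apply: unit_funM; first exact: (unit_fun_comp uf measurable_fst).
  exact: (unit_fun_comp ug measurable_snd).
have mfg : measurable_fun setT (fun z : T * T => (f z.1 * g z.2)%:E).
  by apply/measurable_EFinP; exact: ufg.1.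
have fg0 (z : T * T) : (0 <= (f z.1 * g z.2)%:E)%E.
  by rewrite lee_fin; exact: (unit_fun_ge0 ufg).
by rewrite (splitS mfg fg0) fubini_tonelli1.
Qed.

Lemma integral_iid_stream n (c : nat -> T -> R) : (forall i, unit_fun (c i)) ->
  \int[P]_x \prod_(i < n) c i (iid_stream i x) = \prod_(i < n) \int[P]_x c i x.
Proof.
elim: n c => [|n ih] c uc.
  under eq_Rintegral do rewrite big_ord0.
  rewrite big_ord0 (Rintegral_cst P)// mul1r.
  exact: (congr1 fine (probability_setT P)).
rewrite big_ord_recl -(ih (fun i => c i.+1))// -integral_split_prod//; last first.
  apply: unit_fun_prod => i.
  by apply: unit_fun_comp; [exact: uc|exact: measurable_iid_stream].
by apply: eq_Rintegral => x _; rewrite big_ord_recl.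
Qed.

(** One component of [S x] gives the number of terms and the other the marks, so that the number is
    independent of the marks. *)
Definition poisson_sum (g : T -> R) (x : T) : R :=
  \sum_(i < N (S x).1) g (iid_stream i (S x).2).

Lemma measurable_poisson_sum g : measurable_fun setT g ->
  measurable_fun setT (poisson_sum g).
Proof.
move=> mg; apply: (measurable_nat_choice (N := fun x => N (S x).1)
  (G := fun n x => \sum_(i < n) g (iid_stream i (S x).2))).
  by move=> n; rewrite -[X in measurable X]setTI; exact: (mS1 measurableT (mN n)).
move=> n; apply: measurable_sum => i; apply: measurableT_comp => //.
exact: measurableT_comp (measurable_iid_stream i) mS2.
Qed.

Let unit_expN (g : T -> R) : measurable_fun setT g -> (forall x, 0 <= g x) ->
  unit_fun (fun x => expR (- g x)).
Proof.
move=> mg g0; split.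
  by apply: measurableT_comp => //; exact: measurableT_comp.
by move=> x; rewrite expR_ge0/= -[leRHS]expR0 ler_expR oppr_le0.
Qed.

(** Given [n] terms the transform is [k ^+ n], where [k] is that of one mark; averaging over the
    Poisson number gives [expR (k - 1)]. *)
Lemma laplace_poisson_sum (g : T -> R) : measurable_fun setT g -> (forall x, 0 <= g x) ->
  \int[P]_x expR (- poisson_sum g x) = expR (- \int[P]_x (1 - expR (- g x))).
Proof.
move=> mg g0; have ue := unit_expN mg g0.
set k := \int[P]_x expR (- g x).
have k01 : 0 <= k <= 1.
  rewrite unit_integral_ge0//=.
  have := @le_Rintegral _ _ _ P setT (fun x => expR (- g x)) (cst 1) measurableT.
  rewrite (Rintegral_cst P)// mul1r (congr1 fine (probability_setT P)); apply.
  - exact: unit_fun_integrable.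
  - by apply: unit_fun_integrable => //; apply: unit_fun_cst; rewrite ler01 lexx.
  - by move=> x _; exact: unit_fun_le1 ue x.
have -> : \int[P]_x (1 - expR (- g x)) = 1 - k.
  rewrite RintegralB//; last 2 first.
  - by apply: unit_fun_integrable => //; apply: unit_fun_cst; rewrite ler01 lexx.
  - exact: unit_fun_integrable.
  by rewrite (Rintegral_cst P)// mul1r (congr1 fine (probability_setT P)).
rewrite opprB -poissonN//; congr fine.
pose F (z : T * T) := (\prod_(i < N z.1) expR (- g (iid_stream i z.2)))%:E.
have mF : measurable_fun setT F.
  apply/measurable_EFinP.
  apply: (measurable_nat_choice (N := fun z : T * T => N z.1)
    (G := fun n z => \prod_(i < n) expR (- g (iid_stream i z.2)))).
    by move=> n; rewrite -[X in measurable X]setTI; exact: (@measurable_fst _ _ T T measurableT _ (mN n)).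
  move=> n; apply: measurable_prod => i _.
  apply: (measurableT_comp ue.1).
  exact: measurableT_comp (measurable_iid_stream i) measurable_snd.
have F0 z : (0 <= F z)%E by rewrite lee_fin prodr_ge0// => i _; exact: expR_ge0.
transitivity (\int[P]_x F (S x))%E.
  by apply: eq_integral => x _; rewrite /F /poisson_sum -sumrN expR_sum.
rewrite splitS//; apply: eq_integral => x _; rewrite /F/=.
have up n : unit_fun (fun y => \prod_(i < n) expR (- g (iid_stream i y))).
  apply: unit_fun_prod => i.
  exact: (unit_fun_comp ue (measurable_iid_stream i)).
apply: etrans (esym (EFin_unit_integral oo (up (N x)))) _; congr EFin.
by rewrite (integral_iid_stream _ (fun=> ue)) prodr_const card_ord.
Qed.

(** Term [j] draws on its own point [iid_stream j x], so the terms are independent. *)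
Definition poisson_series (J : nat) (g : nat -> T -> R) (x : T) : R :=
  \sum_(j < J) poisson_sum (g j) (iid_stream j x).

Lemma measurable_poisson_series J (g : nat -> T -> R) : (forall j, measurable_fun setT (g j)) ->
  measurable_fun setT (poisson_series J g).
Proof.
move=> mg; apply: measurable_sum => j.
by apply: measurableT_comp; [exact: measurable_poisson_sum|exact: measurable_iid_stream].
Qed.

Lemma poisson_series_ge0 J (g : nat -> T -> R) x : (forall j z, 0 <= g j z) ->
  0 <= poisson_series J g x.
Proof. by move=> g0; apply: sumr_ge0 => j _; apply: sumr_ge0. Qed.

Lemma poisson_series_nd (g : nat -> T -> R) x : (forall j z, 0 <= g j z) ->
  nondecreasing_seq (fun J => poisson_series J g x).
Proof.
move=> g0; apply/nondecreasing_seqP => J.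
by rewrite /poisson_series big_ord_recr lerDl/=; apply: sumr_ge0.
Qed.

Lemma laplace_poisson_series J (g : nat -> T -> R) : (forall j, measurable_fun setT (g j)) ->
  (forall j x, 0 <= g j x) ->
  \int[P]_x expR (- poisson_series J g x) =
  expR (- \sum_(j < J) \int[P]_x (1 - expR (- g j x))).
Proof.
move=> mg g0.
transitivity (\int[P]_x \prod_(j < J) expR (- poisson_sum (g j) (iid_stream j x))).
  by apply: eq_Rintegral => x _; rewrite /poisson_series -sumrN expR_sum.
rewrite (integral_iid_stream J (c := fun j x => expR (- poisson_sum (g j) x))); last first.
  move=> j; apply: unit_expN; first exact: measurable_poisson_sum.
  by move=> x; apply: sumr_ge0.
by rewrite -sumrN expR_sum; apply: eq_bigr => j _; rewrite laplace_poisson_sum.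
Qed.

End compound_poisson.

(** * A Poisson number from a uniform variable *)

Section poisson_number.
Context (R : realType).
Local Notation U := (uniform01 R).

(** Probability that a Poisson variable of mean 1 is smaller than [n]. *)
Definition poisson1_cdf (n : nat) : R := expR (-1) * series (exp_coeff 1) n.

Definition poisson1_itv (n : nat) : set R := `[poisson1_cdf n, poisson1_cdf n.+1[.

(** Inverse of the distribution function; points outside [[0, 1[] receive the default value 0. *)
Definition poisson1_number (x : R) : nat := xget 0%N [set n | poisson1_itv n x].

Lemma poisson1_cdfS n : poisson1_cdf n.+1 = poisson1_cdf n + expR (-1) * n`!%:R^-1.
Proof. by rewrite /poisson1_cdf seriesSr mulrDr /exp_coeff/= expr1n mul1r. Qed.

Lemma poisson1_cdf_nd : nondecreasing_seq poisson1_cdf.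
Proof.
apply/nondecreasing_seqP => n; rewrite poisson1_cdfS lerDl mulr_ge0 ?expR_ge0//.
Qed.

Lemma poisson1_cdf_cvg : poisson1_cdf n @[n --> \oo] --> (1 : R).
Proof.
have -> : 1 = expR (-1) * expR 1 :> R by rewrite -expRD addNr expR0.
by apply: cvgMr; exact: is_cvg_series_exp_coeff.
Qed.

Lemma poisson1_itv_cover (x : R) : 0 <= x < 1 -> exists n, poisson1_itv n x.
Proof.
move=> /andP[x0 x1].
have ex : exists n, x < poisson1_cdf n.
  have : \forall n \near \oo, x < poisson1_cdf n by exact: (cvgr_gt _ poisson1_cdf_cvg).
  by move=> [n _ nP]; exists n; apply: nP => /=.
case: (ex_minnP ex) => -[|n] xn minn.
  by move: xn; rewrite /poisson1_cdf /series/= big_geq// mulr0 ltNge x0.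
exists n; rewrite /poisson1_itv/= in_itv/= xn andbT leNgt.
by apply/negP => /minn; rewrite ltnn.
Qed.

Lemma poisson1_itv_inj (x : R) m n : poisson1_itv m x -> poisson1_itv n x -> m = n.
Proof.
rewrite /poisson1_itv/= !in_itv/= => /andP[m1 m2] /andP[n1 n2].
apply/eqP; rewrite eqn_leq; apply/andP; split; rewrite leqNgt; apply/negP => mn.
  by have := le_lt_trans m1 (lt_le_trans n2 (poisson1_cdf_nd mn)); rewrite ltxx.
by have := le_lt_trans n1 (lt_le_trans m2 (poisson1_cdf_nd mn)); rewrite ltxx.
Qed.

Lemma poisson1_numberE n (x : R) : poisson1_itv n x -> poisson1_number x = n.
Proof. by move=> nx; apply: xget_unique => // m mx; exact: poisson1_itv_inj mx nx. Qed.

Lemma measurable_poisson1_number n : measurable (poisson1_number @^-1` [set n]).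
Proof.
have mI k : measurable (poisson1_itv k) by exact: measurable_itv.
(* Because of the default value, the points of no interval belong to the case [n = 0]. *)
rewrite (_ : _ @^-1` _ = poisson1_itv n `|`
    (if n == 0%N then ~` \bigcup_k poisson1_itv k else set0)).
  apply: measurableU => //; case: eqP => // _.
  by apply: measurableC; exact: bigcup_measurable.
apply/seteqP; split => x /=.
  rewrite /poisson1_number; case: xgetP => [m mx nx <-|nx <-]; first by left.
  by right => /=; move=> [k _]; exact: nx.
move=> [nx|]; first exact: poisson1_numberE.
case: eqP => // -> nx; rewrite /poisson1_number; case: xgetP => // m _ mx.
by exfalso; apply: nx; exists m.
Qed.

(** The interval of [n] has length [expR (-1) / n!], so the integral is [expR (-1)] times the
    exponential series at [k]. *)
Lemma poisson1_number_laplace (k : R) : 0 <= k <= 1 ->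
  \int[U]_x k ^+ poisson1_number x = expR (k - 1).
Proof.
move=> /andP[k0 k1].
have mf : measurable_fun setT (fun x : R => (k ^+ poisson1_number x)%:E).
  apply/measurable_EFinP; apply: (measurable_nat_choice (N := poisson1_number)
    (G := fun n _ => k ^+ n)) => // n.
  exact: measurable_poisson1_number.
have f0 (x : R) : (0 <= (k ^+ poisson1_number x)%:E)%E by rewrite lee_fin exprn_ge0.
rewrite /Rintegral integral_uniform01//.
(* The intervals cover [[0, 1[] only; the end 1 is removed as a null set. *)
rewrite (@integral_itv_bndoo _ 0 1 _ true false); last exact: measurable_funTS.
rewrite -(@integral_itv_bndoo _ 0 1 _ true true); last exact: measurable_funTS.
rewrite (_ : `[0, 1[%classic = \bigcup_n poisson1_itv n); last first.
  apply/seteqP; split => x /=; rewrite in_itv/=.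
    by move=> /poisson1_itv_cover[n nx]; exists n.
  move=> [n _]; rewrite /poisson1_itv/= in_itv/= => /andP[n1 n2]; apply/andP; split.
    rewrite (le_trans _ n1)// mulr_ge0 ?expR_ge0//.
    by apply: sumr_ge0 => i _; rewrite /exp_coeff/= divr_ge0// exprn_ge0.
  apply: (lt_le_trans n2); rewrite -(cvg_lim _ poisson1_cdf_cvg)//.
  apply: nondecreasing_cvgn_le; first exact: poisson1_cdf_nd.
  by apply/cvg_ex; exists 1; exact: poisson1_cdf_cvg.
have mI n : measurable (poisson1_itv n) by exact: measurable_itv.
rewrite ge0_integral_bigcup//=; last 2 first.
- exact: measurable_funTS.
- by apply/trivIsetP => i j _ _ ij; apply/seteqP; split => // x [xi xj];
    move: ij; rewrite (poisson1_itv_inj xi xj) eqxx.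
transitivity (fine (\sum_(0 <= n <oo) (expR (-1) * (exp_coeff k n))%:E)%E).
  congr fine; apply: eq_eseriesr => n _.
  rewrite (eq_integral (cst (k ^+ n)%:E)); last first.
    by move=> x; rewrite inE => /poisson1_numberE ->.
  transitivity ((k ^+ n)%:E * lebesgue_measure (poisson1_itv n))%E.
    by rewrite integral_cst//; exact: mI.
  rewrite /poisson1_itv lebesgue_measure_itv/= lte_fin poisson1_cdfS ltrDl.
  rewrite mulr_gt0 ?expR_gt0 ?invr_gt0 ?ltr0n ?fact_gt0// -EFinB -EFinM.
  by congr EFin; rewrite addrAC subrr add0r mulrCA.
rewrite addrC expRD; suff: (\sum_(0 <= n <oo) (expR (-1) * exp_coeff k n)%:E)%E =
   (expR (-1) * expR k)%:E by move=> ->.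
apply/cvg_lim => //.
rewrite (_ : (fun n => _) = (fun n => (expR (-1) * series (exp_coeff k) n)%:E)).
  apply: cvg_EFin; first exact: nearW.
  by apply: cvgMr; exact: is_cvg_series_exp_coeff.
by apply/funext => n; rewrite sumEFin /series/= mulr_sumr.
Qed.

End poisson_number.

(** * Exponential marks from uniform variables *)

Section exponential_marks.
Context (R : realType).
Local Notation U := (uniform01 R).
Local Notation mu := (@lebesgue_measure R).

Lemma integral_expN (c : R) : 0 < c ->
  (\int[mu]_(x in `[0%R, +oo[) (expR (- (c * x)))%:E = (c^-1)%:E)%E.
Proof.
move=> c0; have := integral_exponential_pdf c0.
have mE : measurable_fun (`[0, +oo[ : set R) (fun x : R => (expR (- (c * x)))%:E).
  apply: measurable_funTS; apply/measurable_EFinP.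
  by apply: measurableT_comp => //; apply: measurableT_comp => //; exact: measurable_funM.
rewrite (_ : (fun x => (exponential_pdf c x)%:E) =
    (fun x => (c%:E * (expR (- (c * x)))%:E)%E) \_ `[0, +oo[); last first.
  apply/funext => x; rewrite /exponential_pdf !patchE; case: ifPn => // _.
  by rewrite EFinM mulNr.
rewrite -integral_mkcond ge0_integralZl//; last by rewrite lee_fin ltW.
move=> h; rewrite -[LHS]mul1e -(_ : (c^-1)%:E * c%:E = 1)%E.
  by rewrite -muleA h mule1.
by rewrite -EFinM mulVf// gt_eqF.
Qed.

Lemma integral_expN_oy (c : R) : 0 < c ->
  (\int[mu]_(x in `]0%R, +oo[) (expR (- (c * x)))%:E = (c^-1)%:E)%E.
Proof.
move=> c0; rewrite integral_itv_obnd_cbnd ?integral_expN//.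
apply: measurable_funTS; apply/measurable_EFinP.
by apply: measurableT_comp => //; apply: measurableT_comp => //; exact: measurable_funM.
Qed.

(** On [[0, 1[] this is [- ln (1 - x)], the inverse of the exponential distribution function; the
    absolute value makes it nonnegative everywhere. *)
Definition exp_mark (x : R) : R := `|ln (1 - x)|.

Lemma measurable_exp_mark : measurable_fun setT exp_mark.
Proof.
apply: measurableT_comp => //; apply: measurableT_comp; first exact: measurable_ln.
exact: measurable_funB.
Qed.

Lemma exp_mark_ge0 x : 0 <= exp_mark x. Proof. exact: normr_ge0. Qed.

Let exp_weight (x : R) : R := expR (- `|x|) * \1_(`]0, +oo[) x.

Let mexp_weight : measurable_fun setT exp_weight.
Proof.
apply: measurable_funM; last exact: measurable_indic.
by apply: measurableT_comp => //; exact: measurableT_comp.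
Qed.

Let exp_weight_ge0 x : 0 <= exp_weight x.
Proof. by rewrite mulr_ge0// expR_ge0. Qed.

Let exp_law := density_measure mu mexp_weight exp_weight_ge0.

Let integral_exp_law (f : R -> \bar R) : measurable_fun setT f ->
  (forall x, 0 <= f x)%E -> (\int[exp_law]_x f x =
  \int[mu]_(x in `]0%R, +oo[) (f x * (expR (- x))%:E))%E.
Proof.
move=> mf f0; rewrite integral_density_measure// [RHS]integral_mkcond.
apply: eq_integral => x _; rewrite patchE /exp_weight indicE.
case: ifPn => xI; last by rewrite mulr0 mule0.
rewrite mulr1 ger0_norm//.
by move: xI; rewrite inE/= in_itv/= andbT => /ltW.
Qed.

Let exp_law_laplace (k : nat) :
  (\int[exp_law]_x (expR (- (k%:R * `|x|)))%:E = (k.+1%:R^-1)%:E)%E.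
Proof.
rewrite integral_exp_law; last 2 first.
- apply/measurable_EFinP; apply: measurableT_comp => //; apply: measurableT_comp => //.
  by apply: measurable_funM => //; exact: measurableT_comp.
- by move=> x; rewrite lee_fin expR_ge0.
rewrite -integral_expN_oy ?ltr0n//; apply: eq_integral => x.
rewrite inE/= in_itv/= andbT => x0; rewrite -EFinM -expRD gtr0_norm//.
by congr (expR _)%:E; rewrite -natr1; ring.
Qed.

(** Both laws have transform [1 / (k + 1)] at the integer [k], on the uniform side as the integral
    of [(1 - x) ^ k]; [laplace_unique] identifies them. *)
Lemma integral_exp_mark (f : R -> \bar R) : measurable_fun setT f ->
  (forall x, 0 <= f x)%E -> (\int[U]_x f (exp_mark x) =
  \int[mu]_(x in `]0%R, +oo[) (f x * (expR (- x))%:E))%E.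
Proof.
move=> mf f0; rewrite -integral_exp_law//.
have mn : measurable_fun setT (fun x : measurableTypeR R => `|x| : R).
  exact: normr_measurable.
have law A : measurable A -> U (exp_mark @^-1` A) = exp_law ((fun x : R => `|x|) @^-1` A).
  apply: laplace_unique => //.
  - exact: probability_lty.
  - have := exp_law_laplace 0; rewrite (eq_integral (cst 1%E)); last first.
      by move=> x _; rewrite mul0r oppr0 expR0.
    by rewrite integral_cst// mul1e => h; rewrite [ltLHS]h ltry.
  - exact: measurable_exp_mark.
  - by move=> x; exact: exp_mark_ge0.
  move=> k; rewrite [RHS](_ : _ = k.+1%:R^-1); last first.
    by rewrite /Rintegral exp_law_laplace.
  have uk : unit_fun (fun x => expR (- (k%:R * exp_mark x))).
    split.
      apply: measurableT_comp => //; apply: measurableT_comp => //.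
      by apply: measurable_funM => //; exact: measurable_exp_mark.
    by move=> x; rewrite expR_ge0/= -[leRHS]expR0 ler_expR oppr_le0 mulr_ge0// exp_mark_ge0.
  have mk : measurable_fun setT (fun x : R => ((`|1 - x|) ^+ k)%:E).
    apply/measurable_EFinP; apply: measurable_funX; apply: measurableT_comp => //.
    exact: measurable_funB.
  rewrite -Rintegral_onemXn; congr fine.
  transitivity (\int[U]_x ((`|1 - x|) ^+ k)%:E)%E.
    apply: eq_integral_uniform01 => //.
      by apply/measurable_EFinP; exact: uk.1.
    move=> x /andP[x0 x1]; congr EFin; rewrite /exp_mark.
    rewrite ler0_norm; last by rewrite ln_le0// gerBl ltW.
    by rewrite mulrN opprK expRM_natl lnK ?gtr0_norm// ?posrE subr_gt0.
  rewrite integral_uniform01//.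
  apply: eq_integral => x; rewrite inE/= in_itv/= => /andP[x0 x1].
  by rewrite /unstable.onem ger0_norm// subr_ge0.
rewrite -(integral_image_measure U measurable_exp_mark)//.
transitivity (\int[image_measure exp_law mn]_x f x)%E.
  by apply: eq_measure_integral => A mA _; exact: law.
rewrite integral_image_measure// !integral_exp_law//; last first.
  exact: measurableT_comp mf mn.
by apply: eq_integral => x; rewrite inE/= in_itv/= andbT => x0; rewrite gtr0_norm.
Qed.

End exponential_marks.

(** * Layers, and the intensity of the kept marks *)

Section layers.
Context (R : realType).
Local Notation U := (uniform01 R).
Local Notation mu := (@lebesgue_measure R).

Lemma uniform01_le (c : R) :
  (\int[U]_v ((\1_[set v : R | v <= c] v) : R)%:E = (Num.min 1 (Num.max 0 c))%:E)%E.
Proof.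
have mI : measurable [set v : R | v <= c].
  by rewrite (_ : [set _ | _] = `]-oo, c]%classic)//; apply/seteqP; split => x /=; rewrite in_itv.
have mf : measurable_fun setT (fun v : R => ((\1_[set v : R | v <= c] v) : R)%:E).
  by apply/measurable_EFinP; exact: measurable_indic.
have f0 (v : R) : (0 <= ((\1_[set v : R | v <= c] v) : R)%:E :> \bar R)%E by rewrite lee_fin.
have [c0|c0] := ltP c 0.
  rewrite min_r// (@eq_integral_uniform01 _ _ (cst 0%E))//; first by rewrite integral0.
  move=> x /andP[x0 _]; rewrite indicE memNset//= => xc.
  by have := lt_trans (lt_le_trans x0 xc) c0; rewrite ltxx.
have [c1|c1] := leP 1 c.
  rewrite (@eq_integral_uniform01 _ _ (cst 1%E))//.
    by rewrite integral_cst// mul1e; exact: (probability_setT U).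
  move=> x /andP[_ x1]; rewrite indicE mem_set//=.
  by rewrite (le_trans (ltW x1)).
rewrite integral_uniform01// integral_indic//= (_ : _ `&` _ = `[0, c]%classic); last first.
  apply/seteqP; split => x /=; rewrite !in_itv/=; first by move=> [-> /andP[-> _]].
  by move=> /andP[-> xc]; rewrite xc (le_trans xc (ltW c1)).
rewrite lebesgue_measure_itv/= lte_fin.
move: c0; rewrite le_eqVlt => /predU1P[<-|->]; first by rewrite ltxx.
by rewrite oppr0 adde0.
Qed.

(** Layer [j] contributes the part of [h] between [j] and [j + 1]. *)
Lemma layers_mass (h : R) : 0 <= h ->
  (\sum_(0 <= j <oo) \int[U]_v ((\1_[set v : R | j%:R + v <= h] v) : R)%:E = h%:E)%E.
Proof.
move=> h0.
have E (j : nat) : (\int[U]_v ((\1_[set v : R | j%:R + v <= h] v) : R)%:E =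
    (Num.min 1 (Num.max 0 (h - j%:R)))%:E)%E.
  rewrite -uniform01_le; apply: eq_integral => v _; congr (\1__ _)%:E.
  by apply/seteqP; split => x /=; rewrite lerBrDl.
apply/cvg_lim => //; apply: cvg_near_cst; near=> n.
have hn : h <= n%:R by near: n; exact: nbhs_infty_ger.
under eq_bigr do rewrite E.
(* The first [m] layers sum to [min m h], by induction on [m]. *)
rewrite sumEFin; congr EFin; rewrite -[RHS](min_r hn).
elim: (n) => [|m ih]; first by rewrite big_geq// min_l.
rewrite big_nat_recr//= ih -natr1.
have m0 : 0 <= m%:R :> R by [].
have [h1|h1] := leP h m%:R.
  have -> : Num.max 0 (h - m%:R) = 0 by rewrite max_l// subr_le0.
  have -> : Num.min 1 0 = 0 :> R by rewrite min_r.
  by rewrite addr0 min_r// (le_trans h1)// lerDl.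
have -> : Num.max 0 (h - m%:R) = h - m%:R by rewrite max_r// subr_ge0 ltW.
have [h2|h2] := leP (m%:R + 1) h.
  by rewrite min_l// lerBrDl.
by rewrite min_r ?lerBlDl ?ltW// addrC subrK.
Unshelve. all: by end_near. Qed.

End layers.

Lemma measurable_bool_natr d (T : measurableType d) (R : realType) (b : T -> bool) :
  measurable_fun setT b -> measurable_fun setT (fun x => (b x)%:R : R).
Proof.
move=> mb; rewrite (_ : (fun x => _) = (fun x => if b x then 1 else 0 : R)).
  exact: measurable_fun_if.
by apply/funext => x; case: (b x).
Qed.

Section marked_points.
Context (R : realType).
Local Notation U := (uniform01 R).
Local Notation mu := (@lebesgue_measure R).
Local Notation Ut := (measurableTypeR R).
Variable rho : R -> R.
Hypotheses (mrho : measurable_fun setT rho) (rho_ge0 : forall x, 0 <= rho x).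

(** Two splits give three independent uniform variables, of which the first two are made
    exponential. *)
Definition mark_time (z : Ut) : R := exp_mark (split_unif z).1.
Definition mark_size (z : Ut) : R := exp_mark (split_unif (split_unif z).2).1.
Definition mark_level (z : Ut) : R := (split_unif (split_unif z).2).2.

(* Density of the intensity [rho s ds dt] with respect to the law
   [exp (- t - s) ds dt] of the marks. *)
Definition intensity_ratio (t s : R) : R := rho s * expR s * expR t.

(** Real-valued, to serve as a factor of jumps and integrands. The guard [0 < t] makes every path
    vanish at time 0. *)
Definition accept (j : nat) (t s v : R) : R :=
  (0 < t)%R%:R * (0 < s)%R%:R * \1_[set v : R | j%:R + v <= intensity_ratio t s] v.

Definition mark_accept (j : nat) (z : Ut) : R :=
  accept j (mark_time z) (mark_size z) (mark_level z).

Lemma acceptE j t s v :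
  accept j t s v = (0 < t)%R%:R * (0 < s)%R%:R * (j%:R + v <= intensity_ratio t s)%R%:R.
Proof.
rewrite /accept indicE; congr (_ * (nat_of_bool _)%:R).
by apply/idP/idP; rewrite inE.
Qed.

Lemma accept_ge0 j t s v : 0 <= accept j t s v.
Proof. by rewrite acceptE !mulr_ge0. Qed.

Lemma accept_bool j t s v : accept j t s v = 0 \/ accept j t s v = 1.
Proof.
rewrite acceptE -!natrM !mulnb.
by case: (_ && _); [right|left].
Qed.

Lemma measurable_intensity_ratio d (T : measurableType d) (f g : T -> R) :
  measurable_fun setT f -> measurable_fun setT g ->
  measurable_fun setT (fun x => intensity_ratio (f x) (g x)).
Proof.
move=> mf mg; apply: measurable_funM; last exact: measurableT_comp.
by apply: measurable_funM; exact: measurableT_comp.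
Qed.

Lemma measurable_accept d (T : measurableType d) j (f g h : T -> R) :
  measurable_fun setT f -> measurable_fun setT g -> measurable_fun setT h ->
  measurable_fun setT (fun x => accept j (f x) (g x) (h x)).
Proof.
move=> mf mg mh; under eq_fun do rewrite acceptE.
apply: measurable_funM; first apply: measurable_funM.
- by apply: measurable_bool_natr; exact: measurable_fun_ltr.
- by apply: measurable_bool_natr; exact: measurable_fun_ltr.
- apply: measurable_bool_natr; apply: measurable_fun_ler.
    exact: measurable_funD.
  exact: measurable_intensity_ratio.
Qed.

Let mS : measurable_fun setT (@split_unif R) := @measurable_split_unif R.

Let mS2 : measurable_fun setT (fun z : Ut => (split_unif z).2).
Proof. exact: measurableT_comp measurable_snd mS. Qed.

Let mS1 : measurable_fun setT (fun z : Ut => (split_unif z).1).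
Proof. exact: measurableT_comp measurable_fst mS. Qed.

Let mE := @measurable_exp_mark R.

Lemma measurable_mark_time : measurable_fun setT mark_time.
Proof. exact: measurableT_comp mE mS1. Qed.

Lemma measurable_mark_size : measurable_fun setT mark_size.
Proof. exact: measurableT_comp mE (measurableT_comp mS1 mS2). Qed.

Lemma measurable_mark_level : measurable_fun setT mark_level.
Proof. exact: measurableT_comp mS2 mS2. Qed.

(** Campbell's formula for the kept marks. Integrating the level and summing over the layers
    produces [intensity_ratio]; the exponentials in this ratio cancel the densities of time and
    size. *)
Lemma mark_intensity (A B : R -> R) : measurable_fun setT A -> measurable_fun setT B ->
  (forall x, 0 <= A x) -> (forall x, 0 <= B x) ->
  (\sum_(0 <= j <oo)
     \int[U]_z (mark_accept j z * A (mark_time z) * B (mark_size z))%:E =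
   (\int[mu]_(x in `]0%R, +oo[) (A x)%:E) *
   \int[mu]_(x in `]0%R, +oo[) (B x * rho x)%:E)%E.
Proof.
move=> mA mB A0 B0.
pose G j (t s v : R) := (accept j t s v * A t * B s)%:E.
have G0 j t s v : (0 <= G j t s v)%E by rewrite lee_fin !mulr_ge0// accept_ge0.
pose K t s v := (\sum_(0 <= j <oo) G j t s v)%E.
have K0 t s v : (0 <= K t s v)%E by exact: nneseries_ge0.
have mG d (T : measurableType d) j (f g h : T -> R) :
    measurable_fun setT f -> measurable_fun setT g -> measurable_fun setT h ->
    measurable_fun setT (fun x => G j (f x) (g x) (h x)).
  move=> mf mg mh; apply/measurable_EFinP; apply: measurable_funM.
    by apply: measurable_funM; [exact: measurable_accept|exact: measurableT_comp].
  exact: measurableT_comp.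
have mK d (T : measurableType d) (f g h : T -> R) :
    measurable_fun setT f -> measurable_fun setT g -> measurable_fun setT h ->
    measurable_fun setT (fun x => K (f x) (g x) (h x)).
  move=> mf mg mh; apply: (ge0_emeasurable_sum (P := xpredT)) => //.
  by move=> j _; exact: mG.
transitivity (\int[U]_z K (mark_time z) (mark_size z) (mark_level z))%E.
  rewrite /K integral_nneseries//.
  move=> j; apply: mG; [exact: measurable_mark_time|exact: measurable_mark_size|
    exact: measurable_mark_level].
have mlayer (j : nat) (h : R) :
    measurable_fun setT (fun v : R => ((\1_[set v : R | j%:R + v <= h] v) : R)%:E).
  have mI : measurable [set v : R | j%:R + v <= h].
    rewrite (_ : [set v | _] = `]-oo, h - j%:R]%classic)//.
    by apply/seteqP; split => v /=; rewrite in_itv/= lerBrDl.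
  by apply/measurable_EFinP; exact: measurable_indic.
have mf1 : measurable_fun setT (fun z : Ut * Ut => exp_mark z.1).
  exact: measurableT_comp mE measurable_fst.
transitivity (\int[U]_x \int[U]_y
    K (exp_mark x) (exp_mark (split_unif y).1) (split_unif y).2)%E.
  apply: (@integral_split_unif R (fun z =>
    K (exp_mark z.1) (exp_mark (split_unif z.2).1) (split_unif z.2).2)).
    apply: mK => //.
      by apply: measurableT_comp mE _; exact: measurableT_comp mS1 measurable_snd.
    exact: measurableT_comp mS2 measurable_snd.
  by move=> z; exact: K0.
transitivity (\int[U]_x \int[U]_u
   (((0 < exp_mark x)%R%:R * A (exp_mark x) * expR (exp_mark x))%:E *
   ((0 < exp_mark u)%R%:R * B (exp_mark u) * rho (exp_mark u) * expR (exp_mark u))%:E))%E.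
  apply: eq_integral => x _.
  rewrite (@integral_split_unif R (fun z => K (exp_mark x) (exp_mark z.1) z.2)); last 2 first.
  - by apply: mK => //; exact: measurable_snd.
  - by move=> z; exact: K0.
  apply: eq_integral => u _.
  transitivity (\int[U]_v \sum_(0 <= j <oo) G j (exp_mark x) (exp_mark u) v)%E => //.
  rewrite integral_nneseries//; last first.
    by move=> j; apply: (mG _ Ut j (cst _) (cst _) id).
  set t := exp_mark x; set s := exp_mark u.
  (* [c] gathers the factors that do not depend on the level; [layers_mass] sums the rest to
     [intensity_ratio t s]. *)
  pose c := (0 < t)%R%:R * (0 < s)%R%:R * A t * B s.
  have c0 : 0 <= c by rewrite !mulr_ge0.
  transitivity (c%:E * (intensity_ratio t s)%:E)%E; last first.
    by rewrite -!EFinM /c /intensity_ratio; congr EFin; ring.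
  rewrite -layers_mass; last by rewrite !mulr_ge0// expR_ge0.
  rewrite -nneseriesZl; last by move=> j _; apply: integral_ge0 => v _; rewrite lee_fin.
  apply: eq_eseriesr => j _; rewrite -ge0_integralZl//; last exact: mlayer.
  apply: eq_integral => v _; rewrite /G /accept -EFinM /c; congr EFin; ring.
have mfA : measurable_fun setT
    (fun x : R => ((0 < x)%R%:R * A x * expR x)%:E).
  apply/measurable_EFinP; apply: measurable_funM => //.
  apply: measurable_funM => //; apply: measurable_bool_natr.
  exact: measurable_fun_ltr.
have mfB : measurable_fun setT
    (fun x : R => ((0 < x)%R%:R * B x * rho x * expR x)%:E).
  apply/measurable_EFinP; apply: measurable_funM => //.
  apply: measurable_funM => //; apply: measurable_funM => //.
  by apply: measurable_bool_natr; exact: measurable_fun_ltr.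
have fA0 x : (0 <= ((0 < x)%R%:R * A x * expR x)%:E)%E.
  by rewrite lee_fin !mulr_ge0// expR_ge0.
have fB0 x : (0 <= ((0 < x)%R%:R * B x * rho x * expR x)%:E)%E.
  by rewrite lee_fin !mulr_ge0// expR_ge0.
under eq_integral => x _.
  rewrite ge0_integralZl//; last exact: measurableT_comp mfB mE.
  rewrite (integral_exp_mark mfB fB0).
  over.
rewrite /= ge0_integralZr//; last 2 first.
- exact: measurableT_comp mfA mE.
- by apply: integral_ge0 => x _; rewrite mule_ge0// lee_fin expR_ge0.
rewrite (integral_exp_mark mfA fA0); congr (_ * _)%E.
  apply: eq_integral => x; rewrite inE/= in_itv/= andbT => x0.
  by rewrite x0 mul1r -EFinM -mulrA -expRD subrr expR0 mulr1.
apply: eq_integral => x; rewrite inE/= in_itv/= andbT => x0.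
by rewrite x0 mul1r -EFinM -(mulrA (B x * _)) -expRD subrr expR0 mulr1.
Qed.

End marked_points.

Lemma cvg_nneseries_EFin (R : realType) (u : nat -> R) (c : R) :
  (\sum_(0 <= j <oo) (u j)%:E)%E = c%:E -> (forall j, 0 <= u j) ->
  \sum_(j < J) u j @[J --> \oo] --> c.
Proof.
move=> uc u0.
have : (\sum_(0 <= j < J) (u j)%:E)%E @[J --> \oo] --> c%:E.
  by rewrite -uc; apply: is_cvg_nneseries => j _ _; rewrite lee_fin.
move/fine_cvgP => [_]; apply: cvg_trans; apply: near_eq_cvg; near=> J.
by rewrite /= sumEFin big_mkord.
Unshelve. all: by end_near. Qed.

(** The intervals []t i, t i.+1]] are disjoint: at most one term of the inner sum is nonzero, so the
    exponential may be taken term by term. *)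
Lemma disjoint_exponent (R : realType) (n : nat) (t w : nat -> R) (x s : R) :
  nondecreasing_seq t ->
  1 - expR (- (s * \sum_(i < n) w i * (t i < x <= t i.+1)%R%:R)) =
  \sum_(i < n) (t i < x <= t i.+1)%R%:R * (1 - expR (- (w i * s))).
Proof.
move=> tnd; elim: n => [|n ih].
  by rewrite !big_ord0 mulr0 oppr0 expR0 subrr.
rewrite !big_ord_recr/=; case: (boolP (t n < x <= t n.+1)) => [/andP[tnx xtn]|_]; last first.
  by rewrite mulr0 addr0 mul0r addr0.
have zero (F : nat -> R -> R) : (forall i, F i 0 = 0) ->
    \sum_(i < n) F i (t i < x <= t i.+1)%R%:R = 0.
  move=> F0; apply: big1 => i _; rewrite (_ : _ <= _ = false) ?andbF ?F0//.
  by apply/negP => xi; have := lt_le_trans tnx (le_trans xi (tnd _ _ (ltn_ord i)));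
    rewrite ltxx.
rewrite (zero (fun i y => w i * y)); last by move=> i; rewrite mulr0.
rewrite (zero (fun i y => y * (1 - expR (- (w i * s))))); last by move=> i; rewrite mul0r.
by rewrite !add0r mulr1 mul1r mulrC.
Qed.

Lemma cvg_big_sum (R : realType) (I T : Type) (r : seq I) (F : set_system T) {FF : Filter F}
    (f : I -> T -> R) (a : I -> R) :
  (forall i, f i u @[u --> F] --> a i) ->
  \sum_(i <- r) f i u @[u --> F] --> \sum_(i <- r) a i.
Proof.
move=> fa; elim: r => [|i r ih].
  by under eq_fun do rewrite big_nil; rewrite big_nil; exact: cvg_cst.
by under eq_fun do rewrite big_cons; rewrite big_cons; exact: cvgD.
Qed.

(** * Subordinators with a given Levy density *)

Section levy_subordinator.
Context (R : realType).
Local Notation U := (uniform01 R).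
Local Notation mu := (@lebesgue_measure R).
Variables (rho psi : R -> R) (M : R).
Hypotheses (mrho : measurable_fun setT rho) (rho_ge0 : forall x, 0 <= rho x).
Hypothesis psiE : forall w : R, 0 <= w ->
  (\int[mu]_(x in `]0%R, +oo[) ((1 - expR (- (w * x))) * rho x)%:E = (psi w)%:E)%E.
Hypotheses (psi_le : forall w : R, 0 <= w -> psi w <= M * w).

Definition mark_jump (t : R) (j : nat) (z : R) : R :=
  mark_accept rho j z * mark_size z * (mark_time z <= t)%R%:R.

(** Restricted to the first [J] layers, the sum of jumps is finite at every sample point. *)
Definition partial_process (J : nat) (t : R) : R -> R :=
  poisson_series (@split_unif R) (@poisson1_number R) J (mark_jump t).

Lemma mark_jump_ge0 t j z : 0 <= mark_jump t j z.
Proof. by rewrite !mulr_ge0// ?accept_ge0// exp_mark_ge0. Qed.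

Let maccept j : measurable_fun setT (mark_accept rho j).
Proof.
apply: measurable_accept => //; [exact: measurable_mark_time|
  exact: measurable_mark_size|exact: measurable_mark_level].
Qed.

Lemma measurable_mark_jump t j : measurable_fun setT (mark_jump t j).
Proof.
apply: measurable_funM.
  exact: (measurable_funM (maccept j) (@measurable_mark_size R)).
apply: measurable_bool_natr; apply: measurable_fun_ler => //.
exact: measurable_mark_time.
Qed.

Lemma mark_jump_homo j z (s t : R) : s <= t -> mark_jump s j z <= mark_jump t j z.
Proof.
move=> st; rewrite ler_wpM2l//; first by rewrite mulr_ge0 ?accept_ge0 ?exp_mark_ge0.
by rewrite ler_nat; case: leP => // zs; rewrite (le_trans zs).
Qed.

Lemma mark_jump0 j z : mark_jump 0 j z = 0.
Proof.
rewrite /mark_jump /mark_accept acceptE; case: ltP => t0.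
  by rewrite mulr0.
by rewrite !mul0r.
Qed.

Lemma measurable_partial_process J t : measurable_fun setT (partial_process J t).
Proof.
apply: measurable_poisson_series.
- exact: measurable_split_unif.
- exact: measurable_poisson1_number.
- by move=> j; exact: measurable_mark_jump.
Qed.

Lemma partial_process_nd t z : nondecreasing_seq (fun J => partial_process J t z).
Proof. by apply: poisson_series_nd => j y; exact: mark_jump_ge0. Qed.

Lemma partial_process_ge0 J t z : 0 <= partial_process J t z.
Proof. by apply: poisson_series_ge0 => j y; exact: mark_jump_ge0. Qed.

Lemma partial_process_homo J z (s t : R) : s <= t ->
  partial_process J s z <= partial_process J t z.
Proof.
by move=> st; apply: ler_sum => j _; apply: ler_sum => i _; exact: mark_jump_homo.
Qed.

Lemma partial_process0 J z : partial_process J 0 z = 0.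
Proof. by apply: big1 => j _; apply: big1 => i _; exact: mark_jump0. Qed.

(** For a given mark, the truth of [mark_time z <= u] does not change for [u > t] close to [t]. *)
Lemma mark_jump_right_continuous j z (t : R) :
  mark_jump u j z @[u --> t^'+] --> mark_jump t j z.
Proof.
apply: cvg_near_cst; case: (leP (mark_time z) t) => zt.
  near=> u; rewrite /mark_jump zt (le_trans zt)//.
near=> u; rewrite /mark_jump !leNgt zt (_ : u < _)//.
Unshelve. all: by end_near. Qed.

Lemma partial_process_right_continuous J z (t : R) :
  partial_process J u z @[u --> t^'+] --> partial_process J t z.
Proof.
apply: cvg_big_sum => j; apply: cvg_big_sum => i.
exact: mark_jump_right_continuous.
Qed.

(** Laplace exponent at [w] of the increment over []a, b]] of the process built from [J] layers. *)
Definition accepted_exponent (J : nat) (a b w : R) : R :=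
  \sum_(j < J) \int[U]_z (mark_accept rho j z * (a < mark_time z <= b)%R%:R *
                          (1 - expR (- (w * mark_size z)))).

Let unit_time (a b : R) : unit_fun (fun x : R => (a < x <= b)%R%:R : R).
Proof.
split; last by move=> x; rewrite ler0n/= lern1 leq_b1.
apply: measurable_bool_natr; apply: measurable_and.
  exact: measurable_fun_ltr.
exact: measurable_fun_ler.
Qed.

Let unit_size (w : R) : 0 <= w -> unit_fun (fun x : R => 1 - expR (- (w * `|x|))).
Proof. by move=> w0; apply: unit_funB; exact: unit_laplace_kernel. Qed.

Let unit_exponent j (a b w : R) : 0 <= w ->
  unit_fun (fun z : R => mark_accept rho j z * (a < mark_time z <= b)%R%:R *
                          (1 - expR (- (w * mark_size z)))).
Proof.
move=> w0; apply: unit_funM; first apply: unit_funM.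
- split=> [|z]; first exact: maccept.
  rewrite /mark_accept.
  by case: (accept_bool rho j (mark_time z) (mark_size z) (mark_level z)) => ->;
    rewrite ?ler01 ?lexx.
- exact: (unit_fun_comp (unit_time a b) (@measurable_mark_time R)).
- have := unit_fun_comp (unit_size w0) (@measurable_mark_size R).
  congr unit_fun; apply/funext => z /=.
  by rewrite ger0_norm// exp_mark_ge0.
Qed.

(** An instance of [mark_intensity], with the indicator of []a, b]] in time and
    [1 - expR (- (w * |x|))] in size; [0 <= a] keeps the interval inside []0, +oo[]. *)
Lemma accepted_exponent_cvg (a b w : R) : 0 <= a -> a <= b -> 0 <= w ->
  accepted_exponent J a b w @[J --> \oo] --> (b - a) * psi w.
Proof.
move=> a0 ab w0; apply: (@cvg_nneseries_EFin _ (fun j => \int[U]_z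
    (mark_accept rho j z * (a < mark_time z <= b)%R%:R *
     (1 - expR (- (w * mark_size z)))))); last first.
  by move=> j; apply: unit_integral_ge0; exact: unit_exponent.
have us := unit_size w0; have ut := unit_time a b.
have := mark_intensity mrho rho_ge0 ut.1 us.1 (unit_fun_ge0 ut) (unit_fun_ge0 us).
rewrite (_ : (\int[mu]_(x in _) (_ < x <= _)%R%:R%:E)%E = (b - a)%:E); last first.
  transitivity (\int[mu]_(x in `]0%R, +oo[) ((\1_(`]a, b]%classic) x : R)%:E))%E.
    apply: eq_integral => x _; rewrite indicE; congr (nat_of_bool _)%:R%:E.
    by apply/idP/idP; rewrite inE/= in_itv.
  rewrite integral_indic// setIidl; last first.
    by move=> x /=; rewrite !in_itv/= andbT => /andP[ax _]; rewrite (le_lt_trans a0).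
  rewrite [LHS]/= lebesgue_measure_itv/= lte_fin EFinB.
  move: ab; rewrite le_eqVlt => /predU1P[->|->]//.
  by rewrite ltxx subee.
rewrite (_ : (\int[mu]_(x in _) _)%E = (psi w)%:E); last first.
  rewrite -(psiE w0); apply: eq_integral => x; rewrite inE/= in_itv/= andbT => x0.
  by rewrite gtr0_norm.
rewrite -EFinM => <-; apply: eq_eseriesr => j _.
apply: etrans (EFin_unit_integral (probability_lty U) (unit_exponent j a b w0)) _.
by apply: eq_integral => z _; rewrite ger0_norm// exp_mark_ge0.
Qed.

(** A weighted sum of increments is again a Poisson series, with the mark function [g], so its
    transform is explicit; [disjoint_exponent] then separates the time intervals. *)
Lemma partial_process_laplace (J n : nat) (t w : nat -> R) :
  0 <= t 0%N -> nondecreasing_seq t -> (forall i, 0 <= w i) ->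
  \int[U]_z expR (- \sum_(i < n) w i *
    (partial_process J (t i.+1) z - partial_process J (t i) z)) =
  expR (- \sum_(i < n) accepted_exponent J (t i) (t i.+1) (w i)).
Proof.
move=> t0 tnd w0.
pose g j z := \sum_(i < n) w i * (mark_jump (t i.+1) j z - mark_jump (t i) j z).
have g0 j z : 0 <= g j z.
  by apply: sumr_ge0 => i _; rewrite mulr_ge0// subr_ge0 mark_jump_homo// tnd.
have mg j : measurable_fun setT (g j).
  apply: measurable_sum => i; apply: measurable_funM => //.
  by apply: measurable_funB; exact: measurable_mark_jump.
transitivity (\int[U]_z expR (- poisson_series (@split_unif R) (@poisson1_number R) J g z)).
  apply: eq_Rintegral => z _; congr (expR (- _)).
  rewrite /partial_process /poisson_series /poisson_sum /g.
  under eq_bigr do rewrite -sumrB mulr_sumr.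
  rewrite exchange_big/=; apply: eq_bigr => j _.
  under eq_bigr do rewrite -sumrB mulr_sumr.
  by rewrite exchange_big.
rewrite (@laplace_poisson_series _ _ _ U (@split_unif R) (@measurable_split_unif R)
  (@integral_split_unif R) (@poisson1_number R) (@measurable_poisson1_number R)
  (@poisson1_number_laplace R) J g mg g0).
congr (expR (- _)); rewrite /accepted_exponent exchange_big/=.
apply: eq_bigr => j _.
have oo := probability_lty U.
rewrite (_ : \int[U]_x (1 - expR (- g j x)) = \int[U]_z \sum_(i < n)
   (mark_accept rho j z * (t i < mark_time z <= t i.+1)%R%:R *
                          (1 - expR (- (w i * mark_size z))))); last first.
  apply: eq_Rintegral => z _.
  have gE : g j z = mark_accept rho j z *
      (mark_size z * \sum_(i < n) w i * (t i < mark_time z <= t i.+1)%R%:R).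
    rewrite /g !mulr_sumr; apply: eq_bigr => i _; rewrite /mark_jump.
    have : t i <= t i.+1 by exact: tnd.
    by case: (leP (mark_time z) (t i)) => h1; case: (leP (mark_time z) (t i.+1)) => h2 h3 /=;
      [ring|have := lt_le_trans h2 (le_trans h1 h3); rewrite ltxx|ring|ring].
  under eq_bigr do rewrite -mulrA.
  rewrite -mulr_sumr -disjoint_exponent// gE /mark_accept.
  (* As [mark_accept] is 0 or 1, it leaves the exponential: [1 - expR (- (e * y)) = e * (1 - expR (-
     y))]. *)
  case: (accept_bool rho j (mark_time z) (mark_size z) (mark_level z)) => ->.
    by rewrite !mul0r oppr0 expR0 subrr.
  by rewrite !mul1r.
have ue i := unit_exponent j (t i) (t i.+1) (w0 i).
apply: EFin_inj; rewrite -sumEFin.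
under [RHS]eq_bigr do rewrite (EFin_unit_integral oo (ue _)).
rewrite -ge0_integral_sum//; last 2 first.
- by move=> i; apply/measurable_EFinP; exact: (ue i).1.
- by move=> i z _; rewrite lee_fin; exact: (unit_fun_ge0 (ue i)).
rewrite fineK; first by apply: eq_integral => z _; rewrite sumEFin.
under eq_integral do rewrite -sumEFin.
rewrite ge0_integral_sum//; last 2 first.
- by move=> i; apply/measurable_EFinP; exact: (ue i).1.
- by move=> i z _; rewrite lee_fin; exact: (unit_fun_ge0 (ue i)).
by under eq_bigr do rewrite -(EFin_unit_integral oo (ue _)); rewrite sumEFin.
Qed.

Lemma accepted_exponent_le (J : nat) (a b w : R) : 0 <= a -> a <= b -> 0 <= w ->
  accepted_exponent J a b w <= (b - a) * psi w.
Proof.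
move=> a0 ab w0; have cv := accepted_exponent_cvg a0 ab w0.
rewrite -(cvg_lim _ cv)//; apply: nondecreasing_cvgn_le; last first.
  by apply/cvg_ex; exists ((b - a) * psi w).
apply/nondecreasing_seqP => n; rewrite /accepted_exponent big_ord_recr/= lerDl.
by apply: unit_integral_ge0; exact: unit_exponent.
Qed.

(** Integer times and integer bounds make this a countable combination of measurable events;
    monotonicity in time covers the other times. *)
Definition bounded_paths (n : nat) : set R :=
  [set z | exists m : nat, forall J, partial_process J n%:R z <= m%:R].

Lemma measurable_bounded_paths n : measurable (bounded_paths n).
Proof.
rewrite (_ : bounded_paths n =
    \bigcup_m \bigcap_J [set z | partial_process J n%:R z <= m%:R]).
  apply: bigcup_measurable => m _; apply: bigcap_measurableType => J _.
  rewrite (_ : [set z | _] = partial_process J n%:R @^-1` `]-oo, m%:R]).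
    by rewrite -[X in measurable X]setTI; apply: measurable_partial_process.
  by apply/seteqP; split => z /=; rewrite in_itv.
apply/seteqP; split => z /=; first by move=> [m zm]; exists m => // J _; exact: zm.
by move=> [m _ zm]; exists m => J; exact: (zm J I).
Qed.

Lemma unbounded_paths_cvg n (w : R) z : 0 < w -> ~ bounded_paths n z ->
  expR (- (w * partial_process J n%:R z)) @[J --> \oo] --> (0 : R).
Proof.
move=> w0 nb.
have pinfty : (w * partial_process J n%:R z) @[J --> \oo] --> +oo.
  apply/cvgryPge => A; near \oo => m.
  have [J zJ] : exists J, m%:R < partial_process J n%:R z.
    apply: contrapT => h; apply: nb; exists m => J; rewrite leNgt; apply/negP => zJ.
    by apply: h; exists J.
  have mA : A / w <= m%:R by near: m; exact: nbhs_infty_ger.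
  near=> K; rewrite mulrC -ler_pdivrMr//.
  apply: le_trans mA (le_trans (ltW zJ) _); apply: partial_process_nd.
  by near: K; exact: nbhs_infty_ge.
apply: (@cvg_comp _ _ _ (fun J => w * partial_process J n%:R z)
  (fun x => expR (- x)) _ (pinfty_nbhs R)) => //.
exact: cvgr_expR.
Unshelve. all: by end_near. Qed.

Let unit_expN d (T : measurableType d) (g : T -> R) : measurable_fun setT g ->
  (forall x, 0 <= g x) -> unit_fun (fun x => expR (- g x)).
Proof.
move=> mg g0; split.
  by apply: measurableT_comp => //; exact: measurableT_comp.
by move=> x; rewrite expR_ge0/= -[leRHS]expR0 ler_expR oppr_le0.
Qed.

(** At rate [w] the transform is at least [1 - n M w] for every [J], whereas as [J] grows it charges
    only bounded paths, with weight at most 1. So [1 - n M w] bounds the probability from below for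
    every [w > 0], and [w] may tend to 0. *)
Lemma bounded_paths_prob n : U (bounded_paths n) = 1%E.
Proof.
have oo := probability_lty U.
have mB := measurable_bounded_paths n.
pose b : R := \int[U]_z \1_(bounded_paths n) z.
have ui : unit_fun (\1_(bounded_paths n) : R -> R) by exact: unit_fun_indic.
have UB : U (bounded_paths n) = b%:E.
  apply: etrans _ (esym (EFin_unit_integral oo ui)).
  by rewrite integral_indic// setIT.
have b1 : b <= 1 by rewrite -lee_fin -UB probability_le1.
suff b1' : 1 <= b by rewrite UB; congr EFin; apply/eqP; rewrite eq_le b1.
have bound (w : R) : 0 < w -> 1 - n%:R * (M * w) <= b.
  move=> w0; have w0' := ltW w0.
  have up J : unit_fun (fun z => expR (- (w * partial_process J n%:R z))).
    apply: unit_expN.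
      by apply: measurable_funM => //; exact: measurable_partial_process.
    by move=> z; rewrite mulr_ge0// partial_process_ge0.
  have uc : unit_fun (fun z => 1 - \1_(bounded_paths n) z : R) by exact: unit_funB.
  have uu J := unit_funM uc (up J).
  have low J : 1 - n%:R * (M * w) <= b +
      \int[U]_z ((1 - \1_(bounded_paths n) z) * expR (- (w * partial_process J n%:R z))).
    have le1 : 1 - n%:R * (M * w) <= \int[U]_z expR (- (w * partial_process J n%:R z)).
      have := @partial_process_laplace J 1 (fun i => if i == 0%N then 0 else n%:R)
        (fun=> w).
      rewrite /= big_ord1/= => h.
      rewrite (_ : \int[U]_z _ = expR (- accepted_exponent J 0 n%:R w)); last first.
        rewrite -h//; last by apply/nondecreasing_seqP => -[|i]/=.
        by apply: eq_Rintegral => z _; rewrite big_ord1/= partial_process0 subr0.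
      apply: le_trans (expR_ge1Dx _); rewrite lerD2l lerN2.
      apply: le_trans (accepted_exponent_le _ _ _ _) _ => //.
      by rewrite subr0 ler_wpM2l// psi_le.
    apply: le_trans le1 _; rewrite /b.
    have ii := unit_fun_integrable oo ui.
    have ij := unit_fun_integrable oo (uu J).
    rewrite -(RintegralD _ ii ij)//; apply: le_Rintegral => //.
    - exact: unit_fun_integrable oo (up J).
    - exact: (integrableD measurableT ii ij).
    move=> z _ /=; rewrite indicE; case: (z \in _) => /=.
      by rewrite subrr mul0r addr0 (unit_fun_le1 (up J)).
    by rewrite subr0 mul1r add0r.
  have cv : b + \int[U]_z ((1 - \1_(bounded_paths n) z) *
      expR (- (w * partial_process J n%:R z))) @[J --> \oo] --> b + 0.
    apply: cvgD; first exact: cvg_cst.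
    have -> : 0 = \int[U]_z (0 : R) by rewrite (Rintegral_cst U)// mul0r.
    apply: unit_cvg_integral => //.
    apply: aeW => z; rewrite indicE; have [zB|zB] := boolP (z \in _) => /=.
      by rewrite subrr; under eq_fun do rewrite mul0r; exact: cvg_cst.
    rewrite subr0; under eq_fun do rewrite mul1r.
    by apply: unbounded_paths_cvg => //; move: zB; rewrite notin_setE.
  rewrite -[leRHS]addr0; apply: (ler_cvg_to (cvg_cst _) cv).
  by apply: nearW => J; exact: low.
rewrite leNgt; apply/negP => b1'.
(* Chosen so that [n M w <= (1 - b) / 2]; the [+ 1] avoids a zero denominator. *)
pose w := (1 - b) / (2 * (n%:R * `|M| + 1)).
have c0 : 0 < 2 * (n%:R * `|M| + 1) by rewrite mulr_gt0// ltr_wpDl// mulr_ge0.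
have w0 : 0 < w by rewrite divr_gt0// subr_gt0.
have := bound w w0.
have : n%:R * (M * w) <= (1 - b) / 2.
  apply: (@le_trans _ _ ((n%:R * `|M| + 1) * w)).
    rewrite mulrA ler_wpM2r ?(ltW w0)// -[leLHS]addr0 lerD// ler_wpM2l//.
    exact: ler_norm.
  rewrite le_eqVlt; apply/predU1P; left; rewrite /w; field.
  by move: c0; rewrite pmulr_rgt0// => /gt_eqF ->.
by move: b1'; lra.
Qed.

Definition good_paths : set R := \bigcap_n bounded_paths n.

Lemma measurable_good_paths : measurable good_paths.
Proof.
by apply: bigcap_measurableType => n _; exact: measurable_bounded_paths.
Qed.

Lemma good_paths_ae : {ae U, forall z, good_paths z}.
Proof.
apply/ae_foralln => n.
have mB := measurable_bounded_paths n.
exists (~` bounded_paths n); split; first exact: measurableC.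
  by apply: etrans (probability_setC U mB) _; rewrite bounded_paths_prob subee.
by move=> z /= nz bz; apply: nz.
Qed.

(** Paths are set to 0 off [good_paths], because monotonicity and right continuity are required at
    every sample point and not only almost surely. *)
Definition levy_process (t z : R) : R :=
  \1_good_paths z * limn (fun J => partial_process J t z).

Lemma good_paths_cvg t z : good_paths z ->
  partial_process J t z @[J --> \oo] --> levy_process t z.
Proof.
move=> gz; rewrite /levy_process indicE mem_set// mul1r.
have [m zm] := gz (Num.truncn t).+1 I.
apply: nondecreasing_is_cvgn; first exact: partial_process_nd.
exists m%:R => _ [J _ <-]; apply: le_trans (zm J).
by apply: partial_process_homo; rewrite ltW// truncnS_gt.
Qed.

Lemma levy_process_cvg t z :
  \1_good_paths z * partial_process J t z @[J --> \oo] --> levy_process t z.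
Proof.
have [gz|gz] := pselect (good_paths z).
  rewrite {1}indicE mem_set//; under eq_fun do rewrite mul1r.
  exact: good_paths_cvg.
rewrite /levy_process indicE memNset// mul0r; under eq_fun do rewrite mul0r.
exact: cvg_cst.
Qed.

Lemma measurable_levy_process t : measurable_fun setT (levy_process t).
Proof.
apply: (measurable_fun_cvg (h := fun J z => \1_good_paths z * partial_process J t z)).
  move=> J; apply: measurable_funM; last exact: measurable_partial_process.
  by apply: measurable_indic; exact: measurable_good_paths.
by move=> z _; exact: levy_process_cvg.
Qed.

Lemma levy_process0 z : levy_process 0 z = 0.
Proof.
rewrite /levy_process (_ : limn _ = 0) ?mulr0//.
by under eq_fun do rewrite partial_process0; exact: lim_cst.
Qed.

Lemma levy_process_homo z (s t : R) : s <= t -> levy_process s z <= levy_process t z.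
Proof.
move=> st; apply: (ler_cvg_to (@levy_process_cvg s z) (@levy_process_cvg t z)).
apply: nearW => J; apply: ler_wpM2l; first by rewrite indicE.
exact: partial_process_homo.
Qed.

(** Between [t] and [u <= t + 1] the layers beyond the first [J] add at most their total at time
    [t + 1], which is small for large [J]; the first [J] layers are right continuous. *)
Lemma levy_process_right_continuous z (t : R) :
  levy_process u z @[u --> t^'+] --> levy_process t z.
Proof.
have [gz|gz] := pselect (good_paths z); last first.
  rewrite /levy_process indicE memNset// mul0r; under eq_fun do rewrite mul0r.
  exact: cvg_cst.
have gap J (u : R) : t <= u -> u <= t + 1 ->
    levy_process u z - levy_process t z <=
    (partial_process J u z - partial_process J t z) +
    (levy_process (t + 1) z - partial_process J (t + 1) z).
  move=> tu ut; rewrite -subr_ge0.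
  (* The jumps of the later layers only accumulate with time: shown for the layers from [J] to [K],
     then passed to the limit in [K]. *)
  have tail (a b : R) : a <= b -> levy_process a z - partial_process J a z <=
      levy_process b z - partial_process J b z.
    move=> ab; have ca : (partial_process K a z - partial_process J a z) @[K --> \oo] -->
        levy_process a z - partial_process J a z.
      by apply: cvgB; [exact: good_paths_cvg|exact: cvg_cst].
    have cb : (partial_process K b z - partial_process J b z) @[K --> \oo] -->
        levy_process b z - partial_process J b z.
      by apply: cvgB; [exact: good_paths_cvg|exact: cvg_cst].
    apply: (ler_cvg_to ca cb); near=> K.
    have JK : (J <= K)%N by near: K; exact: nbhs_infty_ge.
    rewrite -(subnKC JK); elim: (K - J)%N => [|k ih]; first by rewrite addn0 !subrr.
    rewrite addnS /partial_process /poisson_series !big_ord_recr/=.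
    rewrite [leLHS]addrAC [leRHS]addrAC lerD//.
    by apply: ler_sum => i _; exact: mark_jump_homo.
  have t1 := tail u (t + 1) ut.
  have t2 : partial_process J t z <= levy_process t z.
    rewrite -(cvg_lim _ (good_paths_cvg (t := t) gz))//.
    apply: nondecreasing_cvgn_le; first exact: partial_process_nd.
    by apply/cvg_ex; exists (levy_process t z); exact: good_paths_cvg.
  lra.
apply/cvgrPdist_le => e e0.
have e2 : 0 < e / 2 by rewrite divr_gt0.
have [J hJ] : exists J, levy_process (t + 1) z - partial_process J (t + 1) z <= e / 2.
  have /cvgrPdist_le/(_ _ e2)[J _ hJ] := good_paths_cvg (t := t + 1) gz.
  by exists J; exact: le_trans (ler_norm _) (hJ J (leqnn J)).
have /cvgrPdist_le/(_ _ e2) hJt := partial_process_right_continuous (J := J) (z := z) (t := t).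
near=> u.
have tu : t <= u by apply: ltW; near: u; exact: nbhs_right_gt.
have ut : u <= t + 1 by apply: ltW; near: u; apply: nbhs_right_lt; rewrite ltrDl.
rewrite distrC ger0_norm ?subr_ge0 ?levy_process_homo//.
apply: le_trans (gap J u tu ut) _; rewrite [leRHS](splitr e) lerD//.
have : `|partial_process J t z - partial_process J u z| <= e / 2 by near: u.
by rewrite distrC; exact: le_trans (ler_norm _).
Unshelve. all: by end_near. Qed.

(** In the formula for [J] layers the left side converges by dominated convergence on the good
    paths, the right side by [accepted_exponent_cvg]. *)
Lemma levy_process_laplace : laplace_increments U levy_process psi.
Proof.
move=> n t w t0 tnd w0.
have ti0 i : 0 <= t i by exact: le_trans t0 (tnd _ _ (leq0n i)).
have tS i : t i <= t i.+1 by exact: tnd (leqnSn i).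
pose D J z := \sum_(i < n) w i * (partial_process J (t i.+1) z - partial_process J (t i) z).
pose L z := \sum_(i < n) w i * (levy_process (t i.+1) z - levy_process (t i) z).
have uD J : unit_fun (fun z => expR (- D J z)).
  apply: unit_expN.
    apply: measurable_sum => i; apply: measurable_funM => //.
    by apply: measurable_funB; exact: measurable_partial_process.
  move=> z; apply: sumr_ge0 => i _; rewrite mulr_ge0// subr_ge0.
  exact: partial_process_homo.
have mL : measurable_fun setT (fun z => expR (- L z)).
  apply: measurableT_comp => //; apply: measurableT_comp => //.
  apply: measurable_sum => i; apply: measurable_funM => //.
  by apply: measurable_funB; exact: measurable_levy_process.
have c1 : \int[U]_z expR (- D J z) @[J --> \oo] --> \int[U]_z expR (- L z).
  apply: unit_cvg_integral => //; first exact: probability_lty.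
  apply: (@filterS _ _ (ae_filter_ringOfSetsType U) _ _ _ good_paths_ae) => z gz.
  apply: continuous_cvg; first exact: continuous_expR.
  apply: cvgN; apply: cvg_big_sum => i; apply: cvgMr.
  by apply: cvgB; exact: good_paths_cvg.
have c2 : \int[U]_z expR (- D J z) @[J --> \oo] -->
    expR (- \sum_(i < n) (t i.+1 - t i) * psi (w i)).
  under eq_fun do rewrite partial_process_laplace//.
  apply: continuous_cvg; first exact: continuous_expR.
  by apply: cvgN; apply: cvg_big_sum => i; exact: accepted_exponent_cvg.
exact: (cvg_unique _ c1 c2).
Qed.

End levy_subordinator.

(** * Mixture densities and the gamma law *)

Section gamma_exponent.
Context (R : realType).
Local Notation mu := (@lebesgue_measure R).
Variable delta : R.
Hypothesis delta_gt0 : 0 < delta.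

Let mexpN (s : R) : measurable_fun setT (fun x : R => (expR (- (s * x)))%:E).
Proof.
by apply/measurable_EFinP; apply: measurableT_comp => //; exact: measurableT_comp.
Qed.

Lemma integral_expN_tail (a s : R) : 0 < s ->
  (\int[mu]_(x in `[a, +oo[) (expR (- (s * x)))%:E = (s^-1 * expR (- (s * a)))%:E)%E.
Proof.
move=> s0; rewrite (@ge0_integral_affine _ 1 a)//; last exact: measurable_funTS (mexpN s).
rewrite mul1e (_ : _ @^-1` _ = `[0%R, +oo[%classic); last first.
  by apply/seteqP; split => x /=; rewrite !in_itv/= !andbT mul1r lerDr.
transitivity (\int[mu]_(x in `[0%R, +oo[)
    ((expR (- (s * a)))%:E * (expR (- (s * x)))%:E))%E.
  by apply: eq_integral => x _; rewrite -EFinM -expRD mul1r; congr (expR _)%:E; ring.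
rewrite ge0_integralZl//; last exact: measurable_funTS (mexpN s).
by rewrite integral_expN// -EFinM mulrC.
Qed.

Lemma integral_inv (a b : R) : 0 < a -> a < b ->
  (\int[mu]_(x in `[a, b]) (x^-1)%:E = (ln b - ln a)%:E)%E.
Proof.
move=> a0 ab; rewrite EFinB; apply: continuous_FTC2 => //.
- apply: continuous_in_subspaceT => x; rewrite inE/= in_itv/= => /andP[ax _].
  by apply: inv_continuous; rewrite gt_eqF// (lt_le_trans a0).
- split.
  + move=> x; rewrite in_itv/= => /andP[ax _].
    by apply: ex_derive; apply: is_derive1_ln; exact: lt_trans ax.
  + by apply: cvg_at_right_filter; apply: continuous_ln.
  + by apply: cvg_at_left_filter; apply: continuous_ln; exact: lt_trans ab.
move=> x; rewrite in_itv/= => /andP[ax _].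
by rewrite derive1E; apply: derive_val; apply: is_derive1_ln; exact: lt_trans ax.
Qed.

(** The integrand is the integral of [expR (- (s * x))] over [delta <= x <= delta + w]; exchanging
    the two integrals leaves that of [1 / x]. The kernel [K] puts both domains into indicators for
    Tonelli's theorem. *)
Lemma frullani (w : R) : 0 <= w ->
  (\int[mu]_(s in `]0%R, +oo[)
    ((1 - expR (- (w * s))) * (s^-1 * expR (- (s * delta))))%:E =
   (ln (1 + w / delta))%:E)%E.
Proof.
rewrite le_eqVlt => /predU1P[<-|w0].
  rewrite mul0r addr0 ln1 integral0_eq// => s _.
  by rewrite mul0r oppr0 expR0 subrr mul0r.
have dw : delta < delta + w by rewrite ltrDl.
pose K (s x : R) : R := expR (- (s * x)) *
  (\1_(`]0, +oo[%classic) s * \1_(`[delta, delta + w]%classic) x).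
have mK : measurable_fun setT (fun z : R * R => (K z.1 z.2)%:E).
  apply/measurable_EFinP; apply: measurable_funM.
    apply: measurableT_comp => //; apply: measurableT_comp => //.
    by apply: measurable_funM.
  apply: measurable_funM.
    apply: (measurableT_comp (f := (\1_(`]0, +oo[%classic) : R -> R)) _ measurable_fst).
    exact: measurable_indic.
  apply: (measurableT_comp (f := (\1_(`[delta, delta + w]%classic) : R -> R)) _
    measurable_snd).
  exact: measurable_indic.
have K0 z : (0 <= (K z.1 z.2)%:E)%E.
  by rewrite lee_fin !mulr_ge0// ?expR_ge0// indicE.
have := @fubini_tonelli _ _ _ _ R mu mu _ mK K0.
rewrite /fubini_F/fubini_G/=.
rewrite (_ : (\int[mu]_x _)%E = (\int[mu]_(s in `]0%R, +oo[)
    ((1 - expR (- (w * s))) * (s^-1 * expR (- (s * delta))))%:E)%E); last first.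
  rewrite [RHS]integral_mkcond; apply: eq_integral => s _; rewrite patchE.
  case: ifPn => sI; last first.
    by rewrite integral0_eq// => x _; rewrite /K indicE (negbTE sI) mul0r mulr0.
  have s0 : 0 < s by move: sI; rewrite inE/= in_itv/= andbT.
  transitivity (\int[mu]_(x in `[delta, (delta + w)%R]) (expR (- (s * x)))%:E)%E.
    rewrite [RHS]integral_mkcond; apply: eq_integral => x _.
    rewrite patchE /K indicE sI mul1r indicE.
    by case: (x \in _); rewrite ?mulr1 ?mulr0.
  rewrite -integral_itv_bndo_bndc; last exact: measurable_funTS (mexpN s).
  have := integral_expN_tail delta s0.
  rewrite (@itv_bndbnd_setU _ _ (BLeft delta) (BLeft (delta + w)) +oo%O)//; last first.
    by rewrite bnd_simp ltW.
  rewrite ge0_integral_setU//; last 2 first.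
  - exact: measurable_funTS (mexpN s).
  - apply/disj_setPS => y [/=]; rewrite !in_itv/= => /andP[_ yw].
    by rewrite leNgt yw.
  rewrite integral_expN_tail// => E.
  move/(congr1 (fun y => y - (s^-1 * expR (- (s * (delta + w))))%:E)%E): E.
  rewrite addeK// -EFinB => ->; congr EFin.
  by rewrite (_ : - (s * (delta + w)) = - (w * s) - s * delta) ?expRD; ring.
move=> ->.
transitivity (\int[mu]_(x in `[delta, (delta + w)%R]) (x^-1)%:E)%E.
  rewrite [RHS]integral_mkcond; apply: eq_integral => x _; rewrite patchE.
  case: ifPn => xI; last first.
    by rewrite integral0_eq// => s _; rewrite /K [X in _ * X]mulrC indicE (negbTE xI) mul0r mulr0.
  have x0 : 0 < x.
    by move: xI; rewrite inE/= in_itv/= => /andP[+ _]; exact: lt_le_trans.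
  rewrite -(integral_expN_oy x0) [RHS]integral_mkcond; apply: eq_integral => s _.
  rewrite patchE /K [X in _ * X]mulrC indicE xI mul1r indicE mulrC.
  by case: (s \in _); rewrite ?mul1r ?mul0r// mulrC.
rewrite integral_inv// -ln_div ?posrE//; last exact: lt_trans dw.
by rewrite mulrDl divff ?gt_eqF.
Qed.

Lemma mixture_densityD (q : R -> R) (s : R) :
  measurable_fun `[delta, +oo[ q -> (forall x, delta <= x -> 0 <= q x <= 1) -> 0 < s ->
  (mixture_density delta (fun x => (1 - q x)%R) s + mixture_density delta q s)%E =
  (s^-1 * expR (- (s * delta)))%:E.
Proof.
move=> mq q01 s0; rewrite -integral_expN_tail// /mixture_density.
have mE : measurable_fun `[delta, +oo[ (fun x : R => expR (- (s * x))).
  by apply: measurable_funTS; apply/measurable_EFinP; exact: mexpN.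
rewrite -ge0_integralD//=.
- by apply: eq_integral => x _; rewrite -EFinD; congr EFin; ring.
- move=> x; rewrite in_itv/= andbT => /q01/andP[_ q1].
  by rewrite lee_fin mulr_ge0 ?expR_ge0// subr_ge0.
- by apply/measurable_EFinP; apply: measurable_funM => //; exact: measurable_funB.
- by move=> x; rewrite in_itv/= andbT => /q01/andP[q0 _]; rewrite lee_fin mulr_ge0 ?expR_ge0.
- by apply/measurable_EFinP; exact: measurable_funM.
Qed.

Let le1 (w s : R) : 0 <= w -> 0 < s -> 0 <= 1 - expR (- (w * s)).
Proof.
by move=> w0 s0; rewrite subr_ge0 -[leRHS]expR0 ler_expR oppr_le0 mulr_ge0// ltW.
Qed.

Let mint (w : R) (f : R -> R) : measurable_fun (`]0, +oo[ : set R) f ->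
  measurable_fun (`]0, +oo[ : set R) (fun s : R => ((1 - expR (- (w * s))) * f s)%:E).
Proof.
move=> mf; apply/measurable_EFinP; apply: measurable_funM => //.
by apply: measurable_funTS; apply: measurable_funB => //; apply/measurable_EFinP; exact: mexpN.
Qed.

Lemma measurable_gamma_density :
  measurable_fun (`]0, +oo[ : set R) (fun s : R => s^-1 * expR (- (s * delta))).
Proof.
apply: open_continuous_measurable_fun; first exact: interval_open.
move=> s; rewrite inE/= in_itv/= andbT => s0; apply: cvgM.
  by apply: inv_continuous; rewrite gt_eqF.
apply: continuous_comp; last exact: continuous_expR.
by apply: cvgN; apply: cvgMl; exact: cvg_id.
Qed.

Section mixture.
Variable q : R -> R.
Hypothesis mq : measurable_fun `[delta, +oo[ q.
Hypothesis q01 : forall x, delta <= x -> 0 <= q x <= 1.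

Let q_ge0 x : delta <= x -> 0 <= q x.
Proof. by move=> /q01/andP[]. Qed.

(** Extension of [q] by 0 to the whole line, measurable and nonnegative there, so that it can be the
    density of a measure. *)
Definition mixing_weight : R -> R := q \_ `[delta, +oo[.

Lemma measurable_mixing_weight : measurable_fun setT mixing_weight.
Proof. exact/(measurable_restrictT _ _).1. Qed.

Lemma mixing_weight_ge0 x : 0 <= mixing_weight x.
Proof.
rewrite /mixing_weight patchE; case: ifPn => //.
by rewrite inE/= in_itv/= andbT => /q_ge0.
Qed.

Lemma mixture_densityE (s : R) : (mixture_density delta q s =
  \int[mu]_x (expR (- (s * x)) * mixing_weight x)%:E)%E.
Proof.
rewrite /mixture_density integral_mkcond; apply: eq_integral => x _.
by rewrite /mixing_weight !patchE; case: ifPn => // _; rewrite mulr0.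
Qed.

Lemma mixture_density_ge0 (s : R) : (0 <= mixture_density delta q s)%E.
Proof.
by rewrite mixture_densityE integral_ge0// => x _;
  rewrite lee_fin mulr_ge0 ?expR_ge0 ?mixing_weight_ge0.
Qed.

(** Measurability in the parameter [s] comes from Tonelli's theorem, applied to the kernel on the
    plane. *)
Lemma measurable_mixture_density : measurable_fun setT (mixture_density delta q).
Proof.
rewrite (_ : mixture_density delta q = fun s : R =>
  \int[mu]_x (expR (- (s * x)) * mixing_weight x)%:E)%E; last first.
  by apply/funext => s; exact: mixture_densityE.
have mK : measurable_fun setT
    (fun z : R * R => (expR (- (z.1 * z.2)) * mixing_weight z.2)%:E).
  apply/measurable_EFinP; apply: measurable_funM.
    apply: measurableT_comp => //; apply: measurableT_comp => //.
    by apply: measurable_funM.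
  exact: (measurableT_comp measurable_mixing_weight measurable_snd).
apply: (@measurable_fun_fubini_tonelli_F _ _ _ _ R mu _ mK) => z.
by rewrite lee_fin mulr_ge0 ?expR_ge0 ?mixing_weight_ge0.
Qed.

Lemma mixture_density_le (s : R) : 0 < s ->
  (mixture_density delta q s <= (s^-1 * expR (- (s * delta)))%:E)%E.
Proof.
move=> s0; rewrite -(mixture_densityD mq q01 s0) leeDr//.
apply: integral_ge0 => x; rewrite /= in_itv/= andbT => /q01/andP[_ q1].
by rewrite lee_fin mulr_ge0 ?expR_ge0// subr_ge0.
Qed.

(** Real-valued form of the density, as the construction of the jumps requires. The bound by the
    gamma density makes [fine] faithful for [s > 0]; elsewhere, where the integral may be infinite,
    the value is 0. *)
Definition mixture_rate (s : R) : R :=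
  fine (mixture_density delta q s) * \1_(`]0, +oo[%classic) s.

Lemma measurable_mixture_rate : measurable_fun setT mixture_rate.
Proof.
apply: measurable_funM; last exact: measurable_indic.
by apply: measurableT_comp => //; exact: measurable_mixture_density.
Qed.

Lemma mixture_rate_ge0 s : 0 <= mixture_rate s.
Proof. by rewrite mulr_ge0// fine_ge0// mixture_density_ge0. Qed.

Lemma mixture_rateE (s : R) : 0 < s -> ((mixture_rate s)%:E = mixture_density delta q s)%E.
Proof.
move=> s0; rewrite /mixture_rate indicE mem_set/= ?in_itv/= ?s0// mulr1 fineK//.
rewrite ge0_fin_numE ?mixture_density_ge0//.
by apply: le_lt_trans (mixture_density_le s0) _; rewrite ltry.
Qed.

Definition mixture_exponent (w : R) : R :=
  fine (\int[mu]_(s in `]0%R, +oo[) ((1 - expR (- (w * s))) * mixture_rate s)%:E).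

Lemma mixture_exponent_le_EFin (w : R) : 0 <= w ->
  (\int[mu]_(s in `]0%R, +oo[) ((1 - expR (- (w * s))) * mixture_rate s)%:E <=
   (ln (1 + w / delta))%:E)%E.
Proof.
move=> w0; rewrite -frullani//; apply: ge0_le_integral => //=.
- move=> s; rewrite in_itv/= andbT => s0.
  by rewrite lee_fin mulr_ge0 ?le1 ?mixture_rate_ge0.
- by apply: mint; apply: measurable_funTS; exact: measurable_mixture_rate.
- by apply: mint; exact: measurable_gamma_density.
- move=> s; rewrite in_itv/= andbT => s0; rewrite lee_fin ler_wpM2l ?le1//.
  by rewrite -lee_fin mixture_rateE// mixture_density_le.
Qed.

Lemma mixture_exponentE (w : R) : 0 <= w ->
  (\int[mu]_(s in `]0%R, +oo[) ((1 - expR (- (w * s))) * mixture_rate s)%:E =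
   (mixture_exponent w)%:E)%E.
Proof.
move=> w0; rewrite fineK// ge0_fin_numE.
  by apply: le_lt_trans (mixture_exponent_le_EFin w0) _; rewrite ltry.
apply: integral_ge0 => s; rewrite /= in_itv/= andbT => s0.
by rewrite lee_fin mulr_ge0 ?le1 ?mixture_rate_ge0.
Qed.

(** From [ln (1 + y) <= y] at [y = w / delta]: the linear bound that makes the jumps summable. *)
Lemma mixture_exponent_le (w : R) : 0 <= w -> mixture_exponent w <= delta^-1 * w.
Proof.
move=> w0; rewrite -lee_fin -mixture_exponentE//.
apply: le_trans (mixture_exponent_le_EFin w0) _; rewrite lee_fin mulrC.
apply: le_ln1Dx; apply: (@lt_le_trans _ _ 0); first by rewrite ltrN10.
by rewrite mulr_ge0// invr_ge0 ltW.
Qed.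

Lemma mixture_exponent_EFin (w : R) : 0 <= w ->
  (\int[mu]_(s in `]0%R, +oo[) ((1 - expR (- (w * s)))%:E * mixture_density delta q s) =
   (mixture_exponent w)%:E)%E.
Proof.
move=> w0; rewrite -mixture_exponentE//; apply: eq_integral => s.
by rewrite inE/= in_itv/= andbT => s0; rewrite EFinM mixture_rateE.
Qed.

End mixture.

Lemma mixture_exponentD (q : R -> R) (w : R) :
  measurable_fun `[delta, +oo[ q -> (forall x, delta <= x -> 0 <= q x <= 1) -> 0 <= w ->
  mixture_exponent (fun x => 1 - q x) w + mixture_exponent q w = ln (1 + w / delta).
Proof.
move=> mq q01 w0.
have mq' : measurable_fun `[delta, +oo[ (fun x => 1 - q x) by exact: measurable_funB.
have q01' x : delta <= x -> 0 <= 1 - q x <= 1.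
  by move=> /q01/andP[q0 q1]; rewrite subr_ge0 q1 gerBl.
apply: EFin_inj; rewrite EFinD -(mixture_exponentE mq' q01' w0) -(mixture_exponentE mq q01 w0)
  -(frullani w0) -ge0_integralD//=.
- apply: eq_integral => s; rewrite inE/= in_itv/= andbT => s0.
  rewrite -EFinD -mulrDr; congr (_ * _)%:E.
  by apply: EFin_inj; rewrite EFinD !mixture_rateE// mixture_densityD.
- move=> s; rewrite in_itv/= andbT => s0; rewrite lee_fin.
  by apply: mulr_ge0; [exact: le1|exact: mixture_rate_ge0].
- by apply: mint; apply: measurable_funTS; exact: measurable_mixture_rate.
- move=> s; rewrite in_itv/= andbT => s0; rewrite lee_fin.
  by apply: mulr_ge0; [exact: le1|exact: mixture_rate_ge0].
- by apply: mint; apply: measurable_funTS; exact: measurable_mixture_rate.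
Qed.

End gamma_exponent.

(** * Gamma laws and their Laplace transforms *)

Section gamma_laws.
Context (R : realType).
Local Notation mu := (@lebesgue_measure R).

Let gamma_kernel (t x : R) : R := x `^ (t - 1) * expR (- x).

Let mgamma_kernel t : measurable_fun setT (gamma_kernel t).
Proof. by apply: measurable_funM => //; exact: measurableT_comp. Qed.

Let gamma_kernel_ge0 t x : 0 <= gamma_kernel t x.
Proof. by rewrite mulr_ge0 ?powR_ge0 ?expR_ge0. Qed.

(** The power is singular at 0 when [t < 1]. On [[1 / (n + 2), 1]] the antiderivative [x^t / t]
    applies, and these intervals increase to []0, 1]]. *)
Lemma integral_powR_le (t : R) : 0 < t ->
  (\int[mu]_(x in `]0%R, 1%R]) (x `^ (t - 1))%:E <= (t^-1)%:E)%E.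
Proof.
move=> t0; pose F n : set R := `[n.+2%:R^-1, 1%R]%classic.
have FE : \bigcup_n F n = `]0%R, 1%R]%classic.
  apply/seteqP; split => x /=.
    move=> [n _]; rewrite /F/= !in_itv/= => /andP[nx ->]; rewrite andbT.
    by apply: lt_le_trans nx; rewrite invr_gt0 ltr0n.
  rewrite in_itv/= => /andP[x0 x1]; exists (Num.truncn x^-1) => //.
  rewrite /F/= in_itv/= x1 andbT invf_ple ?posrE ?ltr0n//.
  by rewrite ltW// (lt_trans (truncnS_gt _))// ltr_nat.
have mf : measurable_fun setT (fun x : R => (x `^ (t - 1))%:E).
  by apply/measurable_EFinP.
have step n : (\int[mu]_(x in F n) (x `^ (t - 1))%:E <= (t^-1)%:E)%E.
  have n0 : 0 < n.+2%:R^-1 :> R by rewrite invr_gt0 ltr0n.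
  have n1 : n.+2%:R^-1 < 1 :> R by rewrite invf_lt1 ?ltr0n// ltr1n.
  have pos (x : R) : n.+2%:R^-1 <= x -> 0 < x by exact: lt_le_trans.
  have dF (x : R) : 0 < x -> is_derive x 1 (fun x => t^-1 * x `^ t) (x `^ (t - 1)).
    move=> x0; have := is_deriveZ t^-1 (is_derive1_powR t x0).
    by rewrite [X in is_derive _ _ _ X]/GRing.scale/= mulrA mulVf ?mul1r// gt_eqF.
  have cF (x : R) : 0 < x -> {for x, continuous (fun x => t^-1 * x `^ t)}.
    move=> x0; apply: differentiable_continuous; apply/derivable1_diffP.
    by have [] := dF x x0.
  rewrite (@continuous_FTC2 _ _ (fun x => t^-1 * x `^ t))//.
  - by rewrite powR1 mulr1 -EFinB lee_fin gerBl mulr_ge0 ?powR_ge0// invr_ge0 ltW.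
  - apply: continuous_in_subspaceT => x; rewrite inE/= in_itv/= => /andP[/pos x0 _].
    by apply: differentiable_continuous; apply/derivable1_diffP; apply: derivable_powR;
      rewrite in_itv/= andbT.
  - split.
    + by move=> x; rewrite in_itv/= => /andP[/ltW/pos/dF[]].
    + by apply: cvg_at_right_filter; exact: cF.
    + by apply: cvg_at_left_filter; exact: cF.
  - move=> x; rewrite in_itv/= => /andP[/ltW/pos x0 _].
    by rewrite derive1E; apply: derive_val; exact: dF.
rewrite -FE.
have cv : (\int[mu]_(x in F n) (x `^ (t - 1))%:E @[n --> \oo] -->
    \int[mu]_(x in \bigcup_n F n) (x `^ (t - 1))%:E)%E.
  apply: ge0_nondecreasing_set_cvg_integral.
  - move=> m n mn; apply/subsetPset => x; rewrite /F/= !in_itv/= => /andP[mx ->].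
    by rewrite andbT (le_trans _ mx)// lef_pV2 ?posrE ?ltr0n// ler_nat !ltnS.
  - by move=> n; exact: measurable_itv.
  - by move=> n; exact: measurable_funTS.
  - by move=> n x _; rewrite lee_fin powR_ge0.
rewrite -(cvg_lim _ cv)//; apply: lime_le; first by apply/cvg_ex; eexists; exact: cv.
by apply: nearW => n; exact: step.
Qed.

(** Beyond 1, [ln y <= y] at [y = x / (2 t)] gives [t ln x <= t ln (2 t) + x / 2], so half of the
    exponential decay remains. *)
Let gamma_kernel_le (t x : R) : 0 < t -> 0 < x ->
  gamma_kernel t x <= x `^ (t - 1) * \1_(`]0%R, 1%R]%classic) x +
                      expR (t * ln (2 * t)) * expR (- (2^-1 * x)).
Proof.
move=> t0 x0; rewrite /gamma_kernel indicE; case: (leP x 1) => x1.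
  rewrite mem_set/= ?in_itv/= ?x0// mulr1 -[leLHS]addr0 lerD//.
    by rewrite -[leRHS]mulr1 ler_wpM2l ?powR_ge0// -expR0 ler_expR oppr_le0 ltW.
rewrite memNset/=; last by rewrite in_itv/= x0/= leNgt x1.
rewrite mulr0 add0r.
apply: (@le_trans _ _ (x `^ t * expR (- x))).
  by rewrite ler_wpM2r ?expR_ge0// ler_powR ?(ltW x1)// gerBl.
rewrite /powR gt_eqF// -!expRD ler_expR.
have t2 : 0 < 2 * t by rewrite mulr_gt0.
have : t * ln x <= t * (ln (2 * t) + x / (2 * t)).
  apply: ler_wpM2l; first exact: ltW.
  have xt : 0 < x / (2 * t) by rewrite divr_gt0.
  rewrite (_ : ln x = ln (2 * t) + ln (x / (2 * t))) ?lerD2l ?ltW ?ln_sublinear//.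
  by rewrite -lnM ?posrE// mulrC divfK// gt_eqF.
rewrite mulrDr (_ : t * (x / (2 * t)) = 2^-1 * x); last by field; rewrite gt_eqF.
lra.
Qed.

(** [Gamma_fun] is the [fine] of an integral and equals it only if the integral is finite, which
    [gamma_kernel_le] provides. *)
Lemma gamma_kernel_fin (t : R) : 0 < t ->
  (\int[mu]_(x in `]0%R, +oo[) (x `^ (t - 1) * expR (- x))%:E = (Gamma_fun t)%:E)%E.
Proof.
move=> t0; rewrite /Gamma_fun /Rintegral fineK// ge0_fin_numE; last first.
  by apply: integral_ge0 => x _; rewrite lee_fin gamma_kernel_ge0.
have m1 : measurable_fun setT (fun x : R => x `^ (t - 1) * \1_(`]0%R, 1%R]%classic) x).
  by apply: measurable_funM => //; exact: measurable_indic.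
have m2 : measurable_fun setT (fun x : R => expR (- (2^-1 * x))).
  by apply: measurableT_comp => //; exact: measurableT_comp.
apply: (@le_lt_trans _ _ (\int[mu]_(x in `]0%R, +oo[)
  ((x `^ (t - 1) * \1_(`]0%R, 1%R]%classic) x)%:E +
   (expR (t * ln (2 * t)))%:E * (expR (- (2^-1 * x)))%:E)))%E.
  apply: ge0_le_integral => //=.
  - by move=> x _; rewrite lee_fin gamma_kernel_ge0.
  - by apply: measurable_funTS; apply/measurable_EFinP; exact: mgamma_kernel.
  - apply: measurable_funTS; apply: emeasurable_funD; first exact/measurable_EFinP.
    by apply/measurable_EFinP; exact: measurable_funM.
  - move=> x; rewrite in_itv/= andbT => x0; rewrite -EFinM -EFinD lee_fin.
    exact: gamma_kernel_le.
rewrite ge0_integralD//=.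
- rewrite ge0_integralZl//=; last by apply: measurable_funTS; exact/measurable_EFinP.
  rewrite integral_expN_oy// -EFinM; apply: (@le_lt_trans _ _ ((t^-1)%:E +
    (expR (t * ln (2 * t)) * 2^-1^-1)%:E)%E); last by rewrite -EFinD ltry.
  rewrite leeD2r//; apply: le_trans (integral_powR_le t0).
  rewrite [leLHS]integral_mkcond [leRHS]integral_mkcond.
  apply: ge0_le_integral => //=.
  + move=> x _; rewrite patchE; case: ifP => // _.
    by rewrite lee_fin mulr_ge0 ?powR_ge0// indicE.
  + apply/(measurable_restrictT _ _).1 => //.
    by apply: measurable_funTS; exact/measurable_EFinP.
  + apply/(measurable_restrictT _ _).1 => //.
    by apply: measurable_funTS; exact/measurable_EFinP.
  + move=> x _; rewrite !patchE indicE.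
    case: (x \in `]0, 1]%classic); case: (x \in `]0, +oo[%classic);
      by rewrite ?mulr1 ?mulr0// lee_fin powR_ge0.
- by move=> x _; rewrite lee_fin mulr_ge0 ?powR_ge0// indicE.
- by apply: measurable_funTS; exact/measurable_EFinP.
- by apply: measurable_funTS; apply/measurable_EFinP; exact: measurable_funM.
Qed.

Lemma Gamma_fun_gt0 (t : R) : 0 < t -> 0 < Gamma_fun t.
Proof.
move=> t0; rewrite -lte_fin -gamma_kernel_fin//.
(* On [[1, 2]] the kernel is at least [x^-1 * expR (- 2)], hence at least [c]. *)
pose c : R := 2^-1 * expR (- 2).
have c0 : 0 < c by rewrite mulr_gt0// expR_gt0.
apply: (@lt_le_trans _ _ (c%:E)); first by rewrite lte_fin.
apply: (@le_trans _ _ (\int[mu]_(x in `[1%R, 2%R]) c%:E)%E).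
  rewrite integral_cst// [X in (_ * X)%E]/= lebesgue_measure_itv/= lte_fin ltr1n -EFinB.
  by rewrite (_ : 2 - 1 = 1 :> R) ?mule1//; ring.
apply: (@le_trans _ _ (\int[mu]_(x in `[1%R, 2%R]) (gamma_kernel t x)%:E)%E).
  apply: ge0_le_integral => //=.
  - by move=> x _; rewrite lee_fin ltW.
  - by apply: measurable_funTS; apply/measurable_EFinP; exact: mgamma_kernel.
  move=> x; rewrite in_itv/= => /andP[x1 x2]; rewrite lee_fin /c.
  apply: ler_pM; rewrite ?expR_ge0//; last by rewrite ler_expR lerN2.
  have x0 : 0 < x by exact: lt_le_trans x1.
  apply: (@le_trans _ _ (x `^ (-1))); last by rewrite ler_powR// lerBrDr addNr ltW.
  by rewrite powR_inv1 ?(ltW x0)// lef_pV2// posrE.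
apply: ge0_subset_integral => //=.
- by apply: measurable_funTS; apply/measurable_EFinP; exact: mgamma_kernel.
- by move=> x _; rewrite lee_fin gamma_kernel_ge0.
- by move=> x /=; rewrite !in_itv/= andbT => /andP[x1 _]; exact: lt_le_trans x1.
Qed.

(** Substitution of [x / c] for [x]; the factor [expR (- (t * ln c))] is [c] to the power [- t]. *)
Lemma gamma_kernel_scale (t c : R) : 0 < t -> 0 < c ->
  (\int[mu]_(x in `]0%R, +oo[) (x `^ (t - 1) * expR (- (c * x)))%:E =
   (expR (- (t * ln c)) * Gamma_fun t)%:E)%E.
Proof.
move=> t0 c0; have ci0 : 0 < c^-1 by rewrite invr_gt0.
have mf : measurable_fun setT (fun x : R => (x `^ (t - 1) * expR (- (c * x)))%:E).
  apply/measurable_EFinP; apply: measurable_funM => //.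
  by apply: measurableT_comp => //; exact: measurableT_comp.
rewrite (@ge0_integral_affine _ c^-1 0)//; last 2 first.
- exact: measurable_funTS.
- by move=> x _; rewrite lee_fin mulr_ge0 ?powR_ge0 ?expR_ge0.
rewrite (_ : _ @^-1` _ = `]0%R, +oo[%classic); last first.
  by apply/seteqP; split => x /=; rewrite !in_itv/= !andbT addr0 pmulr_rgt0.
rewrite EFinM -(gamma_kernel_fin t0).
transitivity ((c^-1)%:E * \int[mu]_(x in `]0%R, +oo[)
    ((c^-1 `^ (t - 1))%:E * (x `^ (t - 1) * expR (- x))%:E))%E.
  congr (_ * _)%E; apply: eq_integral => x; rewrite inE/= in_itv/= andbT => x0.
  rewrite -EFinM !addr0 powRM ?(ltW ci0) ?(ltW x0)// (mulrA c) divff ?gt_eqF// mul1r.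
  by rewrite mulrA.
rewrite ge0_integralZl//=; last 3 first.
- by apply: measurable_funTS; apply/measurable_EFinP; exact: mgamma_kernel.
- by move=> x _; rewrite lee_fin gamma_kernel_ge0.
- by rewrite lee_fin powR_ge0.
rewrite muleA -EFinM mulr_powRB1 ?(ltW ci0)//; congr (_%:E * _)%E.
by rewrite /powR gt_eqF// lnV ?posrE// mulrN.
Qed.

Let gamma_pdf (t x : R) : R := gamma_kernel t x / Gamma_fun t * \1_(`]0%R, +oo[%classic) x.

Let mgamma_pdf t : measurable_fun setT (gamma_pdf t).
Proof.
apply: measurable_funM; last exact: measurable_indic.
by apply: measurable_funM => //; exact: mgamma_kernel.
Qed.

Let Gamma_fun_ge0 (t : R) : 0 <= Gamma_fun t.
Proof. by apply: Rintegral_ge0 => x _; exact: gamma_kernel_ge0. Qed.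

Let gamma_pdf_ge0 t x : 0 <= gamma_pdf t x.
Proof. by rewrite mulr_ge0// divr_ge0. Qed.

(** [gamma_law] as a measure, to which [laplace_unique] can be applied. *)
Let gamma_measure (t : R) := density_measure mu (mgamma_pdf t) (gamma_pdf_ge0 t).

Let gamma_measureE (t : R) (A B : set R) :
  (forall x, 0 < x -> A x <-> B x) -> gamma_measure t A = gamma_law t B.
Proof.
move=> AB; rewrite [LHS]/= /density_measure /gamma_law [LHS]integral_mkcond [RHS]integral_mkcond.
apply: eq_integral => x _; rewrite !patchE in_setI /gamma_pdf indicE.
have [xI|xI] := boolP (x \in `]0, +oo[%classic); last first.
  by rewrite andbF mulr0; case: ifP.
have x0 : 0 < x by move: xI; rewrite inE/= in_itv/= andbT.
rewrite andbT mulr1; case: ifPn => xA.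
  by rewrite mem_set//; apply/AB => //; rewrite -inE.
rewrite memNset// => Bx; move: xA; rewrite notin_setE; apply; exact/(AB x x0).
Qed.

Let integral_gamma_measure (t : R) (f : R -> \bar R) : measurable_fun setT f ->
  (forall x, 0 <= f x)%E -> (\int[gamma_measure t]_x f x =
  \int[mu]_(x in `]0%R, +oo[) (f x * (gamma_kernel t x / Gamma_fun t)%:E))%E.
Proof.
move=> mf f0; rewrite integral_density_measure// [RHS]integral_mkcond.
apply: eq_integral => x _; rewrite patchE /gamma_pdf indicE.
by case: ifP => _; rewrite ?mulr1// mulr0 mule0.
Qed.

Variable delta : R.
Hypothesis delta_gt0 : 0 < delta.

Let mscale : measurable_fun setT (fun x : measurableTypeR R => `|x| / delta : R).
Proof. by apply: measurable_funM => //; exact: normr_measurable. Qed.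

Let scale_ge0 (x : R) : 0 <= `|x| / delta.
Proof. by rewrite divr_ge0// ltW. Qed.

(** Multiplying the kernel by the exponential changes its rate to [1 + w / delta]. The absolute
    value serves [laplace_unique], which asks for a variable that is nonnegative everywhere. *)
Let gamma_measure_laplace (t w : R) : 0 < t -> 0 <= w ->
  (\int[gamma_measure t]_x (expR (- (w * (`|x| / delta))))%:E =
   (expR (- (t * ln (1 + w / delta))))%:E)%E.
Proof.
move=> t0 w0; have c0 : 0 < 1 + w / delta by rewrite ltr_wpDr// divr_ge0// ltW.
have G0 := Gamma_fun_gt0 t0.
rewrite integral_gamma_measure; last 2 first.
- apply/measurable_EFinP; apply: measurableT_comp => //; apply: measurableT_comp => //.
  by apply: measurable_funM => //; exact: mscale.
- by move=> x; rewrite lee_fin expR_ge0.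
have := gamma_kernel_scale t0 c0.
move/(congr1 (fun y => (Gamma_fun t)^-1%:E * y)%E).
rewrite -[RHS]EFinM (mulrC (expR _)) mulKf ?gt_eqF// => <-.
rewrite -ge0_integralZl//=; last 3 first.
- apply: measurable_funTS; apply/measurable_EFinP; apply: measurable_funM => //.
  by apply: measurableT_comp => //; exact: measurableT_comp.
- by move=> x _; rewrite lee_fin mulr_ge0 ?powR_ge0 ?expR_ge0.
- by rewrite lee_fin invr_ge0.
apply: eq_integral => x; rewrite inE/= in_itv/= andbT => x0.
rewrite -!EFinM; congr EFin; rewrite gtr0_norm// /gamma_kernel.
rewrite (_ : - ((1 + w / delta) * x) = - (w * (x / delta)) - x) ?expRD; last by ring.
by ring.
Qed.

Let gamma_measure_lty (t : R) : 0 < t -> (gamma_measure t setT < +oo)%E.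
Proof.
move=> t0; have := gamma_measure_laplace t0 (lexx 0).
under eq_integral do rewrite mul0r oppr0 expR0.
rewrite integral_cst// mul1e => E.
apply: (@eq_ind_r _ _ (fun y => (y < +oo)%E) _ _ E); exact: ltry.
Qed.

Section variable.
Context d (T : measurableType d) (P : probability T R) (X : T -> R) (t : R).
Hypotheses (t_gt0 : 0 < t) (mX : measurable_fun setT X) (X_ge0 : forall x, 0 <= X x).

Lemma gamma_law_laplace (w : R) : 0 <= w ->
  (forall A, measurable A -> P (X @^-1` A) = gamma_law t ((fun x => x / delta) @^-1` A)) ->
  \int[P]_x expR (- (w * X x)) = expR (- (t * ln (1 + w / delta))).
Proof.
move=> w0 PX; apply: (@congr1 _ _ fine _ (expR (- (t * ln (1 + w / delta))))%:E).
rewrite -gamma_measure_laplace//.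
have mE : measurable_fun setT (fun y : R => (expR (- (w * y)))%:E).
  by apply/measurable_EFinP; apply: measurableT_comp => //; exact: measurableT_comp.
have E0 y : (0 <= (expR (- (w * y)))%:E :> \bar R)%E by rewrite lee_fin expR_ge0.
apply: etrans (esym (integral_image_measure P mX mE E0)) _.
apply: etrans _ (integral_image_measure (gamma_measure t) mscale mE E0).
apply: eq_measure_integral => A mA _; rewrite [LHS]/= /image_measure /pushforward PX//.
rewrite [RHS]/= /image_measure /pushforward; apply/esym/gamma_measureE => x x0.
by rewrite /preimage/= gtr0_norm.
Qed.

(** Converse of [gamma_law_laplace], from integer rates, which are all that [laplace_unique] asks
    for. *)
Lemma laplace_gamma_law :
  (forall k : nat, \int[P]_x expR (- (k%:R * X x)) = expR (- (t * ln (1 + k%:R / delta)))) ->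
  forall A, measurable A -> P (X @^-1` A) = gamma_law t ((fun x => x / delta) @^-1` A).
Proof.
move=> PX A mA; rewrite -(@gamma_measureE t ((fun x => `|x| / delta) @^-1` A)); last first.
  by move=> x x0; rewrite /preimage/= gtr0_norm.
apply: laplace_unique => //; first exact: probability_lty.
  exact: gamma_measure_lty.
by move=> k; rewrite PX [RHS]/Rintegral gamma_measure_laplace.
Qed.

End variable.
End gamma_laws.

(** * The decomposition *)

Section processes.
Context (R : realType).
Local Notation mu := (@lebesgue_measure R).
Local Notation U := (uniform01 R).

Section one_process.
Context d (T : measurableType d) (P : probability T R).
Variables (X : R -> T -> R) (rho : R -> \bar R) (psi : R -> R).
Hypothesis psiE : forall w : R, 0 <= w ->
  (\int[mu]_(s in `]0%R, +oo[) ((1 - expR (- (w * s)))%:E * rho s) = (psi w)%:E)%E.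

Let unit_expN (t w : R) : measurable_fun setT (X t) -> (forall x, 0 <= X t x) ->
  0 <= w -> unit_fun (fun x => expR (- (w * X t x))).
Proof.
move=> mX X_ge0 w0; split.
  apply: measurableT_comp => //; apply: measurableT_comp => //.
  exact: measurable_funM.
by move=> x; rewrite expR_ge0/= -[leRHS]expR0 ler_expR oppr_le0 mulr_ge0.
Qed.

Lemma subordinator_laplace : subordinator P X rho -> laplace_increments P X psi.
Proof.
move=> [[mX X0 Xh _ [sX iX]] [_ _ LX]].
apply: (levy_laplace_increments mX X0 Xh sX iX) => w t w0 t0.
have Xt0 x : 0 <= X t x by rewrite -(X0 x); exact: Xh.
have := LX w t w0 t0; rewrite psiE// -EFinM -EFinN unlock.
rewrite -(EFin_unit_integral (probability_lty P) (unit_expN (mX t t0) Xt0 w0)) => E.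
exact: EFin_inj.
Qed.

Hypotheses (mX : forall t : R, 0 <= t -> measurable_fun setT (X t)).
Hypothesis X0 : forall x, X 0 x = 0.
Hypothesis X_homo : forall x (s t : R), 0 <= s -> s <= t -> X s x <= X t x.
Hypothesis X_rc : forall x (t : R), 0 <= t -> X u x @[u --> t^'+] --> X t x.
Hypothesis LIX : laplace_increments P X psi.

Lemma laplace_increasing_levy : increasing_levy_process P X.
Proof.
split => //; split.
  exact: (laplace_increments_stationary mX X0 X_homo LIX).
exact: (laplace_increments_independent mX X_homo LIX).
Qed.

Lemma laplace_subordinator : measurable_fun (`]0, +oo[ : set R) rho ->
  (forall s, 0 < s -> (0 <= rho s)%E) -> subordinator P X rho.
Proof.
move=> mrho rho0; split; first exact: laplace_increasing_levy.
split => // w t w0 t0.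
have Xt0 x : 0 <= X t x by rewrite -(X0 x); exact: X_homo.
rewrite psiE// -EFinM -EFinN unlock.
rewrite -(EFin_unit_integral (probability_lty P) (unit_expN (mX t0) Xt0 w0)).
by congr EFin; exact: (laplace_marginal X0 LIX).
Qed.

End one_process.

Lemma gamma_subordinator_laplace d (T : measurableType d) (P : probability T R)
    (delta : R) (G : R -> T -> R) : 0 < delta ->
  gamma_subordinator P delta G -> laplace_increments P G (fun w => ln (1 + w / delta)).
Proof.
move=> d0 [[mG G0 Gh _ [sG iG]] GE].
apply: (levy_laplace_increments mG G0 Gh sG iG) => w t w0.
rewrite le_eqVlt => /predU1P[<-|t0].
  (* Time 0 is apart: the gamma law is prescribed at positive times only, and the process starts at
     0. *)
  under eq_Rintegral do rewrite G0 mulr0 oppr0 expR0.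
  rewrite mul0r oppr0 expR0 (Rintegral_cst P)// mul1r.
  exact: (congr1 fine (probability_setT P)).
by apply: (gamma_law_laplace d0 t0 (mG t (ltW t0))) => //; exact: GE.
Qed.

Lemma laplace_gamma_subordinator d (T : measurableType d) (P : probability T R)
    (delta : R) (G : R -> T -> R) : 0 < delta -> increasing_levy_process P G ->
  laplace_increments P G (fun w => ln (1 + w / delta)) -> gamma_subordinator P delta G.
Proof.
move=> d0 levyG LG; split => // t t0 A mA.
have [mG G0 Gh _ _] := levyG.
apply: (laplace_gamma_law d0 t0 (mG t (ltW t0))) => //.
  by move=> x; rewrite -(G0 x); apply: Gh => //; exact: ltW.
move=> k; apply: (laplace_marginal G0 LG) => //; exact: ltW.
Qed.

(** Preimages under [p] of measurable sets form a sigma-algebra that contains the generating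
    events. *)
Lemma process_sigma_algebra_comp d d' (T : measurableType d) (T' : measurableType d')
    (X : R -> T -> R) (p : T' -> T) (E : set T') :
  (forall t, 0 <= t -> measurable_fun setT (X t)) ->
  process_sigma_algebra (fun t => X t \o p) E ->
  exists2 A, measurable A & E = p @^-1` A.
Proof.
move=> mX; pose S := [set E : set T' | exists2 A, measurable A & E = p @^-1` A].
suff sub : process_sigma_algebra (fun t => X t \o p) `<=` S by exact: sub.
apply: smallest_sub; last first.
  move=> _ [t [A [t0 mA ->]]]; exists (X t @^-1` A) => //.
  by rewrite -[X in measurable X]setTI; exact: mX.
split.
- by exists set0; rewrite ?preimage_set0.
- by move=> _ [A mA ->]; exists (~` A); [exact: measurableC|rewrite setTD preimage_setC].
- move=> F SF; have /choice[A FA] n : exists A, measurable A /\ F n = p @^-1` A.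
    by have [A mA ->] := SF n; exists A.
  exists (\bigcup_n A n); first by apply: bigcupT_measurable => n; have [] := FA n.
  by rewrite preimage_bigcup; apply: eq_bigcupr => n _; have [] := FA n.
Qed.

Section product_space.
Context d (T : measurableType d) (P : probability T R).
Context d2 (T2 : measurableType d2) (Q : probability T2 R).

Lemma extension_of_space_fst : extension_of_space (P \x Q)%E P fst.
Proof.
split=> // A mA; rewrite (_ : fst @^-1` A = A `*` setT); last first.
  by apply/seteqP; split => z //= -[].
rewrite [LHS]/= product_measure1E//.
by apply: etrans (congr1 (fun y => P A * y)%E (probability_setT Q)) _; rewrite mule1.
Qed.

(** Events of the two processes are cylinders over the two factors, and they meet in a rectangle. *)
Lemma independent_processes_prod (X : R -> T -> R) (Y : R -> T2 -> R) :
  (forall t, 0 <= t -> measurable_fun setT (X t)) ->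
  (forall t, 0 <= t -> measurable_fun setT (Y t)) ->
  independent_processes (P \x Q)%E (fun t => X t \o fst) (fun t => Y t \o snd).
Proof.
move=> mX mY E F /(process_sigma_algebra_comp mX)[A mA ->].
move=> /(process_sigma_algebra_comp mY)[B mB ->].
rewrite (extension_of_space_fst.2 A mA).
have PQB : (P \x Q)%E (snd @^-1` B) = Q B.
  rewrite (_ : snd @^-1` B = setT `*` B); last by apply/seteqP; split => z //= -[].
  rewrite [LHS]/= product_measure1E//.
  by apply: etrans (congr1 (fun y => y * Q B)%E (probability_setT P)) _; rewrite mul1e.
apply: etrans _ (congr1 (fun y => P A * y)%E (esym PQB)).
by rewrite [LHS]/= product_measure1E.
Qed.

(** [Y] is its own sum with the zero process on the first factor, so [laplace_increments_sum]
    applies. *)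
Lemma laplace_increments_snd (Y : R -> T2 -> R) (psi : R -> R) :
  (forall t : R, 0 <= t -> measurable_fun setT (Y t)) ->
  (forall x (s t : R), 0 <= s -> s <= t -> Y s x <= Y t x) ->
  laplace_increments Q Y psi -> laplace_increments (P \x Q)%E (fun t z => Y t z.2) psi.
Proof.
move=> mY Yh LY.
have L0 : laplace_increments P (fun _ _ => 0) (fun=> 0).
  move=> n t w _ _ _; transitivity (\int[P]_x (1 : R)).
    apply: eq_Rintegral => x _; rewrite big1 => [|i _]; first by rewrite oppr0 expR0.
    by rewrite subrr mulr0.
  rewrite big1 ?oppr0 ?expR0; last by move=> i _; rewrite mulr0.
  rewrite (Rintegral_cst P)// mul1r; exact: (congr1 fine (probability_setT P)).
have := laplace_increments_sum (X1 := fun _ _ => 0) _ _ mY Yh L0 LY.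
rewrite (_ : (fun t z => Y t z.2 + 0) = (fun t z => Y t z.2)); last first.
  by apply/funext => t; apply/funext => z; rewrite addr0.
rewrite (_ : (fun w => psi w + 0) = psi); last by apply/funext => w; rewrite addr0.
by apply.
Qed.

Lemma subordinator_snd (Y : R -> T2 -> R) (rho : R -> \bar R) (psi : R -> R) :
  (forall w : R, 0 <= w ->
    (\int[mu]_(s in `]0%R, +oo[) ((1 - expR (- (w * s)))%:E * rho s) = (psi w)%:E)%E) ->
  subordinator Q Y rho -> subordinator (P \x Q)%E (fun t z => Y t z.2) rho.
Proof.
move=> psiE subY; have [[mY Y0 Yh Yrc _] [mrho rho0 _]] := subY.
have LY := subordinator_laplace psiE subY.
have mY2 (t : R) : 0 <= t -> measurable_fun setT (fun z : T * T2 => Y t z.2).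
  by move=> t0; exact: measurableT_comp (mY t t0) measurable_snd.
apply: (laplace_subordinator psiE mY2 _ _ _ (laplace_increments_snd mY Yh LY) mrho rho0).
- by move=> z; exact: Y0.
- by move=> z; exact: Yh.
- by move=> z; exact: Yrc.
Qed.

End product_space.
End processes.

(** The mixing measure has density [q] on [[delta, +oo[] and 0 elsewhere; since [delta > 0], it is
    carried by the half-line of Bondesson's representation. *)
Lemma bondesson_mixture (R : realType) d (T : measurableType d) (P : probability T R)
    (X : R -> T -> R) (delta : R) (q : R -> R) : 0 < delta ->
  measurable_fun `[delta, +oo[ q -> (forall x, delta <= x -> 0 <= q x <= 1) ->
  subordinator P X (mixture_density delta q) -> bondesson P X.
Proof.
move=> d0 mq q01 subX.
(* [lebesgue_measure] lives on [measurableTypeR R], whose display is not that of [R]. *)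
have mid : measurable_fun setT (id : measurableTypeR R -> R) by exact: measurable_id.
pose m0 : {measure set (measurableTypeR R) -> \bar R} :=
  density_measure (@lebesgue_measure R) (measurable_mixing_weight mq) (mixing_weight_ge0 q01).
pose m : {measure set R -> \bar R} := image_measure m0 mid.
exists m, (mixture_density delta q); split => // s s0.
have mE : measurable_fun setT (fun y : R => (expR (- (s * y)))%:E).
  by apply/measurable_EFinP; apply: measurableT_comp => //; exact: measurableT_comp.
have mE0 : measurable_fun setT
    ((fun y : R => (expR (- (s * y)))%:E) \_ `[0%R, +oo[%classic).
  by apply/(measurable_restrictT _ _).1 => //; exact: measurable_funTS.
have E0 (y : R) : (0 <= ((fun y : R => (expR (- (s * y)))%:E) \_ `[0%R, +oo[%classic) y)%E.
  by rewrite patchE; case: ifP => // _; rewrite lee_fin expR_ge0.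
rewrite integral_mkcond; apply: etrans _ (esym (integral_image_measure m0 mid mE0 E0)).
apply: etrans _ (esym (integral_density_measure (@lebesgue_measure R)
  (measurable_mixing_weight mq) (mixing_weight_ge0 q01) mE0 E0)).
rewrite mixture_densityE; apply: eq_integral => x _; rewrite patchE.
case: ifPn => [_|x0]; first by rewrite EFinM.
rewrite mul0e /mixing_weight patchE memNset ?mulr0// => /=.
rewrite in_itv/= andbT => dx; move/negP: x0; apply; rewrite inE/= in_itv/= andbT.
exact: le_trans (ltW d0) dx.
Qed.

Theorem theorem6p1 (R : realType) (delta : R) (q : R -> R)
    (d : measure_display) (T : measurableType d) (P : probability T R)
    (Omega : R -> T -> R)
    (delta_gt0 : 0 < delta)
    (q_meas : measurable_fun `[delta, +oo[ q)
    (q_ge0 : forall x, delta <= x -> 0 <= q x)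
    (q_le1 : forall x, delta <= x -> q x <= 1)
    (Omega_B : bondesson P Omega)
    (Omega_density : subordinator P Omega (mixture_density delta q)) :
  [/\ (forall (d1 : measure_display) (T1 : measurableType d1)
         (P1 : probability T1 R) (G : R -> T1 -> R),
         gamma_subordinator P1 delta G ->
         subordinator P1 G (fun s => (s^-1 * expR (- (s * delta)))%:E)),
      (forall s, 0 < s ->
         (s^-1 * expR (- (s * delta)))%:E =
         (mixture_density delta (fun x => (1 - q x)%R) s
          + mixture_density delta q s)%E) &
      exists (d' : measure_display) (T' : measurableType d')
        (P' : probability T' R) (p : T' -> T) (hatOmega : R -> T' -> R),
        let Omega' := fun t => Omega t \o p in
        let total := fun t w => hatOmega t w + Omega' t w in
        [/\ extension_of_space P' P p,
            bondesson P' hatOmega /\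
            subordinator P' hatOmega
              (mixture_density delta (fun x => (1 - q x)%R)),
            independent_processes P' Omega' hatOmega,
            gamma_subordinator P' delta total /\
            (forall (d1 : measure_display) (T1 : measurableType d1)
               (P1 : probability T1 R) (G : R -> T1 -> R),
               gamma_subordinator P1 delta G -> eq_process_law P1 P' G total) &
            forall (theta : R), 0 < theta ->
              forall (d1 : measure_display) (T1 : measurableType d1)
                (P1 : probability T1 R) (g : T1 -> R),
                gamma_variable P1 g theta ->
                eq_law P1 P' (fun w => g w / delta) (total theta)]].
Proof.
have q01 x : delta <= x -> 0 <= q x <= 1 by move=> dx; rewrite q_ge0 ?q_le1.
have mq' : measurable_fun `[delta, +oo[ (fun x => 1 - q x) by exact: measurable_funB.
have q01' x : delta <= x -> 0 <= 1 - q x <= 1.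
  by move=> /q01/andP[q0 q1]; rewrite subr_ge0 q1 gerBl.
split.
(* Frullani's integral equates the exponent of the gamma law with that of the density. *)
- move=> d1 T1 P1 G gG; have [[mG G0 Gh Grc _] _] := gG.
  apply: (@laplace_subordinator _ _ _ _ _ _ (fun w => ln (1 + w / delta))) => //.
  + by move=> w w0; rewrite -(frullani delta_gt0 w0); apply: eq_integral => s _; rewrite EFinM.
  + exact: gamma_subordinator_laplace.
  + by apply/measurable_EFinP; exact: measurable_gamma_density.
  + by move=> s s0; rewrite lee_fin mulr_ge0 ?expR_ge0// invr_ge0 ltW.
- by move=> s s0; rewrite (mixture_densityD q_meas q01 s0).
pose rho := mixture_rate delta (fun x => 1 - q x).
pose psi := mixture_exponent delta (fun x => 1 - q x).
have mrho : measurable_fun setT rho by exact: measurable_mixture_rate.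
have Lhat : laplace_increments (uniform01 R) (levy_process rho) psi.
  apply: (levy_process_laplace (M := delta^-1)) => //.
  - exact: mixture_rate_ge0.
  - by move=> w w0; exact: mixture_exponentE.
  - by move=> w w0; exact: mixture_exponent_le.
have mhat (t : R) : 0 <= t ->
    measurable_fun setT (levy_process rho t : measurableTypeR R -> R).
  by move=> _; exact: measurable_levy_process.
have hat_homo z (s t : R) : 0 <= s -> s <= t -> levy_process rho s z <= levy_process rho t z.
  by move=> _; exact: levy_process_homo.
have [[mOm Om0 Om_homo Om_rc _] _] := Omega_density.
have LOm : laplace_increments P Omega (mixture_exponent delta q).
  by apply: (subordinator_laplace _ Omega_density) => w w0; exact: mixture_exponent_EFin.
pose hatOmega (t : R) (z : T * measurableTypeR R) := levy_process rho t z.2.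
pose total (t : R) (z : T * measurableTypeR R) := hatOmega t z + Omega t z.1.
(* The first factor carries [Omega] and the second the jumps of [hatOmega], whence their
   independence. *)
pose P' : probability _ R := (P \x uniform01 R)%E.
have mhatOmega (t : R) : 0 <= t -> measurable_fun setT (hatOmega t).
  by move=> t0; exact: measurableT_comp (mhat t t0) measurable_snd.
have mtotal (t : R) : 0 <= t -> measurable_fun setT (total t).
  move=> t0; apply: measurable_funD; first exact: mhatOmega.
  exact: measurableT_comp (mOm t t0) measurable_fst.
have total0 z : total 0 z = 0 by rewrite /total /hatOmega levy_process0 Om0 addr0.
have total_homo z (s t : R) : 0 <= s -> s <= t -> total s z <= total t z.
  by move=> s0 st; rewrite lerD ?hat_homo ?Om_homo.
have Ltotal : laplace_increments P' total (fun w => ln (1 + w / delta)).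
  move=> n t w t0 tnd w0.
  rewrite (laplace_increments_sum mOm Om_homo mhat hat_homo LOm Lhat)//.
  congr (expR (- _)); apply: eq_bigr => i _.
  by rewrite -(mixture_exponentD delta_gt0 q_meas q01 (w0 i)).
have gtotal : gamma_subordinator P' delta total.
  apply: (laplace_gamma_subordinator delta_gt0 _ Ltotal).
  apply: (laplace_increasing_levy mtotal total0 total_homo _ Ltotal) => z t t0.
  by apply: cvgD; [exact: levy_process_right_continuous|exact: Om_rc].
have psiE w (w0 : 0 <= w) := mixture_exponent_EFin delta_gt0 mq' q01' w0.
have sub_hat : subordinator (uniform01 R) (levy_process rho)
    (mixture_density delta (fun x => 1 - q x)).
  apply: (laplace_subordinator psiE mhat _ hat_homo _ Lhat).
  - exact: levy_process0.
  - by move=> z t _; exact: levy_process_right_continuous.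
  - by apply: measurable_funTS; exact: measurable_mixture_density.
  - by move=> s _; exact: mixture_density_ge0.
exists _, _, P', fst, hatOmega => /=; split.
- exact: extension_of_space_fst.
- have sub_hat' := subordinator_snd P psiE sub_hat.
  by split; [exact: (bondesson_mixture delta_gt0 mq' q01' sub_hat')|exact: sub_hat'].
- exact: (independent_processes_prod P _ mOm mhat).
- split; first exact: gtotal.
  move=> d1 T1 P1 G gG; have [[mG G0 Gh _ _] _] := gG.
  apply: (laplace_increments_eq_process_law mG G0 Gh mtotal total0 total_homo _ Ltotal).
  exact: gamma_subordinator_laplace.
- move=> theta theta0 d1 T1 P1 g [mg gE] A mA.
  (* Both laws are [gamma_law theta] of the rescaled set: one by [gtotal], the other by the
     hypothesis on [g]. *)
  rewrite (gtotal.2 theta theta0 A mA) -gE//.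
  rewrite -[X in measurable X]setTI; apply: measurable_funM => //.
Qed.
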